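(* Let $n\ge 1$ and let $\varphi:\mathbb{C}^n\to\mathbb{C}^n$ be a holomorphic mapping. Suppose that the composition operator $C_\varphi$ is compact on the Fock space $\mathcal{F}^2(\mathbb{C}^n)$. Then $C_\varphi$ belongs to the Schatten $p$-class $S_p$ of $\mathcal{F}^2(\mathbb{C}^n)$ for all $0<p<\infty$.
   Context: On $\mathbb{C}^n$ use the inner product $\langle z,w\rangle=\sum_{j=1}^n z_j\overline{w_j}$ and norm $|z|=\sqrt{\langle z,z\rangle}$. The Fock space $\mathcal{F}^2(\mathbb{C}^n)$ is the Hilbert space of all holomorphic functions $f:\mathbb{C}^n\to\mathbb{C}$ with $\|f\|^2=\left(\frac{1}{2\pi}\right)^n\int_{\mathbb{C}^n}|f(z)|^2e^{-|z|^2/2}\,dv(z)<\infty$, where $dv$ is Lebesgue volume measure on $\mathbb{C}^n$. The composition operator is $C_\varphi f=f\circ\varphi$; it is called compact if it maps $\mathcal{F}^2(\mathbb{C}^n)$ into itself and is a compact linear operator there. A compact operator $T$ on a separable Hilbert space $H$ belongs to the Schatten $p$-class $S_p=S_p(H)$, $0<p<\infty$, if the sequence of its singular values (the eigenvalues of $|T|=(T^*T)^{1/2}$, counted with multiplicity) belongs to $\ell^p$. *)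

(* Defs.v *)
From HB Require Import structures.
From mathcomp Require Import all_boot all_order all_algebra.
From mathcomp Require Import complex.
From mathcomp Require Import all_classical all_reals all_analysis.

Set Implicit Arguments.
Unset Strict Implicit.
Unset Printing Implicit Defensive.

Import Order.TTheory GRing.Theory Num.Theory.
Import numFieldNormedType.Exports.

Local Open Scope classical_set_scope.
Local Open Scope ring_scope.

(* R[i] is packaged as a numClosedFieldType so that the norm topology which
   mathcomp-analysis attaches to an abstract numFieldType is inferred for it. *)
Definition cplx (R : realType) : numClosedFieldType := complex R.

Definition of_real (R : realType) (x : R) : cplx R := Complex x 0.

Notation Cn R n := 'rV[cplx R]_n.

Section product_sigma_finite.
Context d1 d2 (T1 : measurableType d1) (T2 : measurableType d2) (R : realType).
Variable m1 : {sigma_finite_measure set T1 -> \bar R}.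
Variable m2 : {sigma_finite_measure set T2 -> \bar R}.

Lemma sigma_finite_product : sigma_finite setT (m1 \x m2)%E.
Proof.
have /sigma_finiteP[F [TF ndF Foo]] := sigma_finiteT m1.
have /sigma_finiteP[G [TG ndG Goo]] := sigma_finiteT m2.
exists (fun n => F n `*` G n).
  rewrite -setXTT TF TG predeqE => -[x y]; split.
    move=> [/= [n _ Fnx] [k _ Gky]]; exists (maxn n k) => //; split.
    - by move: x Fnx; exact/subsetPset/ndF/leq_maxl.
    - by move: y Gky; exact/subsetPset/ndG/leq_maxr.
  by move=> [n _ []/= ? ?]; split; exists n.
move=> k; have [? ?] := Foo k; have [? ?] := Goo k.
split; first exact: measurableX.
by rewrite product_measure1E// lte_mul_pinfty// ge0_fin_numE.
Qed.

End product_sigma_finite.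

Section plane_measure.
Context (R : realType).

(* Lebesgue area on R x R, the pair (x, y) standing for x + i y *)
Definition plane_measure :
    set (measurableTypeR R * measurableTypeR R)%type -> \bar R :=
  (@lebesgue_measure R \x @lebesgue_measure R)%E.

HB.instance Definition _ := Measure.on plane_measure.

HB.instance Definition _ := Measure_isSigmaFinite.Build _ _ _ plane_measure
  (@sigma_finite_product _ _ (measurableTypeR R) (measurableTypeR R) R
     (@lebesgue_measure R) (@lebesgue_measure R)).

End plane_measure.

Section cons_measure.
Context d (T : measurableType d) (R : realType) (n : nat).
Variable m1 : {sigma_finite_measure set T -> \bar R}.
Variable m2 : {sigma_finite_measure set (n.-tuple T) -> \bar R}.

Definition tuple_cons (x : T * n.-tuple T) : n.+1.-tuple T :=
  [tuple of x.1 :: x.2].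

Lemma measurable_tuple_cons : measurable_fun setT tuple_cons.
Proof. exact: (measurable_cons measurable_fst measurable_snd). Qed.

Lemma measurable_tuple_uncons :
  measurable_fun setT (fun t : n.+1.-tuple T => (thead t, [tuple of behead t])).
Proof.
apply/measurable_fun_pairP; split => /=.
  exact: (measurable_tnth ord0).
exact: measurable_behead.
Qed.

(* m1 \x m2 transported along T * T^n ~ T^(n+1) *)
Definition cons_measure : set (n.+1.-tuple T) -> \bar R :=
  pushforward (m1 \x m2)%E tuple_cons.

Let cons_measure0 : cons_measure set0 = 0%E.
Proof. by rewrite /cons_measure /pushforward preimage_set0 measure0. Qed.

Let cons_measure_ge0 A : (0 <= cons_measure A)%E.
Proof. by rewrite /cons_measure /pushforward; exact: measure_ge0. Qed.

Let cons_measure_sigma_additive : semi_sigma_additive cons_measure.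
Proof.
move=> F mF tF mUF; rewrite /cons_measure /pushforward preimage_bigcup.
apply: measure_semi_sigma_additive.
- by move=> k; rewrite -[X in measurable X]setTI; exact: measurable_tuple_cons.
- apply/trivIsetP => /= i j _ _ ij; rewrite -preimage_setI.
  by move/trivIsetP : tF => /(_ _ _ _ _ ij) ->//; rewrite preimage_set0.
- rewrite -preimage_bigcup -[X in measurable X]setTI.
  exact: measurable_tuple_cons.
Qed.

HB.instance Definition _ := isMeasure.Build _ _ _ cons_measure
  cons_measure0 cons_measure_ge0 cons_measure_sigma_additive.

Let cons_measure_sigma_finite : sigma_finite setT cons_measure.
Proof.
have [F TF Foo] := sigma_finite_product m1 m2.
pose u (t : n.+1.-tuple T) := (thead t, [tuple of behead t]).
have uK x : u (tuple_cons x) = x.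
  by case: x => a b; rewrite /u /tuple_cons theadE; congr (_, _); exact: val_inj.
exists (fun k => u @^-1` F k).
  by rewrite -preimage_bigcup -TF preimage_setT.
move=> k; have [mF Fk] := Foo k; split.
  by rewrite -[X in measurable X]setTI; exact: measurable_tuple_uncons.
rewrite /cons_measure /pushforward -comp_preimage.
by rewrite (_ : u \o tuple_cons = id) ?preimage_id//; apply/funext => x /=.
Qed.

HB.instance Definition _ := Measure_isSigmaFinite.Build _ _ _ cons_measure
  cons_measure_sigma_finite.

End cons_measure.

(* the n-fold power of m, a measure on T^n *)
Fixpoint power_measure d (T : measurableType d) (R : realType)
    (m : {sigma_finite_measure set T -> \bar R}) (n : nat) :
    {sigma_finite_measure set (n.-tuple T) -> \bar R} :=
  match n with
  | 0 => \d_([tuple] : 0.-tuple T)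
  | n'.+1 => cons_measure m (power_measure m n')
  end.

Definition plane_to_cplx (R : realType) (x : R * R) : cplx R :=
  Complex x.1 x.2.

Definition tuple_to_Cn (R : realType) (n : nat)
    (t : n.-tuple (measurableTypeR R * measurableTypeR R)%type) : Cn R n :=
  \row_i plane_to_cplx (tnth t i).

(* Lebesgue volume dv on C^n, carried by n-tuples of pairs of real
   coordinates: the integral of g : C^n -> R is the integral of g \o tuple_to_Cn
   against this measure. *)
Definition Cn_volume (R : realType) (n : nat) :=
  power_measure (@plane_measure R) n.

Section hilbert_operators.
Context (R : realType) (V : lmodType (cplx R)).
(* The Hilbert space is the subset H of the ambient vector space V with the
   inner product ip, linear in the first argument; an operator on H is a
   function T : V -> V, of which only the values on H matter. *)
Variables (H : set V) (ip : V -> V -> cplx R).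
Implicit Types (T S P : V -> V).

Definition hnorm (x : V) : R := Num.sqrt (complex.Re (ip x x)).

Definition linear_operator T :=
  (forall x, H x -> H (T x)) /\
  (forall (a : cplx R) x y, H x -> H y -> T (a *: x + y) = a *: T x + T y).

Definition bounded_operator T :=
  linear_operator T /\
  exists M : R, forall x, H x -> hnorm (T x) <= M * hnorm x.

Definition compact_operator T :=
  linear_operator T /\
  forall u : nat -> V,
    (forall k, H (u k)) -> (exists M : R, forall k, hnorm (u k) <= M) ->
    exists (s : nat -> nat) (y : V),
      [/\ {homo s : i j / (i < j)%N}, H y &
          hnorm (T (u (s k)) - y) @[k --> \oo] --> (0 : R)].

Definition is_adjoint T S :=
  (forall x, H x -> H (S x)) /\
  (forall x y, H x -> H y -> ip (T x) y = ip x (S y)).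

(* The order on complex numbers makes [0 <= z] mean that z is real and
   nonnegative. *)
Definition positive_operator P :=
  bounded_operator P /\ forall x, H x -> 0 <= ip (P x) x.

(* P = |T|, the positive square root of T^* T *)
Definition is_absolute_value T P :=
  positive_operator P /\
  exists2 S, is_adjoint T S & forall x, H x -> P (P x) = S (T x).

Definition eigenvector P (l : R) (x : V) := H x /\ P x = of_real l *: x.

Definition linearly_independent (m : nat) (e : 'I_m -> V) :=
  forall c : 'I_m -> cplx R,
    \sum_(i < m) c i *: e i = 0 -> forall i, c i = 0.

(* The dimension, possibly +oo, of the eigenspace of P for l; it is 0 when l
   is not an eigenvalue. *)
Definition multiplicity P (l : R) : \bar R :=
  ereal_sup [set d | exists (m : nat) (e : 'I_m -> V),
    [/\ forall i, eigenvector P l (e i), linearly_independent e &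
        d = m%:R%:E]].

(* The sequence of eigenvalues of |T|, each repeated according to its
   multiplicity, is in l^p; the possible eigenvalue 0 contributes nothing. *)
Definition schatten_class (p : R) T :=
  compact_operator T /\
  exists2 P, is_absolute_value T P &
    (\esum_(l in [set l : R | (0 <= l)%R]) (multiplicity P l * (l `^ p)%:E)
       < +oo)%E.

End hilbert_operators.

Definition holomorphic (R : realType) (V W : normedModType (cplx R))
  (f : V -> W) := forall z, differentiable f z.

Section fock_space.
Context (R : realType) (n : nat).
Implicit Types (f g : Cn R n -> cplx R) (z w : Cn R n).

Definition Cn_dot z w : cplx R := \sum_(j < n) z ord0 j * (w ord0 j)^*.

Definition Cn_norm z : R := Num.sqrt (complex.Re (Cn_dot z z)).

Definition gauss z : R := expR (- (Cn_norm z ^+ 2) / 2).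

Definition fock_const : R := (2 * pi)^-1 ^+ n.

Definition fock_sqnorm f : \bar R :=
  (fock_const%:E * \int[@Cn_volume R n]_t
     (complex.Re (`|f (tuple_to_Cn t)|) ^+ 2 * gauss (tuple_to_Cn t))%:E)%E.

Definition fock_space : set (Cn R n -> cplx R) :=
  [set f | holomorphic f /\ (fock_sqnorm f < +oo)%E].

Definition fock_ip f g : cplx R :=
  let h t := f (tuple_to_Cn t) * (g (tuple_to_Cn t))^*
             * of_real (gauss (tuple_to_Cn t)) in
  of_real fock_const *
  Complex (\int[@Cn_volume R n]_t complex.Re (h t))
          (\int[@Cn_volume R n]_t complex.Im (h t)).

End fock_space.

Definition composition_operator (R : realType) (n : nat)
  (phi : Cn R n -> Cn R n) (f : Cn R n -> cplx R) : Cn R n -> cplx R :=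
  f \o phi.

(* Main.v *)
Require Import Defs.
From HB Require Import structures.
From mathcomp Require Import all_boot all_order all_algebra.
From mathcomp Require Import complex.
From mathcomp Require Import all_classical all_reals all_analysis.
From mathcomp Require Import measurable_realfun.
From mathcomp Require Import ring lra.

Import Order.TTheory GRing.Theory Num.Theory.
Import numFieldNormedType.Exports.

Local Open Scope classical_set_scope.
Local Open Scope ring_scope.

(** Write [C f = f o phi] for the composition operator.

    The symbol of a compact [C] is an affine strict contraction.  The
    reproducing kernels, normalised to norm one, tend to 0 pointwise when their
    index goes to infinity.  If [|phi w_j| >= |w_j|] for points with
    [|phi w_j| -> oo], the images under [C] of the unit kernels at [phi w_j]
    have a limit point, which can only be 0, while their values at [w_j] show
    that their norms are at least 1.  Hence [|phi w| >= |w|] bounds [|phi w|]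
    ([compact_composition_growth]).  It follows that [phi] grows at most
    linearly, so by Liouville's theorem [phi z = z A + b], and then that
    [|z A| < |z|] for [z <> 0], so that [A] is a strict contraction
    ([compact_composition_affine]).

    The operators [wco A b v k], which map [f] to the function
    [z |-> k exp (<z, v> / 2) f (z A + b)] with [A] a strict contraction, are
    closed under composition ([wco_comp]) and adjoints ([wco_adjoint]).  Thus
    [C^* C] is one of them, with the positive Hermitian matrix [A^* A].
    Diagonalising that matrix, the equation [Q Q = T] can be solved inside the
    class of the positive operators of this form ([poswco_root]): the absolute
    value [|C|] and all its iterated square roots are such operators.

    Every one of them is Hilbert-Schmidt ([wco_hilbert_schmidt]).  An
    orthonormal family satisfies [sum_i |e_i x| ^ 2 <= exp (|x| ^ 2 / 2)], and
    since the linear part is a strict contraction this bound can be integrated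
    after composition with the symbol.  An eigenvector of [|C|] for [l] is an
    eigenvector of the root of order [2 ^ j] for [l ^ (2 ^ - j)], so the
    eigenvalues of [|C|] have summable powers of exponent [2 * 2 ^ - j], for
    every [j]; these exponents become smaller than any given [p]
    ([poswco_schatten_sum]).

    The complex analysis behind this is developed from Goursat's theorem
    ([goursat]), proved by bisection.  It gives mean values over circles and
    the affine form of entire functions of linear growth; averaging over the
    rotations of C^n, which preserve the Gaussian measure, turns the mean value
    property into the reproducing property of the kernels
    ([fock_reproducing]). *)

Set Implicit Arguments.
Unset Strict Implicit.
Unset Printing Implicit Defensive.

(** * Real and imaginary parts, modulus *)

Section cplx_basics.
Variable R : realType.
Implicit Types (z w : cplx R) (x y : R).

Definition cmod z : R := complex.Re `|z|.

Lemma cplx_ext z w : complex.Re z = complex.Re w -> complex.Im z = complex.Im w -> z = w.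
Proof. by case: z => a b; case: w => c d /= -> ->. Qed.

Lemma ReD z w : complex.Re (z + w) = complex.Re z + complex.Re w.
Proof. by case: z; case: w. Qed.
Lemma ImD z w : complex.Im (z + w) = complex.Im z + complex.Im w.
Proof. by case: z; case: w. Qed.
Lemma ReN z : complex.Re (- z) = - complex.Re z.
Proof. by case: z. Qed.
Lemma ImN z : complex.Im (- z) = - complex.Im z.
Proof. by case: z. Qed.
Lemma ReB z w : complex.Re (z - w) = complex.Re z - complex.Re w.
Proof. by rewrite ReD ReN. Qed.
Lemma ImB z w : complex.Im (z - w) = complex.Im z - complex.Im w.
Proof. by rewrite ImD ImN. Qed.
Lemma ReM z w : complex.Re (z * w) =
  complex.Re z * complex.Re w - complex.Im z * complex.Im w.
Proof. by case: z; case: w. Qed.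
Lemma ImM z w : complex.Im (z * w) =
  complex.Re z * complex.Im w + complex.Im z * complex.Re w.
Proof. by case: z; case: w. Qed.
Lemma ReJ z : complex.Re z^* = complex.Re z.
Proof. by case: z. Qed.
Lemma ImJ z : complex.Im z^* = - complex.Im z.
Proof. by case: z. Qed.
Lemma Re0 : complex.Re (0 : cplx R) = 0. Proof. by []. Qed.
Lemma Im0 : complex.Im (0 : cplx R) = 0. Proof. by []. Qed.
Lemma Re1 : complex.Re (1 : cplx R) = 1. Proof. by []. Qed.
Lemma Im1 : complex.Im (1 : cplx R) = 0. Proof. by []. Qed.
Definition reimE := (ReD, ImD, ReN, ImN, ReM, ImM, ReJ, ImJ, Re0, Im0, Re1, Im1).

Lemma of_realD x y : of_real (x + y) = of_real x + of_real y.
Proof. by apply: cplx_ext; rewrite !reimE//= addr0. Qed.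
Lemma of_realN x : of_real (- x) = - of_real x.
Proof. by apply: cplx_ext; rewrite !reimE//= oppr0. Qed.
Lemma of_realM x y : of_real (x * y) = of_real x * of_real y.
Proof. by apply: cplx_ext; rewrite !reimE//=; ring. Qed.
Lemma of_real_sum I (r : seq I) P (F : I -> R) :
  of_real (\sum_(i <- r | P i) F i) = \sum_(i <- r | P i) of_real (F i).
Proof. by apply: big_morph => //; exact: of_realD. Qed.
Lemma of_real1 : of_real 1 = 1 :> cplx R. Proof. by []. Qed.
Lemma of_real0 : of_real 0 = 0 :> cplx R. Proof. by []. Qed.

Lemma normcE z : `|z| = of_real (cmod z).
Proof. by case: z. Qed.
Lemma cmodE z : cmod z = Num.sqrt (complex.Re z ^+ 2 + complex.Im z ^+ 2).
Proof. by case: z. Qed.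
Lemma sqr_cmod z : cmod z ^+ 2 = complex.Re z ^+ 2 + complex.Im z ^+ 2.
Proof. by rewrite cmodE sqr_sqrtr// addr_ge0// sqr_ge0. Qed.
Lemma cmod_ge0 z : 0 <= cmod z. Proof. by rewrite cmodE sqrtr_ge0. Qed.
Lemma cmodM z w : cmod (z * w) = cmod z * cmod w.
Proof. by rewrite /cmod normrM !normcE -of_realM. Qed.
Lemma cmodD z w : cmod (z + w) <= cmod z + cmod w.
Proof. by have := ler_normD z w; rewrite !normcE -of_realD lecE => /andP[]. Qed.
Lemma cmodN z : cmod (- z) = cmod z. Proof. by rewrite /cmod normrN. Qed.
Lemma cmodJ z : cmod z^* = cmod z.
Proof. by rewrite !cmodE ReJ ImJ sqrrN. Qed.
Lemma cmod0 : cmod 0 = 0. Proof. by rewrite /cmod normr0. Qed.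
Lemma cmod1 : cmod 1 = 1. Proof. by rewrite /cmod normr1. Qed.
Lemma cmod_eq0 z : cmod z = 0 -> z = 0.
Proof. by move=> h; apply/eqP; rewrite -normr_eq0 normcE h. Qed.
Lemma cmod_of_real x : cmod (of_real x) = `|x|.
Proof. by rewrite cmodE/= expr0n/= addr0 sqrtr_sqr. Qed.
Lemma ler_cmod_Re z : `|complex.Re z| <= cmod z.
Proof.
by rewrite cmodE -[leLHS]sqrtr_sqr ler_wsqrtr// lerDl sqr_ge0.
Qed.
Lemma ler_cmod_Im z : `|complex.Im z| <= cmod z.
Proof.
by rewrite cmodE -[leLHS]sqrtr_sqr ler_wsqrtr// lerDr sqr_ge0.
Qed.
Lemma ler_cmod_ReIm z : cmod z <= `|complex.Re z| + `|complex.Im z|.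
Proof.
rewrite -ler_sqr ?nnegrE ?cmod_ge0// ?addr_ge0//.
rewrite sqr_cmod sqrrD !real_normK ?num_real// addrAC lerDl.
by rewrite mulrn_wge0// mulr_ge0.
Qed.
Lemma ltc_norm z (e : R) : (`|z| < of_real e) = (cmod z < e).
Proof. by rewrite normcE ltcR. Qed.
End cplx_basics.

(** * Limits and derivatives measured by the modulus *)

Section cplx_topology.
Variable R : realType.
Implicit Types (z w : cplx R) (x y : R).

Lemma cplx_gt0_cmod (e : cplx R) : 0 < e -> 0 < cmod e /\ of_real (cmod e) = e.
Proof.
move=> e0; have := gtr0_norm e0; rewrite normcE => h; split => //.
by rewrite -h in e0; move: e0; rewrite ltcR.
Qed.

Lemma nbhs_cplxP z (P : set (cplx R)) :
  nbhs z P <-> exists2 d : R, 0 < d & forall w, cmod (w - z) < d -> P w.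
Proof.
split=> [/nbhs_ballP[e /= /cplx_gt0_cmod[e0 eE] zP]|[d d0 zP]].
  exists (cmod e) => // w wz; apply: zP; rewrite /ball/= -eE distrC.
  by rewrite ltc_norm.
apply/nbhs_ballP; exists (of_real d); first by rewrite /= ltcR.
by move=> w; rewrite /ball/= distrC ltc_norm => /zP.
Qed.

Lemma cvg_cplxP T (F : set_system T) {FF : Filter F} (f : T -> cplx R) z :
  f x @[x --> F] --> z <->
  forall e : R, 0 < e -> \forall x \near F, cmod (f x - z) < e.
Proof.
split=> [h e e0|h].
  by apply: (h [set w | cmod (w - z) < e]); apply/nbhs_cplxP; exists e.
move=> P /nbhs_cplxP[d d0 dP]; have := h _ d0.
by apply: filterS => x; exact: dP.
Qed.

Lemma continuous_Re : continuous (@complex.Re R : cplx R -> R).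
Proof.
move=> z; apply/(@cvgrPdist_lt _ _ _ (nbhs z) (nbhs_filter z)) => e e0; apply/nbhs_cplxP; exists e => // w wz.
by rewrite distrC -ReB (le_lt_trans (ler_cmod_Re _)).
Qed.

Lemma continuous_Im : continuous (@complex.Im R : cplx R -> R).
Proof.
move=> z; apply/(@cvgrPdist_lt _ _ _ (nbhs z) (nbhs_filter z)) => e e0; apply/nbhs_cplxP; exists e => // w wz.
by rewrite distrC -ImB (le_lt_trans (ler_cmod_Im _)).
Qed.

Lemma cvg_Complex T (F : set_system T) {FF : Filter F} (f g : T -> R) x y :
  f t @[t --> F] --> x -> g t @[t --> F] --> y ->
  (Complex (f t) (g t) : cplx R) @[t --> F] --> (Complex x y : cplx R).
Proof.
move=> /cvgrPdist_lt fx /cvgrPdist_lt gy; apply/cvg_cplxP => e e0.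
have e2 : 0 < e / 2 by rewrite divr_gt0.
near=> t; apply: (le_lt_trans (ler_cmod_ReIm _)).
rewrite ReB ImB/= (splitr e) ltrD// distrC; near: t; [exact: fx|exact: gy].
Unshelve. all: by end_near. Qed.

(** This is the form in which complex differentiability enters the integral
    estimates: everything is measured by the real number [cmod]. *)
Lemma differentiable_approx (f : cplx R -> cplx R) z : differentiable f z ->
  forall e : R, 0 < e -> exists2 d : R, 0 < d &
  forall w, cmod (w - z) < d ->
    cmod (f w - f z - f^`()%classic z * (w - z)) <= e * cmod (w - z).
Proof.
move=> /derivable1_diffP df e e0.
have /cvg_cplxP := df; rewrite -[lim _]/('D_1 f z) -derive1E => /(_ _ e0).
move=> /nbhs_cplxP[d d0 H]; exists d => // w wz.
have [->|nwz] := eqVneq w z.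
  by rewrite !subrr mulr0 subrr cmod0 mulr0.
have := H (w - z); rewrite subr0 subr_eq0 => /(_ wz nwz) /=.
rewrite /GRing.scale /= mulr1 subrK => /ltW h.
have nz : w - z != 0 by rewrite subr_eq0.
apply: le_trans (ler_wpM2r (cmod_ge0 (w - z)) h).
by rewrite -cmodM mulrBl mulrAC mulVf// mul1r.
Qed.

Lemma approx_derivative (f : cplx R -> cplx R) z a :
  (forall e : R, 0 < e -> exists2 d : R, 0 < d &
  forall w, cmod (w - z) < d ->
    cmod (f w - f z - a * (w - z)) <= e * cmod (w - z)) ->
  differentiable f z /\ f^`()%classic z = a.
Proof.
move=> H.
have : h^-1 *: ((f \o shift z) (h *: 1) - f z) @[h --> 0^'] --> a.
  apply/cvg_cplxP => e e0; have e2 : 0 < e / 2 by rewrite divr_gt0.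
  have [d d0 Hd] := H _ e2; apply/nbhs_cplxP; exists d => // w wd /= w0.
  rewrite subr0 in wd; have := Hd (w + z); rewrite addrK => /(_ wd) h.
  have cw0 : 0 < cmod w.
    by rewrite lt_neqAle cmod_ge0 andbT eq_sym; apply: contra_neq w0 => /cmod_eq0.
  rewrite /GRing.scale /= mulr1 -(ltr_pM2r cw0) -cmodM mulrBl mulrAC mulVf// mul1r.
  by apply: le_lt_trans h _; rewrite ltr_pM2r// ltr_pdivrMr// ltr_pMr// ltr1n.
move=> h; split; last by rewrite derive1E; apply: cvg_lim h.
by apply/derivable1_diffP; apply/cvg_ex; exists a.
Qed.

End cplx_topology.

(** * The complex exponential *)

Section cexp.
Variable R : realType.
Implicit Types (z w : cplx R) (x y : R).

Lemma real_approx (f : R -> R) x l : is_derive x 1 f l ->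
  forall e : R, 0 < e -> exists2 d : R, 0 < d &
  forall h, `|h| < d -> `|f (h + x) - f x - l * h| <= e * `|h|.
Proof.
move=> [df dfl] e e0; move: df => /cvgrPdist_lt/(_ _ e0); rewrite -[lim _]/('D_1 f x) dfl.
move=> /nbhs_ballP[d /= d0 H]; exists d => // h hd.
have [->|h0] := eqVneq h 0.
  by rewrite add0r mulr0 subrr subr0 normr0 mulr0.
have := H h; rewrite /ball/= sub0r normrN => /(_ hd h0).
rewrite /GRing.scale /= mulr1 => /ltW H'.
apply: le_trans (ler_wpM2r (normr_ge0 h) H').
by rewrite distrC -normrM mulrBl mulrAC mulVf// mul1r.
Qed.

Definition cexp z : cplx R :=
  Complex (expR (complex.Re z) * cos (complex.Im z))
          (expR (complex.Re z) * sin (complex.Im z)).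

Lemma cexpD z w : cexp (z + w) = cexp z * cexp w.
Proof.
rewrite /cexp !reimE expRD cosD sinD; apply: cplx_ext; rewrite !reimE/=; ring.
Qed.

Lemma cexp0 : cexp 0 = 1.
Proof. by rewrite /cexp/= expR0 cos0 sin0 mulr1 mulr0. Qed.

Lemma cexp_neq0 z : cexp z != 0.
Proof.
apply/eqP => h; have := cexpD z (- z); rewrite subrr cexp0 h mul0r.
by apply/eqP; exact: oner_neq0.
Qed.

Lemma cexpN z : cexp (- z) = (cexp z)^-1.
Proof.
by apply: (mulfI (cexp_neq0 z)); rewrite -cexpD subrr cexp0 divff ?cexp_neq0.
Qed.

Lemma cmod_cexp z : cmod (cexp z) = expR (complex.Re z).
Proof.
rewrite cmodE/= !exprMn -mulrDr cos2Dsin2 mulr1.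
by rewrite sqrtr_sqr ger0_norm// expR_ge0.
Qed.

Lemma cexpJ z : (cexp z)^* = cexp z^*.
Proof. by apply: cplx_ext; rewrite !reimE/= !reimE ?cosN ?sinN ?mulrN. Qed.

Lemma cexp_of_real x : cexp (of_real x) = of_real (expR x).
Proof. by apply: cplx_ext => /=; rewrite ?cos0 ?sin0 ?mulr1 ?mulr0. Qed.

Let cexp_approx0 : forall e : R, 0 < e -> exists2 d : R, 0 < d &
  forall w, cmod (w - 0) < d ->
    cmod (cexp w - cexp 0 - 1 * (w - 0)) <= e * cmod (w - 0).
Proof.
move=> e e0.
have k0 : 0 < Num.min (e / 12) 1 by rewrite lt_min divr_gt0//=.
set k : R := Num.min _ _ in k0.
have ke : 12 * k <= e.
  by rewrite mulrC -ler_pdivlMr// /k ge_min lexx.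
have k1 : k <= 1 by rewrite /k ge_min lexx orbT.
clearbody k.
have [d1 d10 H1] := real_approx (@is_derive_expR R 0) k0.
have [d2 d20 H2] := real_approx (@is_derive_cos R 0) k0.
have [d3 d30 H3] := real_approx (@is_derive_sin R 0) k0.
exists (Num.min (Num.min d1 k) (Num.min d2 d3)).
  by rewrite !lt_min d10 k0 d20 d30.
move=> w; rewrite subr0 !lt_min => /andP[/andP[w1 wk] /andP[w2 w3]].
rewrite cexp0 mul1r; set x := complex.Re w; set y := complex.Im w.
have xw : `|x| <= cmod w by exact: ler_cmod_Re.
have yw : `|y| <= cmod w by exact: ler_cmod_Im.
have := H1 x (le_lt_trans xw w1); rewrite addr0 expR0 mul1r => {}H1.
have := H2 y (le_lt_trans yw w2); rewrite addr0 cos0 sin0 oppr0 mul0r subr0 => {}H2.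
have := H3 y (le_lt_trans yw w3); rewrite addr0 sin0 cos0 subr0 mul1r => {}H3.
have kx : k * `|x| <= `|x| by rewrite ler_piMl.
have ex1 : `|expR x - 1| <= 2 * `|x|.
  rewrite -(subrK x (expR x - 1)); apply: le_trans (ler_normD _ _) _; lra.
have ex3 : `|expR x| <= 3.
  rewrite -(subrK 1 (expR x)); apply: le_trans (ler_normD _ _) _.
  rewrite normr1; lra.
apply: le_trans (ler_cmod_ReIm _) _; rewrite !reimE/= -/x -/y.
have -> : expR x * cos y - 1 - x = expR x * (cos y - 1) + (expR x - 1 - x) by ring.
have -> : expR x * sin y - 0 - y = expR x * (sin y - y) + (expR x - 1) * y by ring.
have b1 : `|expR x * (cos y - 1)| <= 3 * (k * cmod w).
  by rewrite normrM ler_pM// (le_trans H2)// ler_wpM2l// ltW.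
have b2 : `|expR x * (sin y - y)| <= 3 * (k * cmod w).
  by rewrite normrM ler_pM// (le_trans H3)// ler_wpM2l// ltW.
have b3 : `|(expR x - 1) * y| <= 2 * k * cmod w.
  rewrite normrM ler_pM// (le_trans ex1)// ler_wpM2l//.
  by rewrite (le_trans xw)// ltW.
have b4 : `|expR x - 1 - x| <= k * cmod w.
  by rewrite (le_trans H1)// ler_wpM2l// ltW.
apply: (@le_trans _ _ (12 * k * cmod w)); last by rewrite ler_wpM2r ?cmod_ge0.
have ck : 0 <= k * cmod w by rewrite mulr_ge0 ?cmod_ge0// ltW.
apply: le_trans (lerD (ler_normD _ _) (ler_normD _ _)) _.
lra.
Qed.

Let cexp_approx z : forall e : R, 0 < e -> exists2 d : R, 0 < d &
  forall w, cmod (w - z) < d ->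
    cmod (cexp w - cexp z - cexp z * (w - z)) <= e * cmod (w - z).
Proof.
move=> e e0; have c0 : 0 < cmod (cexp z) by rewrite cmod_cexp expR_gt0.
have [d d0 H] := cexp_approx0 (divr_gt0 e0 c0); exists d => // w wz.
have := H (w - z); rewrite subr0 => /(_ wz); rewrite cexp0 mul1r => h.
have -> : cexp w - cexp z - cexp z * (w - z) = cexp z * (cexp (w - z) - 1 - (w - z)).
  have -> : cexp w = cexp z * cexp (w - z) by rewrite -cexpD addrC subrK.
  ring.
rewrite cmodM (le_trans (ler_wpM2l (ltW c0) h))//.
by rewrite mulrA mulrCA divff ?mulr1// gt_eqF.
Qed.

Lemma differentiable_cexp z : differentiable cexp z.
Proof. exact: (approx_derivative (cexp_approx z)).1. Qed.

End cexp.

(** * Flux through the sides of a rectangle *)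

Section interval_integral.
Variable R : realType.
Implicit Types (f g : R -> R) (a b c : R).

Definition itg a b f : R := \int[@lebesgue_measure R]_(x in `[a, b]) f x.

Lemma continuous_itg_integrable f a b : continuous f ->
  (@lebesgue_measure R).-integrable `[a, b] (EFin \o f).
Proof.
move=> cf; apply: continuous_compact_integrable; first exact: segment_compact.
exact: continuous_subspaceT.
Qed.

Lemma itgD f g a b : continuous f -> continuous g ->
  itg a b (fun x => f x + g x) = itg a b f + itg a b g.
Proof. by move=> cf cg; rewrite /itg RintegralD//; exact: continuous_itg_integrable. Qed.

Lemma itgB f g a b : continuous f -> continuous g ->
  itg a b (fun x => f x - g x) = itg a b f - itg a b g.
Proof. by move=> cf cg; rewrite /itg RintegralB//; exact: continuous_itg_integrable. Qed.

Lemma itg_cst k a b : a <= b -> itg a b (fun=> k) = k * (b - a).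
Proof.
move=> ab; rewrite /itg Rintegral_cst//= lebesgue_measure_itv/= lte_fin.
by case: ltgtP ab => // -> _; rewrite subrr.
Qed.

Lemma itg_split f a b c : a <= c -> c <= b -> continuous f ->
  itg a b f = itg a c f + itg c b f.
Proof.
move=> ac cb cf; have := @Rintegral_itvB R f (BLeft a) (BRight b) c.
move=> /(_ (continuous_itg_integrable a b cf)); rewrite !bnd_simp => /(_ ac cb) /eqP.
rewrite subr_eq => /eqP; rewrite /itg => ->; rewrite addrC; congr (_ + _).
rewrite Rintegral_itv_obnd_cbnd//; apply: integrableS (continuous_itg_integrable c b cf) => //.
by apply: subset_itvr; rewrite bnd_simp.
Qed.

Lemma eq_itg f g a b : (forall x, a <= x <= b -> f x = g x) -> itg a b f = itg a b g.
Proof.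
by move=> fg; apply: eq_Rintegral => x; rewrite inE/= in_itv/= => /fg.
Qed.

Lemma ler_norm_itg f a b M : a <= b -> continuous f ->
  (forall x, a <= x <= b -> `|f x| <= M) -> `|itg a b f| <= M * (b - a).
Proof.
move=> ab cf fM.
have If := continuous_itg_integrable a b cf.
apply: le_trans (le_normr_Rintegral _ If) _ => //.
rewrite -(itg_cst M ab); apply: le_Rintegral => //.
- by apply: continuous_itg_integrable => x; apply: cvg_norm; exact: cf.
- by apply: continuous_itg_integrable => x; exact: cvg_cst.
Qed.

End interval_integral.

Section flux.
Variable R : realType.
Implicit Types (h f g : cplx R -> cplx R) (x y L M : R).

(** The imaginary part of the integral of [h] along the boundary of the
    rectangle with corner [x + i y] and sides [L], [M]. *)
Definition flux h x y L M : R :=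
  itg y (y + M) (fun t => complex.Re (h (Complex (x + L) t)) - complex.Re (h (Complex x t))) +
  itg x (x + L) (fun s => complex.Im (h (Complex s y)) - complex.Im (h (Complex s (y + M)))).

Lemma continuous_vline x : continuous (fun t : R => Complex x t : cplx R).
Proof. by move=> t; apply: cvg_Complex; [exact: cvg_cst|exact: cvg_id]. Qed.

Lemma continuous_hline y : continuous (fun s : R => Complex s y : cplx R).
Proof. by move=> s; apply: cvg_Complex; [exact: cvg_id|exact: cvg_cst]. Qed.

Section continuous_along.
Variables (h : cplx R -> cplx R) (ch : continuous h).

Lemma continuous_Re_along (p : R -> cplx R) : continuous p ->
  continuous (fun t => complex.Re (h (p t))).
Proof.
move=> cp t; apply: (@continuous_comp _ _ _ p (fun z => complex.Re (h z))); first exact: cp.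
by apply: (@continuous_comp _ _ _ h (@complex.Re R)); [exact: ch|exact: continuous_Re].
Qed.

Lemma continuous_Im_along (p : R -> cplx R) : continuous p ->
  continuous (fun t => complex.Im (h (p t))).
Proof.
move=> cp t; apply: (@continuous_comp _ _ _ p (fun z => complex.Im (h z))); first exact: cp.
by apply: (@continuous_comp _ _ _ h (@complex.Im R)); [exact: ch|exact: continuous_Im].
Qed.

Let cRv x : continuous (fun t => complex.Re (h (Complex x t))).
Proof. exact: continuous_Re_along (@continuous_vline x). Qed.
Let cIh y : continuous (fun t => complex.Im (h (Complex t y))).
Proof. exact: continuous_Im_along (@continuous_hline y). Qed.

Let cRvB x x' : continuous (fun t => complex.Re (h (Complex x t)) - complex.Re (h (Complex x' t))).
Proof. by move=> t; apply: cvgB; exact: cRv. Qed.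
Let cIhB y y' : continuous (fun t => complex.Im (h (Complex t y)) - complex.Im (h (Complex t y'))).
Proof. by move=> t; apply: cvgB; exact: cIh. Qed.

(** The contributions of the common side cancel. *)
Lemma flux_splitx x y l l' M : 0 <= l -> 0 <= l' -> 0 <= M ->
  flux h x y (l + l') M = flux h x y l M + flux h (x + l) y l' M.
Proof.
move=> l0 l0' M0; rewrite /flux addrA.
rewrite [X in _ + X = _](@itg_split _ _ _ _ (x + l)) ?lerDl//.
rewrite !itgB//; ring.
Qed.

Lemma flux_splity x y L m m' : 0 <= m -> 0 <= m' -> 0 <= L ->
  flux h x y L (m + m') = flux h x y L m + flux h x (y + m) L m'.
Proof.
move=> m0 m0' L0; rewrite /flux addrA.
rewrite [X in X + _ = _](@itg_split _ _ _ _ (y + m)) ?lerDl//.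
rewrite !itgB//; ring.
Qed.

(** An affine function has no flux, so only the deviation of [h] from one
    counts. *)
Lemma flux_le_affine x y L M (a b : cplx R) K : 0 <= L -> 0 <= M ->
  (forall s t, x <= s <= x + L -> y <= t <= y + M ->
    cmod (h (Complex s t) - (a + b * Complex s t)) <= K) ->
  `|flux h x y L M| <= 2 * K * (L + M).
Proof.
move=> L0 M0 hK.
have E1 : itg y (y + M) (fun t => complex.Re (h (Complex (x + L) t)) - complex.Re (h (Complex x t)))
   = complex.Re b * L * M +
     itg y (y + M) (fun t => complex.Re (h (Complex (x + L) t)) - complex.Re (h (Complex x t)) - complex.Re b * L).
  rewrite [X in _ = _ + X]itgB; last 2 first.
  - exact: cRvB.
  - by move=> t; exact: cvg_cst.
  rewrite itg_cst ?lerDl//; ring.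
have E2 : itg x (x + L) (fun s => complex.Im (h (Complex s y)) - complex.Im (h (Complex s (y + M))))
   = - (complex.Re b * L * M) +
     itg x (x + L) (fun s => complex.Im (h (Complex s y)) - complex.Im (h (Complex s (y + M))) + complex.Re b * M).
  rewrite [X in _ = _ + X]itgD; last 2 first.
  - exact: cIhB.
  - by move=> t; exact: cvg_cst.
  rewrite itg_cst ?lerDl//; ring.
have bd s t s' t' : x <= s <= x + L -> y <= t <= y + M ->
   x <= s' <= x + L -> y <= t' <= y + M ->
   let z : cplx R := h (Complex s t) - h (Complex s' t') - b * Complex (s - s') (t - t') in
   `|complex.Re z| <= 2 * K /\ `|complex.Im z| <= 2 * K.
  move=> s0 t0 s0' t0' z.
  have zK : cmod z <= 2 * K.
    have -> : z = (h (Complex s t) - (a + b * Complex s t))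
                + - (h (Complex s' t') - (a + b * Complex s' t')).
      rewrite /z; have -> : (Complex (s - s') (t - t') : cplx R) = Complex s t - Complex s' t'.
        by [].
      ring.
    apply: le_trans (cmodD _ _) _; rewrite cmodN.
    by have := hK _ _ s0 t0; have := hK _ _ s0' t0'; lra.
  by split; apply: le_trans zK; [exact: ler_cmod_Re|exact: ler_cmod_Im].
rewrite /flux E1 E2 addrACA subrr add0r mulrDr addrC.
apply: le_trans (ler_normD _ _) _; apply: lerD.
  rewrite [X in _ <= _ * X](_ : L = x + L - x); last by rewrite addrC addKr.
  apply: ler_norm_itg; first by rewrite lerDl.
    by move=> s; apply: cvgD; [exact: cIhB|exact: cvg_cst].
  move=> s sL.
  have := bd s y s (y + M) sL; rewrite !lexx !lerDl M0 /= => /(_ isT sL isT)[_].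
  by rewrite !reimE/=; congr (`|_| <= _); ring.
rewrite [X in _ <= _ * X](_ : M = y + M - y); last by rewrite addrC addKr.
apply: ler_norm_itg; first by rewrite lerDl.
  by move=> s; apply: cvgB; [exact: cRvB|exact: cvg_cst].
move=> t tM.
have := bd (x + L) t x t; rewrite !lexx !lerDl L0 /= => /(_ isT tM isT tM)[+ _].
by rewrite !reimE/=; congr (`|_| <= _); ring.
Qed.

End continuous_along.
End flux.

(** * Goursat's theorem *)

Section goursat.
Variable R : realType.
Implicit Types (h f g : cplx R -> cplx R) (x y L M : R).

Lemma nested_intervals (u : nat -> R) L : 0 <= L ->
  (forall k, u k <= u k.+1 <= u k + L / 2 ^+ k.+1) ->
  exists x, forall k, u k <= x <= u k + L / 2 ^+ k.
Proof.
move=> L0 H.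
have half k : L / 2 ^+ k = L / 2 ^+ k.+1 + L / 2 ^+ k.+1.
  by rewrite exprS; field; rewrite expf_neq0.
have up : {homo u : i j / (i <= j)%N >-> i <= j}.
  by apply: homo_leq => // [? ? ?|k]; [exact: le_trans|case/andP: (H k)].
have dn : {homo (fun k => u k + L / 2 ^+ k) : i j / (i <= j)%N >-> j <= i}.
  apply: homo_leq => // [? ? ? h1 h2|k]; first exact: le_trans h2 h1.
  by rewrite (half k); case/andP: (H k) => _; lra.
have ub k : ubound (range u) (u k + L / 2 ^+ k).
  move=> _ [j _ <-]; have [kj|/ltnW jk] := leqP k j.
    by apply: le_trans (dn _ _ kj); rewrite lerDl divr_ge0// exprn_ge0.
  by apply: le_trans (up _ _ jk) _; rewrite lerDl divr_ge0// exprn_ge0.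
have hs : has_sup (range u) by split; [exists (u 0%N), 0%N|exists (u 0%N + L / 2 ^+ 0)].
exists (sup (range u)) => k; apply/andP; split.
  by apply: (ub_le_sup hs.2); exists k.
by apply: ge_sup; [case: hs|exact: ub].
Qed.

Section bisection.
Variables (h : cplx R -> cplx R) (ch : continuous h) (L M : R).
Hypotheses (L0 : 0 <= L) (M0 : 0 <= M).

Let sc k N := N / 2 ^+ k : R.
Let sc_ge0 k N : 0 <= N -> 0 <= sc k N.
Proof. by move=> N0; rewrite /sc divr_ge0// exprn_ge0. Qed.
Let sc_half k N : sc k N = sc k.+1 N + sc k.+1 N.
Proof. by rewrite /sc exprS; field; rewrite expf_neq0. Qed.

(** The flux is the sum of the fluxes of the four quarters, one of which must
    carry at least a quarter of it. *)
Let bisect_step eta k (p : R * R) :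
  eta / 4 ^+ k <= `|flux h p.1 p.2 (sc k L) (sc k M)| ->
  exists q : R * R, [/\ p.1 <= q.1 <= p.1 + sc k.+1 L, p.2 <= q.2 <= p.2 + sc k.+1 M &
    eta / 4 ^+ k.+1 <= `|flux h q.1 q.2 (sc k.+1 L) (sc k.+1 M)|].
Proof.
case: p => x y /= H.
have l0 := sc_ge0 k.+1 L0; have m0 := sc_ge0 k.+1 M0.
move: H; rewrite (sc_half k L) (sc_half k M).
set l := sc k.+1 L in l0 *; set m := sc k.+1 M in m0 *.
have -> : eta / 4 ^+ k = 4 * (eta / 4 ^+ k.+1) by rewrite exprS; field; rewrite expf_neq0.
set e := eta / _ => H.
rewrite flux_splitx// ?addr_ge0// !flux_splity// in H.
have ina (a b : R) : 0 <= b -> a <= a <= a + b by move=> ?; rewrite lexx lerDl.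
have inb (a b : R) : 0 <= b -> a <= a + b <= a + b by move=> ?; rewrite lexx lerDl andbT.
have [H1|H1] := leP e `|flux h x y l m|.
  by exists (x, y); split => //=; exact: ina.
have [H2|H2] := leP e `|flux h x (y + m) l m|.
  by exists (x, y + m); split => //=; [exact: ina|exact: inb].
have [H3|H3] := leP e `|flux h (x + l) y l m|.
  by exists (x + l, y); split => //=; [exact: inb|exact: ina].
have [H4|H4] := leP e `|flux h (x + l) (y + m) l m|.
  by exists (x + l, y + m); split => //=; exact: inb.
exfalso; move: H; apply/negP; rewrite -ltNge.
apply: le_lt_trans (ler_normD _ _) _.
apply: le_lt_trans (lerD (ler_normD _ _) (ler_normD _ _)) _.
lra.
Qed.

Lemma bisection eta x y : eta <= `|flux h x y L M| ->
  exists a b : nat -> R, exists s t,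
  forall k, [/\ a k <= s <= a k + L / 2 ^+ k, b k <= t <= b k + M / 2 ^+ k &
    eta / 4 ^+ k <= `|flux h (a k) (b k) (L / 2 ^+ k) (M / 2 ^+ k)|].
Proof.
move=> H0.
pose good k p := eta / 4 ^+ k <= `|flux h p.1 p.2 (sc k L) (sc k M)|.
have /choice[nx nxP] : forall kp : nat * (R * R), exists q : R * R, good kp.1 kp.2 ->
  [/\ kp.2.1 <= q.1 <= kp.2.1 + sc kp.1.+1 L, kp.2.2 <= q.2 <= kp.2.2 + sc kp.1.+1 M &
    good kp.1.+1 q].
  move=> [k p] /=; have [gp|ngp] := pselect (good k p).
    by have [q qP] := bisect_step gp; exists q.
  by exists p.
pose fix u k : R * R := if k is j.+1 then nx (j, u j) else (x, y).
have gu k : good k (u k).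
  elim: k => [|k IH]; first by rewrite /good /sc /= !expr0 !divr1.
  by have [] := nxP (k, u k) IH.
have [s sP] : exists s, forall k, (u k).1 <= s <= (u k).1 + L / 2 ^+ k.
  by apply: nested_intervals => // k; have [] := nxP (k, u k) (gu k).
have [t tP] : exists s, forall k, (u k).2 <= s <= (u k).2 + M / 2 ^+ k.
  by apply: nested_intervals => // k; have [] := nxP (k, u k) (gu k).
exists (fun k => (u k).1), (fun k => (u k).2), s, t => k.
by split => //; exact: gu.
Qed.

End bisection.

(** If the flux were not zero, bisection would give rectangles shrinking to a point where
    the flux is at least proportional to the square of the diameter, whereas
    the affine approximation at that point makes it of smaller order. *)
Theorem goursat h x y L M : 0 <= L -> 0 <= M -> (forall z, differentiable h z) ->
  flux h x y L M = 0.
Proof.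
move=> L0 M0 dh.
have ch : continuous h by move=> z; exact/differentiable_continuous.
apply/eqP/negP => /negP; rewrite -normr_gt0; set eta := `|_| => eta0.
have [a [b [s [t H]]]] := bisection ch L0 M0 (lexx eta).
have LM : 0 < (L + M) ^+ 2 + 1 by rewrite ltr_wpDl// sqr_ge0.
pose e := eta / 2 / (2 * ((L + M) ^+ 2 + 1)).
have e0 : 0 < e by rewrite !divr_gt0// mulr_gt0.
(* with this [e] the affine approximation makes the flux smaller than half of
   [eta / 4 ^ k] *)
pose z0 : cplx R := Complex s t.
have [d d0 Hd] := differentiable_approx (dh z0) e0.
have [k kd] : exists k : nat, (L + M) / 2 ^+ k < d.
  have [k /= kP] : exists k : nat, (L + M) / d < k%:R.
    by exists (Num.truncn `|(L + M) / d|).+1; rewrite (le_lt_trans (ler_norm _))// truncnS_gt.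
  exists k; rewrite ltr_pdivrMr ?exprn_gt0// mulrC -ltr_pdivrMr//.
  by rewrite (lt_trans kP)// -natrX ltr_nat ltn_expl.
have [sk tk fk] := H k.
move: fk; apply/negP; rewrite -ltNge.
set l := L / 2 ^+ k in sk *; set m := M / 2 ^+ k in tk *.
have l0 : 0 <= l by rewrite divr_ge0// exprn_ge0.
have m0 : 0 <= m by rewrite divr_ge0// exprn_ge0.
have lm : l + m = (L + M) / 2 ^+ k by rewrite mulrDl.
have := @flux_le_affine R h ch (a k) (b k) l m (h z0 - h^`()%classic z0 * z0)
   (h^`()%classic z0) (e * (l + m)) l0 m0.
move=> /(_ _)/le_lt_trans; apply.
  move=> s' t' s'P t'P.
  have -> : h (Complex s' t') - (h z0 - h^`()%classic z0 * z0 + h^`()%classic z0 * Complex s' t')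
    = h (Complex s' t') - h z0 - h^`()%classic z0 * (Complex s' t' - z0) by ring.
  have zz : cmod (Complex s' t' - z0) <= l + m.
    apply: le_trans (ler_cmod_ReIm _) _; rewrite /z0 !reimE/=.
    by apply: lerD; rewrite ler_norml; lra.
  apply: le_trans (Hd _ _) _; last by rewrite ler_wpM2l// ltW.
  by apply: le_lt_trans zz _; rewrite lm.
rewrite -mulrA -mulrA -expr2 lm expr_div_n -exprM mulnC exprM (_ : 2 ^+ 2 = 4 :> R); last by ring.
rewrite [e * _]mulrA [2 * _]mulrA [2 * _]mulrA ltr_pM2r; last by rewrite invr_gt0 exprn_gt0.
have -> : 2 * e * (L + M) ^+ 2 =
   eta / 2 * ((L + M) ^+ 2 / ((L + M) ^+ 2 + 1)).
  by rewrite /e; field; lra.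
apply: (@le_lt_trans _ _ (eta / 2 * 1)); last by lra.
rewrite ler_wpM2l ?divr_ge0 ?ltW// ltr_pdivrMr// mul1r; lra.
Qed.

End goursat.

(** * Mean values and derivatives of entire functions *)

Section periodic_mean.
Variable R : realType.
Implicit Types (h f g G : cplx R -> cplx R) (x y L M : R).

(** The boundary integral over [s1, s2] x [0, 2 pi] loses its horizontal sides
    by periodicity, so that the mean over a vertical period does not depend on
    the abscissa. *)
Lemma periodic_mean h (l : cplx R) : (forall z, differentiable h z) ->
  (forall s t, h (Complex s (t + 2 * pi)) = h (Complex s t)) ->
  (forall e, 0 < e -> exists s0, forall s t, s <= s0 -> cmod (h (Complex s t) - l) <= e) ->
  forall s, itg 0 (2 * pi) (fun t => complex.Re (h (Complex s t))) = 2 * pi * complex.Re l.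
Proof.
move=> dh ph lh s.
have ch : continuous h by move=> z; exact/differentiable_continuous.
have cR r : continuous (fun t : R => complex.Re (h (Complex r t))).
  by apply: (continuous_Re_along ch); exact: continuous_vline.
have p0 : 0 < 2 * pi :> R by rewrite mulr_gt0// pi_gt0.
have const s1 s2 : s1 <= s2 ->
  itg 0 (2 * pi) (fun t => complex.Re (h (Complex s1 t))) =
  itg 0 (2 * pi) (fun t => complex.Re (h (Complex s2 t))).
  move=> s12; have L0 : 0 <= s2 - s1 by rewrite subr_ge0.
  have := goursat s1 0 L0 (ltW p0) dh; rewrite /flux [s1 + (s2 - s1)]addrC subrK add0r.
  rewrite [X in _ + X](_ : _ = 0).
    by rewrite addr0 itgB// => /eqP; rewrite subr_eq0 => /eqP ->.
  rewrite (@eq_itg _ _ (fun=> 0)) ?itg_cst ?mul0r// => x _.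
  by rewrite -[2 * pi]add0r ph subrr.
apply/eqP; rewrite -subr_eq0 -normr_le0; apply/ler_addgt0Pr => e e0; rewrite add0r.
have e0' : 0 < e / (2 * pi) by rewrite divr_gt0.
have [s0 hs0] := lh _ e0'.
have ms : Num.min s s0 <= s by rewrite ge_min lexx.
have ms0 : Num.min s s0 <= s0 by rewrite ge_min lexx orbT.
rewrite -(const _ _ ms).
rewrite (_ : 2 * pi * complex.Re l = itg 0 (2 * pi) (fun=> complex.Re l)); last first.
  by rewrite itg_cst ?ltW// subr0 mulrC.
rewrite -itgB//; last by move=> x; exact: cvg_cst.
have -> : e = e / (2 * pi) * (2 * pi - 0) by rewrite subr0 divfK// gt_eqF.
apply: ler_norm_itg; first exact: ltW.
  by move=> x; apply: cvgB; [exact: cR|exact: cvg_cst].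
by move=> t _; rewrite -ReB (le_trans (ler_cmod_Re _))// hs0.
Qed.

Lemma cexp_periodic (s t : R) : cexp (Complex s (t + 2 * pi)) = cexp (Complex s t).
Proof. by rewrite /cexp/= mulr_natl cosD2pi sinD2pi. Qed.

Lemma expR_small (d : R) : 0 < d -> exists s0, forall s, s <= s0 -> expR s < d.
Proof.
move=> d0; exists (ln (d / 2)) => s ss0.
apply: (@le_lt_trans _ _ (d / 2)); last by rewrite ltr_pdivrMr// ltr_pMr// ltr1n.
by rewrite -[leRHS]lnK ?ler_expR// posrE divr_gt0.
Qed.

(** On the line of abscissa [s], [G o exp] runs over the circle of radius
    [exp s], and it tends to [G 0] when [s] goes to [-oo]. *)
Lemma mean_value G : (forall z, differentiable G z) ->
  itg 0 (2 * pi) (fun t => complex.Re (G (cexp (Complex 0 t)))) = 2 * pi * complex.Re (G 0).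
Proof.
move=> dG; apply: (@periodic_mean (G \o @cexp R) (G 0)) => /=.
- by move=> z; apply: differentiable_comp => //; exact: differentiable_cexp.
- by move=> s t; rewrite cexp_periodic.
- move=> e e0.
  have /cvg_cplxP/(_ _ e0)/nbhs_cplxP[d d0 Hd] := differentiable_continuous (dG 0).
  have [s0 hs0] := expR_small d0; exists s0 => s t /hs0 sd.
  by apply/ltW/Hd; rewrite subr0 cmod_cexp.
Qed.

(** The function [(G (exp w) - G 0) exp (- w)] tends to the derivative at 0 on
    the far left, where its mean can be computed, and is bounded by [b] up to
    [o(1)] on the far right. *)
Lemma derivative0_growth G (a b : R) : (forall z, differentiable G z) ->
  (forall z, cmod (G z) <= a + b * cmod z) ->
  `|complex.Re (G^`()%classic 0)| <= b.
Proof.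
move=> dG Gab.
pose h := fun w => (G (cexp w) - G 0) * cexp (- w).
have dh z : differentiable h z.
  apply: (@differentiableM _ _ (fun w => G (cexp w) - G 0) (fun w => cexp (- w))).
    apply: (@differentiableB _ _ _ (fun w => G (cexp w)) (cst (G 0))) => //.
    by apply: (@differentiable_comp _ _ _ _ (@cexp R) G) => //; exact: differentiable_cexp.
  apply: (@differentiable_comp _ _ _ _ (fun w : cplx R => - w) (@cexp R)).
    by apply: differentiableN.
  exact: differentiable_cexp.
have ch : continuous h by move=> z; exact/differentiable_continuous.
have ph s t : h (Complex s (t + 2 * pi)) = h (Complex s t).
  by rewrite /h !cexpN cexp_periodic.
have p0 : 0 < 2 * pi :> R by rewrite mulr_gt0// pi_gt0.
have mh s := @periodic_mean h (G^`()%classic 0) dh ph _ s.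
have {}mh s : itg 0 (2 * pi) (fun t => complex.Re (h (Complex s t))) =
   2 * pi * complex.Re (G^`()%classic 0).
  apply: mh => e e0.
  have [d d0 Hd] := differentiable_approx (dG 0) e0.
  have [s0 hs0] := expR_small d0; exists s0 => {}s t /hs0 sd.
  set w : cplx R := Complex s t.
  have := Hd (cexp w); rewrite subr0 cmod_cexp => /(_ sd) H.
  rewrite -(ler_pM2r (expR_gt0 s)); apply: le_trans H.
  have -> : expR s = cmod (cexp w) by rewrite cmod_cexp.
  rewrite -cmodM mulrBl /h -mulrA [cexp (- w) * _]mulrC cexpN divff ?cexp_neq0//.
  by rewrite mulr1.
have bound s : `|complex.Re (G^`()%classic 0)| <= b + (a + cmod (G 0)) * expR (- s).
  rewrite -(ler_pM2l p0) -{1}(ger0_norm (ltW p0)) -normrM -(mh s).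
  rewrite [leRHS]mulrC -[in leRHS](subr0 (2 * pi)); apply: ler_norm_itg; first exact: ltW.
    by apply: (continuous_Re_along ch); exact: continuous_vline.
  move=> t _; apply: le_trans (ler_cmod_Re _) _.
  rewrite /h cmodM cmod_cexp ReN/=.
  have -> : b + (a + cmod (G 0)) * expR (- s) = (a + b * expR s + cmod (G 0)) * expR (- s).
    rewrite expRN; field; by rewrite gt_eqF ?expR_gt0.
  rewrite ler_wpM2r ?expR_ge0//.
  apply: le_trans (cmodD _ _) _; rewrite cmodN lerD2r.
  by apply: le_trans (Gab _) _; rewrite cmod_cexp.
apply/ler_addgt0Pr => e e0.
have K0 : 0 < `|a + cmod (G 0)| + 1 by rewrite ltr_wpDl.
have [s0 /(_ _ (lexx s0)) hs0] := expR_small (divr_gt0 e0 K0).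
apply: le_trans (bound (- s0)) _; rewrite opprK lerD2l.
apply: (@le_trans _ _ ((`|a + cmod (G 0)| + 1) * expR s0)).
  by rewrite ler_wpM2r ?expR_ge0// (le_trans (ler_norm _))// lerDl.
by rewrite mulrC -ler_pdivlMr// ltW.
Qed.

End periodic_mean.

(** * Entire functions of linear growth *)

Section liouville.
Variable R : realType.
Implicit Types (f g G : cplx R -> cplx R) (z w v c : cplx R).

Lemma derive1_scaled_translate G w c x : differentiable G (x + w) ->
  differentiable (fun z => c * G (z + w)) x /\
  (fun z => c * G (z + w))^`()%classic x = c * G^`()%classic (x + w).
Proof.
move=> dG; apply: approx_derivative => e e0.
have c0 : 0 < cmod c + 1 by rewrite ltr_wpDl// cmod_ge0.
have [d d0 Hd] := differentiable_approx dG (divr_gt0 e0 c0).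
exists d => // z zd.
have zw : z + w - (x + w) = z - x by ring.
have := Hd (z + w); rewrite zw => /(_ zd) H.
rewrite -mulrA -!mulrBr cmodM.
apply: le_trans (ler_wpM2l (cmod_ge0 _) H) _; rewrite mulrA ler_wpM2r ?cmod_ge0//.
by rewrite mulrCA ler_piMr ?(ltW e0)// ler_pdivrMr// mul1r lerDl.
Qed.

Lemma derive1_scaled G c x : differentiable G x ->
  differentiable (fun z => c * G z) x /\
  (fun z => c * G z)^`()%classic x = c * G^`()%classic x.
Proof.
move=> dG; have := @derive1_scaled_translate G 0 c x; rewrite addr0 => /(_ dG).
by rewrite (_ : (fun z => c * G (z + 0)) = fun z => c * G z)//; apply/funext => z; rewrite addr0.
Qed.

Lemma is_derive_Re_along G z v (t : R) : differentiable G (z + of_real t * v) ->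
  is_derive t (1 : R) (fun s : R => complex.Re (G (z + of_real s * v)))
    (complex.Re (G^`()%classic (z + of_real t * v) * v)).
Proof.
set p := z + _; set l := complex.Re _ => dG.
suff H : h^-1 *: (((fun s : R => complex.Re (G (z + of_real s * v))) \o shift t) (h *: (1 : R))
    - complex.Re (G p)) @[h --> 0^'] --> l.
  split; first by apply/cvg_ex; exists l.
  by apply: cvg_lim H.
apply/cvgrPdist_lt => e e0.
have v0 : 0 < cmod v + 1 by rewrite ltr_wpDl// cmod_ge0.
have [d d0 Hd] := differentiable_approx dG (divr_gt0 e0 v0).
apply/nbhs_ballP; exists (d / (cmod v + 1)); first by rewrite /= divr_gt0.
move=> h; rewrite /ball/= sub0r normrN => hd h0; rewrite /GRing.scale/= mulr1.
have -> : z + of_real (h + t) * v = of_real h * v + p.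
  by rewrite /p of_realD; ring.
have hv : cmod (of_real h * v) < d.
  rewrite cmodM cmod_of_real.
  apply: le_lt_trans (_ : `|h| * (cmod v + 1) < d); last by rewrite -ltr_pdivlMr.
  by rewrite ler_wpM2l// lerDl.
have := Hd (of_real h * v + p); rewrite addrK => /(_ hv).
move=> /(le_trans (ler_cmod_Re _)); rewrite cmodM cmod_of_real !ReB => H.
have E : complex.Re (G^`()%classic p * (of_real h * v)) = h * l.
  by rewrite /l !reimE/=; ring.
rewrite E in H.
have h0' : 0 < `|h| by rewrite normr_gt0.
rewrite distrC -(ltr_pM2r h0') -normrM mulrBl mulrAC mulVf// mul1r [l * h]mulrC.
apply: le_lt_trans H _; rewrite mulrCA mulrC ltr_pM2r//.
by rewrite -mulrA gtr_pMr// mulrC ltr_pdivrMr// mul1r ltrDl.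
Qed.

Let mi : cplx R := Complex 0 (-1).

Let Re_mi z : complex.Re (mi * z) = complex.Im z.
Proof. by rewrite reimE/=; ring. Qed.

Let cmod_mi : cmod mi = 1.
Proof. by rewrite cmodE/= expr0n/= add0r sqrrN expr1n sqrtr1. Qed.

(** The mean value theorem on the segment from [z] to [z + v]. *)
Lemma Re_lipschitz F (K : R) z v : (forall z, differentiable F z) -> (forall z, cmod (F^`()%classic z) <= K) ->
  `|complex.Re (F (z + v) - F z)| <= K * cmod v.
Proof.
move=> dF FK.
pose u (s : R) := complex.Re (F (z + of_real s * v)).
have [c _] : exists2 c, c \in `]0, 1[%R & u 1 - u 0 =
    complex.Re (F^`()%classic (z + of_real c * v) * v) * (1 - 0).
  apply: (MVT ltr01) => [x _|]; first exact: is_derive_Re_along.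
  apply: continuous_subspaceT => x.
  apply: differentiable_continuous; apply/derivable1_diffP.
  by have [] := @is_derive_Re_along F z v x (dF _).
rewrite /u subr0 mulr1 !(of_real0,of_real1) mul1r mul0r addr0 -ReB => ->.
apply: le_trans (ler_cmod_Re _) _.
by rewrite cmodM ler_wpM2r ?cmod_ge0.
Qed.

(** The factor 2 comes from estimating the real and the imaginary part
    separately. *)
Lemma bounded_derivative_lipschitz G (K : R) z v : (forall z, differentiable G z) ->
  (forall z, cmod (G^`()%classic z) <= K) ->
  cmod (G (z + v) - G z) <= 2 * K * cmod v.
Proof.
move=> dG GK; apply: le_trans (ler_cmod_ReIm _) _.
rewrite -mulrA mulr_natl mulr2n; apply: lerD; first exact: Re_lipschitz.
rewrite -Re_mi mulrBr.
apply: (@Re_lipschitz (fun z => mi * G z)) => w; have [dm em] := derive1_scaled mi (dG w) => //.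
by rewrite em cmodM cmod_mi mul1r.
Qed.

(** Translation moves [w] to 0, and a unimodular factor gives access to the
    imaginary part. *)
Lemma derivative_growth G (a b : R) w : (forall z, differentiable G z) ->
  0 <= b -> (forall z, cmod (G z) <= a + b * cmod z) ->
  cmod (G^`()%classic w) <= 2 * b.
Proof.
move=> dG b0 Gab.
have H c : cmod c = 1 -> `|complex.Re (c * G^`()%classic w)| <= b.
  move=> c1; have [_] := @derive1_scaled_translate G w c 0 (dG _); rewrite add0r => <-.
  apply: (@derivative0_growth _ _ (a + b * cmod w)).
    by move=> z; have [] := @derive1_scaled_translate G w c z (dG _).
  move=> z; rewrite cmodM c1 mul1r; apply: le_trans (Gab _) _.
  by rewrite -addrA lerD2l -mulrDr addrC ler_wpM2l// cmodD.
apply: le_trans (ler_cmod_ReIm _) _; rewrite mulr_natl mulr2n; apply: lerD.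
  by have := H 1; rewrite cmod1 mul1r; exact.
by rewrite -Re_mi; exact: H.
Qed.

(** The difference [G (w + z) - G z] is bounded in [z] because [G] has a bounded
    derivative, so the estimate for functions of growth [a + 0 * |z|] kills its
    derivative: [G] has a constant derivative. *)
Theorem linear_growth_affine G (a b : R) : (forall z, differentiable G z) ->
  0 <= b -> (forall z, cmod (G z) <= a + b * cmod z) ->
  forall z, G z = G 0 + G^`()%classic 0 * z.
Proof.
move=> dG b0 Gab.
have lip z v := bounded_derivative_lipschitz z v dG (fun w => derivative_growth w dG b0 Gab).
have derB (F1 F2 : cplx R -> cplx R) z : (forall z, differentiable F1 z) -> (forall z, differentiable F2 z) ->
    differentiable (fun z => F1 z - F2 z) z /\
    (fun z => F1 z - F2 z)^`()%classic z = F1^`()%classic z - F2^`()%classic z.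
  move=> d1 d2; split; first exact: (@differentiableB _ _ _ F1 F2).
  rewrite !derive1E (_ : (fun z => _) = F1 - F2)// deriveB//; exact/derivable1_diffP.
have dT w z : differentiable (fun z => G (z + w)) z /\
    (fun z => G (z + w))^`()%classic z = G^`()%classic (z + w).
  have := @derive1_scaled_translate G w 1 z (dG _); rewrite mul1r.
  by rewrite (_ : (fun z => 1 * _) = (fun z => G (z + w)))//; apply/funext => x; rewrite mul1r.
have cst' w : G^`()%classic w = G^`()%classic 0.
  apply/eqP; rewrite -subr_eq0; apply/eqP/cmod_eq0/eqP.
  rewrite eq_le cmod_ge0 andbT.
  have [_ E] := derB (fun z => G (z + w)) G 0 (fun z => (dT w z).1) dG.
  rewrite (dT w 0).2 add0r in E; rewrite -E.
  have {1}-> : 0 = 2 * 0 :> R by rewrite mulr0.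
  apply: (@derivative_growth _ (2 * (2 * b) * cmod w)) => // z.
    exact: (derB (fun z => G (z + w)) G z (fun z => (dT w z).1) dG).1.
  by rewrite mul0r addr0; exact: lip.
move=> z.
have dL x : differentiable (fun z => G^`()%classic 0 * z) x /\
   (fun z => G^`()%classic 0 * z)^`()%classic x = G^`()%classic 0.
  apply: approx_derivative => e e0; exists 1 => // w _.
  by rewrite -mulrBr subrr cmod0 mulr_ge0 ?cmod_ge0// ltW.
have dF x := derB G (fun z => G^`()%classic 0 * z) x dG (fun x => (dL x).1).
have := @bounded_derivative_lipschitz (fun z => G z - G^`()%classic 0 * z) 0 0 z (fun x => (dF x).1).
rewrite /= add0r !(mulr0, mul0r) subr0 => H.
have : cmod (G z - G^`()%classic 0 * z - G 0) <= 0.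
  by apply: H => w; rewrite (dF w).2 (dL w).2 cst' subrr cmod0.
move=> h0; apply/eqP; rewrite -subr_eq0; apply/eqP/cmod_eq0/eqP.
rewrite eq_le cmod_ge0 andbT; apply: le_trans h0.
by rewrite le_eqVlt; apply/orP; left; apply/eqP; congr cmod; ring.
Qed.

End liouville.

(** * Measure-preserving maps *)

Section measure_preserving.
Local Open Scope ereal_scope.

Definition measure_preserving d (T : measurableType d) (R : realType)
    (mu : set T -> \bar R) (g : T -> T) :=
  measurable_fun setT g /\ forall A, measurable A -> mu (g @^-1` A) = mu A.

Section basic.
Context d (T : measurableType d) (R : realType) (mu : {measure set T -> \bar R}).

Lemma measure_preserving_id : measure_preserving mu id.
Proof. by split => [|A]; [exact: measurable_id|]. Qed.

Lemma measure_preserving_comp g h : measure_preserving mu g -> measure_preserving mu h ->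
  measure_preserving mu (g \o h).
Proof.
move=> [mg pg] [mh ph]; split; first exact: measurableT_comp.
move=> A mA; rewrite -(pg A mA) -[RHS]ph//.
by rewrite -[X in measurable X]setTI; exact: mg.
Qed.

Lemma ge0_integral_preserving g (f : T -> \bar R) : measure_preserving mu g ->
  measurable_fun setT f -> (forall x, 0 <= f x) ->
  \int[mu]_x f (g x) = \int[mu]_x f x.
Proof.
move=> [mg pg] mf f0.
pose gm : {mfun T >-> T} := HB.pack g (isMeasurableFun.Build _ _ _ _ g mg).
have := @ge0_integral_pushforward _ _ _ _ _ _ mg mu setT f measurableT mf (fun x _ => f0 x).
rewrite preimage_setT => <-.
apply: (@eq_measure_integral _ _ _ _ mu (pushforward mu gm)) => A mA _.
by rewrite -(pg _ mA).
Qed.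

Lemma integrable_preserving g (f : T -> \bar R) : measure_preserving mu g ->
  mu.-integrable setT f -> mu.-integrable setT (f \o g).
Proof.
move=> pg /integrableP[mf foo]; apply/integrableP; split.
  by apply: measurableT_comp => //; case: pg.
rewrite (@ge0_integral_preserving g (fun x => `|f x|))//.
exact: measurableT_comp.
Qed.

Lemma integral_preserving g (f : T -> \bar R) : measure_preserving mu g ->
  mu.-integrable setT f -> \int[mu]_x f (g x) = \int[mu]_x f x.
Proof.
move=> pg fi; have [mf _] := integrableP _ _ _ fi.
have -> : (fun x => f (g x)) = f \o g by [].
rewrite integralE [RHS]integralE funepos_comp funeneg_comp.
rewrite -(ge0_integral_preserving pg (measurable_funepos mf)); last exact: funepos_ge0.
by rewrite -(ge0_integral_preserving pg (measurable_funeneg mf)); last exact: funeneg_ge0.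
Qed.

End basic.

Section product.
Context d1 d2 (T1 : measurableType d1) (T2 : measurableType d2) (R : realType).
Variables (m1 : {sigma_finite_measure set T1 -> \bar R}).
Variables (m2 : {sigma_finite_measure set T2 -> \bar R}).

(** A skew product: the second factor may be moved by a transformation depending
    on the first coordinate; both shears and direct products are of this form. *)
Lemma measure_preserving_skew g (h : T1 -> T2 -> T2) : measure_preserving m1 g ->
  (forall x, measure_preserving m2 (h x)) ->
  measurable_fun setT (fun p : T1 * T2 => h p.1 p.2) ->
  measure_preserving (m1 \x m2) (fun p => (g p.1, h p.1 p.2)).
Proof.
move=> pg ph mh; split.
  apply: measurable_fun_pair => //; apply: measurableT_comp => //; by case: pg.
move=> A mA; rewrite /product_measure1.
have mxA := measurable_fun_xsection m2 mA.
rewrite -(@ge0_integral_preserving _ _ _ m1 g (m2 \o xsection A))//; last first.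
apply: eq_integral => x _ /=.
have [_ /(_ _ (measurable_xsection (g x) mA)) <-] := ph x.
congr (m2 _); apply/seteqP; split => y /=; rewrite /xsection/= !inE//.
Qed.

Lemma measure_preserving_prod g h : measure_preserving m1 g -> measure_preserving m2 h ->
  measure_preserving (m1 \x m2) (fun p => (g p.1, h p.2)).
Proof.
move=> pg ph; apply: (@measure_preserving_skew g (fun=> h)) => //.
by apply: measurableT_comp => //; case: ph.
Qed.

End product.

Section tuples.
Context d (T : measurableType d) (R : realType) (m : {sigma_finite_measure set T -> \bar R}).

Lemma measure_preserving_cons n (m2 : {sigma_finite_measure set (n.-tuple T) -> \bar R})
    g (h : n.-tuple T -> n.-tuple T) :
  measure_preserving m g -> measure_preserving m2 h ->
  measure_preserving (cons_measure m m2)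
    (fun t => [tuple of g (thead t) :: h [tuple of behead t]]).
Proof.
move=> pg ph; have [mgh pgh] := measure_preserving_prod pg ph.
have mu := @measurable_tuple_uncons _ T n.
split.
  apply: (measurable_cons (f := fun t => g (thead t)) (g := fun t => h [tuple of behead t])).
    by apply: measurableT_comp; [case: pg|exact: measurable_tnth].
  by apply: measurableT_comp; [case: ph|exact: measurable_behead].
move=> A mA; rewrite /cons_measure /pushforward -[RHS]pgh; last first.
  by rewrite -[X in measurable X]setTI; exact: measurable_tuple_cons.
congr ((_ \x _) _); apply/funext => -[x t].
rewrite /preimage/mkset /= /tuple_cons /= theadE.
by have -> : [tuple of behead [tuple of x :: t]] = t by exact/val_inj.
Qed.

Lemma measure_preserving_power n (g : 'I_n -> T -> T) : (forall i, measure_preserving m (g i)) ->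
  measure_preserving (power_measure m n) (fun t => [tuple g i (tnth t i) | i < n]).
Proof.
elim: n g => [|n IH] g pg.
  rewrite (_ : (fun t => _) = id); first exact: measure_preserving_id.
  by apply/funext => t; rewrite tuple0 [RHS]tuple0.
have := measure_preserving_cons (pg ord0) (IH (fun i => g (lift ord0 i)) (fun i => pg _)).
rewrite (_ : (fun t => [tuple g i (tnth t i)  | i < n.+1]) =
  fun t => [tuple of g ord0 (thead t) :: [tuple g (lift ord0 i) (tnth [tuple of behead t] i) | i < n]])//.
apply/funext => t; apply: eq_from_tnth => i; rewrite tnth_mktuple.
case: (unliftP ord0 i) => [j ->|->] /=; last by [].
rewrite tnthS tnth_mktuple; congr (g _ _).
by rewrite [in LHS](tuple_eta t) tnthS.
Qed.

End tuples.
End measure_preserving.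

(** * Translations and rotations of C^n *)

Section plane_motions.
Variable R : realType.
Local Notation RR := (measurableTypeR R).
Local Notation leb := (@lebesgue_measure R).

(** Lebesgue measure is determined by its values on intervals. *)
Lemma lebesgue_shift_preserving (t : R) : measure_preserving leb (fun x : RR => x + t : RR).
Proof.
have ms : measurable_fun setT (fun x : RR => x + t : RR) by exact: measurable_funD.
split=> // A mA.
pose gm : {mfun RR >-> RR} := HB.pack (fun x : RR => x + t : RR) (isMeasurableFun.Build _ _ _ _ _ ms).
apply/esym; apply: (@lebesgue_measure_unique R (pushforward leb gm)) => //= _ [[a b]] _ <-.
rewrite /pushforward/= (_ : _ @^-1` _ = `]a - t, b - t]%classic); last first.
  by apply/seteqP; split => x /=; rewrite !in_itv/= ltrBlDr lerBrDr.
rewrite !lebesgue_measure_itv/= !lte_fin ltrBlDr subrK.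
by case: ifP => // _; rewrite -!EFinB; congr (_%:E); ring.
Qed.

Lemma shear2_preserving (k : R) : measure_preserving (@plane_measure R)
  (fun p : RR * RR => (p.1, p.2 + k * p.1)).
Proof.
apply: (@measure_preserving_skew _ _ _ _ _ leb leb id (fun x y : RR => y + k * x : RR)).
- exact: measure_preserving_id.
- by move=> x; exact: lebesgue_shift_preserving.
- by apply: measurable_funD => //; apply: measurable_funM.
Qed.

Lemma swap_preserving : measure_preserving (@plane_measure R) (fun p : RR * RR => (p.2, p.1)).
Proof.
split; first exact: measurable_fun_pair.
move=> A mA; rewrite /plane_measure.
have mB : measurable ((fun p : RR * RR => (p.2, p.1)) @^-1` A).
  by rewrite -[X in measurable X]setTI; apply: measurable_fun_pair.
have -> : (leb \x leb)%E A = (leb \x^ leb)%E A.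
  apply: (@product_measure_unique _ _ _ _ _ leb leb (leb \x^ leb)%E) => // A1 A2 mA1 mA2.
  exact: product_measure2E.
rewrite /product_measure1/product_measure2; apply: eq_integral => x _ /=.
by congr (leb _); apply/seteqP; split => y; rewrite /xsection/ysection/= !inE.
Qed.

(** Conjugate of the other shear by the exchange of coordinates. *)
Lemma shear1_preserving (k : R) : measure_preserving (@plane_measure R)
  (fun p : RR * RR => (p.1 + k * p.2, p.2)).
Proof.
have h := measure_preserving_comp (measure_preserving_comp swap_preserving (shear2_preserving k))
            swap_preserving.
by rewrite (_ : (fun p => _) = ((fun p : RR * RR => (p.2, p.1)) \o
   (fun p : RR * RR => (p.1, p.2 + k * p.1))) \o (fun p : RR * RR => (p.2, p.1))).
Qed.

(** The shear coefficient [k] is [- tan (theta / 2)] for the rotation of angle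
    [theta], which is undefined for the half turn only. *)
Let rotation_preserving' (c s : R) : c ^+ 2 + s ^+ 2 = 1 -> 1 + c != 0 ->
  measure_preserving (@plane_measure R)
    (fun p : RR * RR => (c * p.1 - s * p.2, s * p.1 + c * p.2)).
Proof.
move=> cs c1; set k := - (s / (1 + c)).
have := measure_preserving_comp (measure_preserving_comp (shear1_preserving k) (shear2_preserving s))
            (shear1_preserving k).
rewrite (_ : _ \o _ = (fun p : RR * RR => (c * p.1 - s * p.2, s * p.1 + c * p.2)))//.
have ks : k * s = c - 1.
  have -> : k * s = - s ^+ 2 / (1 + c) by rewrite /k; field.
  have -> : s ^+ 2 = 1 - c ^+ 2 by rewrite -cs; ring.
  by field.
have kc : k * (1 + c) = - s by rewrite /k mulNr divfK.
apply/funext => -[x y] /=; congr pair; last by transitivity (s * x + (1 + k * s) * y); [|rewrite ks]; ring.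
transitivity ((1 + k * s) * x + (k * (1 + (1 + k * s))) * y); first by ring.
by rewrite ks (_ : 1 + (1 + (c - 1)) = 1 + c) ?kc; ring.
Qed.

(** A rotation is a product of three shears, except for the half turn, which is
    the square of a quarter turn. *)
Lemma rotation_preserving (c s : R) : c ^+ 2 + s ^+ 2 = 1 ->
  measure_preserving (@plane_measure R)
    (fun p : RR * RR => (c * p.1 - s * p.2, s * p.1 + c * p.2)).
Proof.
move=> cs; have [c1|] := eqVneq (1 + c) 0; last exact: rotation_preserving'.
have cE : c = -1 by apply/eqP; rewrite -subr_eq0 opprK addrC c1.
have s0 : s = 0.
  by move: cs => /eqP; rewrite cE sqrrN expr1n -subr_eq0 addrC addKr sqrf_eq0 => /eqP.
have q : measure_preserving (@plane_measure R)
    (fun p : RR * RR => (0 * p.1 - 1 * p.2, 1 * p.1 + 0 * p.2)).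
  by apply: rotation_preserving'; rewrite ?addr0 ?oner_neq0// expr0n add0r expr1n.
have := measure_preserving_comp q q.
rewrite (_ : _ \o _ = (fun p : RR * RR => (c * p.1 - s * p.2, s * p.1 + c * p.2)))//.
by apply/funext => -[x y] /=; rewrite cE s0; congr pair; ring.
Qed.

Lemma translation_preserving (a b : R) : measure_preserving (@plane_measure R)
    (fun p : RR * RR => (p.1 + a, p.2 + b)).
Proof.
exact: (measure_preserving_prod (lebesgue_shift_preserving a) (lebesgue_shift_preserving b)).
Qed.

Lemma Cn_translation_preserving n (w : Cn R n) :
  exists2 g, measure_preserving (Cn_volume R n) g &
    forall t, tuple_to_Cn (g t) = tuple_to_Cn t + w.
Proof.
exists (fun t : n.-tuple (RR * RR) => [tuple ((tnth t i).1 + complex.Re (w ord0 i),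
   (tnth t i).2 + complex.Im (w ord0 i)) | i < n]).
  apply: (measure_preserving_power
    (g := fun i (p : RR * RR) => (p.1 + complex.Re (w ord0 i), p.2 + complex.Im (w ord0 i)))).
  by move=> i; exact: translation_preserving.
move=> t; apply/rowP => i; rewrite !mxE tnth_mktuple.
by apply: cplx_ext; rewrite !reimE.
Qed.

Lemma Cn_rotation_preserving n (u : cplx R) : cmod u = 1 ->
  exists2 g, measure_preserving (Cn_volume R n) g &
    forall t, tuple_to_Cn (g t) = u *: tuple_to_Cn t.
Proof.
move=> u1.
exists (fun t : n.-tuple (RR * RR) => [tuple
   (complex.Re u * (tnth t i).1 - complex.Im u * (tnth t i).2,
    complex.Im u * (tnth t i).1 + complex.Re u * (tnth t i).2) | i < n]).
  apply: (measure_preserving_power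
    (g := fun i (p : RR * RR) => (complex.Re u * p.1 - complex.Im u * p.2,
             complex.Im u * p.1 + complex.Re u * p.2))).
  by move=> i; apply: rotation_preserving; rewrite -sqr_cmod u1 expr1n.
move=> t; apply/rowP => i; rewrite !mxE tnth_mktuple.
by apply: cplx_ext; rewrite !reimE//= addrC.
Qed.

End plane_motions.

(** * Measurability of continuous functions on C^n *)

Section Cn_topology.
Variables (R : realType) (n : nat).
Implicit Types z w : Cn R n.

Lemma nbhs_CnP z (P : set (Cn R n)) :
  nbhs z P <-> exists2 d : R, 0 < d & forall w, (forall j, cmod (w ord0 j - z ord0 j) < d) -> P w.
Proof.
split=> [/nbhs_ballP[e /= ep zP]|[d d0 zP]].
  have [e0 eE] := cplx_gt0_cmod ep.
  exists (cmod e) => // w wz; apply: zP; split => // i j.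
  by rewrite ord1 /ball/= -eE distrC ltc_norm.
apply/nbhs_ballP; exists (of_real d); first by rewrite /= ltcR.
move=> w wz; apply: zP => j; have := wz.2 ord0 j.
by rewrite /ball/= distrC ltc_norm.
Qed.

Lemma cvg_CnP T (F : set_system T) {FF : Filter F} (f : T -> Cn R n) z :
  (forall j, f x ord0 j @[x --> F] --> z ord0 j) -> f x @[x --> F] --> z.
Proof.
move=> H P /nbhs_CnP[d d0 zP].
have : \forall x \near F, forall j, cmod (f x ord0 j - z ord0 j) < d.
  by apply: filter_forall => j; have /cvg_cplxP/(_ _ d0) := H j.
by apply: filterS => x; exact: zP.
Qed.

End Cn_topology.

Section complex_measurable.
Context d (T : measurableType d) (R : realType).
Implicit Types f g : T -> cplx R.

Definition cmeasurable f := measurable_fun setT (fun t => complex.Re (f t)) /\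
  measurable_fun setT (fun t => complex.Im (f t)).

Lemma cmeasurable_cst (c : cplx R) : cmeasurable (fun=> c).
Proof. by split; exact: measurable_cst. Qed.

Lemma cmeasurableD f g : cmeasurable f -> cmeasurable g -> cmeasurable (fun t => f t + g t).
Proof.
move=> [f1 f2] [g1 g2]; split.
  by under eq_fun do rewrite ReD; exact: measurable_funD.
by under eq_fun do rewrite ImD; exact: measurable_funD.
Qed.

Lemma cmeasurableM f g : cmeasurable f -> cmeasurable g -> cmeasurable (fun t => f t * g t).
Proof.
move=> [f1 f2] [g1 g2]; split.
  by under eq_fun do rewrite ReM; apply: measurable_funB; exact: measurable_funM.
by under eq_fun do rewrite ImM; apply: measurable_funD; exact: measurable_funM.
Qed.

Lemma cmeasurableJ f : cmeasurable f -> cmeasurable (fun t => (f t)^*).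
Proof.
move=> [f1 f2]; split.
  by under eq_fun do rewrite ReJ.
by under eq_fun do rewrite ImJ; exact: measurableT_comp.
Qed.

Lemma cmeasurable_sum I (r : seq I) (F : I -> T -> cplx R) :
  (forall i, cmeasurable (F i)) -> cmeasurable (fun t => \sum_(i <- r) F i t).
Proof.
move=> mF; elim: r => [|i r IH].
  by under eq_fun do rewrite big_nil; exact: cmeasurable_cst.
by under eq_fun do rewrite big_cons; exact: cmeasurableD.
Qed.

Lemma cmeasurable_of_real (f : T -> R) : measurable_fun setT f -> cmeasurable (fun t => of_real (f t)).
Proof. by move=> mf; split => //; exact: measurable_cst. Qed.

Lemma cmeasurable_cexp f : cmeasurable f -> cmeasurable (fun t => cexp (f t)).
Proof.
move=> [f1 f2]; split => /=; apply: measurable_funM; apply: measurableT_comp => //.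
- by apply: continuous_measurable_fun; exact: continuous_cos.
- by apply: continuous_measurable_fun; exact: continuous_sin.
Qed.

Lemma measurable_cmod f : cmeasurable f -> measurable_fun setT (fun t => cmod (f t)).
Proof.
move=> [f1 f2]; under eq_fun do rewrite cmodE.
have ms : measurable_fun setT (@Num.sqrt R).
  by apply: continuous_measurable_fun; exact: sqrt_continuous.
apply: (measurableT_comp ms).
by apply: measurable_funD; exact: measurable_funX.
Qed.

(** The cell of the grid of mesh [1 / k.+1] that contains [p t]: it takes its
    values in a countable type. *)
Let cell n k (p : T -> Cn R n) (t : T) : n.-tuple (int * int) :=
  [tuple (Num.floor (k.+1%:R * complex.Re (p t ord0 i)),
          Num.floor (k.+1%:R * complex.Im (p t ord0 i))) | i < n].

Let corner n k (v : n.-tuple (int * int)) : Cn R n :=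
  \row_i Complex ((tnth v i).1%:~R / k.+1%:R) ((tnth v i).2%:~R / k.+1%:R).

Let floor_cvg (x : R) : (Num.floor (k.+1%:R * x))%:~R / k.+1%:R @[k --> \oo] --> x.
Proof.
apply/cvgrPdist_lt => e e0.
near=> k.
have k0 : 0 < k.+1%:R :> R by [].
have /andP[h1 h2] := floor_itv (k.+1%:R * x).
rewrite intrD mulr1z in h2.
have -> : x - (Num.floor (k.+1%:R * x))%:~R / k.+1%:R =
   (k.+1%:R * x - (Num.floor (k.+1%:R * x))%:~R) / k.+1%:R by field; rewrite gt_eqF.
rewrite normrM [X in _ * X]ger0_norm ?invr_ge0// ltr_pdivrMr//.
rewrite ger0_norm ?subr_ge0//; apply: (@lt_le_trans _ _ 1); first by lra.
rewrite mulrC -ler_pdivrMr// div1r; apply/ltW.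
apply: (@lt_trans _ _ k%:R); last by rewrite ltr_nat.
by near: k; exact: nbhs_infty_gtr.
Unshelve. all: by end_near. Qed.

(** Rounding the coordinates down to a grid of mesh [1 / k.+1] makes the
    composition a function with countably many values, hence measurable, and
    continuity recovers the original function as the limit. *)
Lemma measurable_continuous_Cn n (F : Cn R n -> R) (p : T -> Cn R n) :
  continuous F -> (forall i, cmeasurable (fun t => p t ord0 i)) ->
  measurable_fun setT (fun t => F (p t)).
Proof.
move=> cF mp.
apply: (@measurable_fun_cvg _ _ _ setT (fun k t => F (corner k (cell k p t)))) => [k|t _]; last first.
  apply: (@cvg_comp _ _ _ (fun k => corner k (cell k p t)) F _ (nbhs (p t))); last exact: cF.
  apply: cvg_CnP => j.
  under eq_fun do rewrite mxE tnth_mktuple.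
  have E : Complex (complex.Re (p t ord0 j)) (complex.Im (p t ord0 j)) = p t ord0 j :> cplx R.
    exact: cplx_ext.
  have := cvg_Complex (@floor_cvg (complex.Re (p t ord0 j))) (@floor_cvg (complex.Im (p t ord0 j))).
  by rewrite E; apply.
move=> _ B mB; rewrite setTI.
rewrite (_ : _ @^-1` B = \bigcup_(v in [set v | B (F (corner k v))]) [set t | cell k p t = v]); last first.
  apply/seteqP; split => [t Bt|t [v Bv /= vE]]; first by exists (cell k p t).
  by move: Bv; rewrite /= -vE.
rewrite bigcup_mkcond; apply: countable_bigcupT_measurable => // v.
case: ifPn => _; last exact: measurable0.
rewrite (_ : [set t | _] = \bigcap_(i in [set: 'I_n]) [set t | tnth (cell k p t) i = tnth v i]); last first.
  by apply/seteqP; split => [t /= <- //|t H]; apply: eq_from_tnth => i; exact: H.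
apply: fin_bigcap_measurable; first exact: finite_finset.
move=> i _; under eq_fun do rewrite tnth_mktuple.
have mfl (g : T -> R) (m : int) : measurable_fun setT g ->
    measurable [set t | Num.floor (k.+1%:R * g t) = m].
  move=> mg.
  rewrite (_ : [set t | _] = setT `&` (fun t => k.+1%:R * g t) @^-1` `[m%:~R, (m + 1)%:~R[%classic).
    by apply: measurable_funM.
  rewrite setTI; apply/seteqP; split => t /=; rewrite in_itv/=.
    by move=> /eqP; rewrite floor_eq.
  by rewrite -floor_eq => /eqP.
rewrite (_ : [set t | _] = [set t | Num.floor (k.+1%:R * complex.Re (p t ord0 i)) = (tnth v i).1] `&`
   [set t | Num.floor (k.+1%:R * complex.Im (p t ord0 i)) = (tnth v i).2]).
  by apply: measurableI; apply: mfl; case: (mp i).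
apply/seteqP; split => t /=; first by case: (tnth v i) => a b [-> ->].
by case: (tnth v i) => a b [/= -> ->].
Qed.

Lemma cmeasurable_continuous_Cn n (F : Cn R n -> cplx R) (p : T -> Cn R n) :
  continuous F -> (forall i, cmeasurable (fun t => p t ord0 i)) ->
  cmeasurable (fun t => F (p t)).
Proof.
move=> cF mp; split.
  apply: (measurable_continuous_Cn (F := fun z => complex.Re (F z))) => // z.
  by apply: (@continuous_comp _ _ _ F (@complex.Re R)); [exact: cF|exact: continuous_Re].
apply: (measurable_continuous_Cn (F := fun z => complex.Im (F z))) => // z.
by apply: (@continuous_comp _ _ _ F (@complex.Im R)); [exact: cF|exact: continuous_Im].
Qed.

End complex_measurable.

Lemma cmeasurable_tuple_to_Cn (R : realType) n (i : 'I_n) :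
  cmeasurable (fun t : n.-tuple (measurableTypeR R * measurableTypeR R)%type => tuple_to_Cn t ord0 i).
Proof.
split; under eq_fun do rewrite mxE /=.
  exact: (measurableT_comp measurable_fst (measurable_tnth i)).
exact: (measurableT_comp measurable_snd (measurable_tnth i)).
Qed.

(** * Integrals of real and complex functions *)

Section real_integral.
Context d (T : measurableType d) (R : realType) (mu : {measure set T -> \bar R}).
Implicit Types f g : T -> R.

Definition rintegrable f := mu.-integrable setT (EFin \o f).

Lemma rintegrable_measurable f : rintegrable f -> measurable_fun setT f.
Proof. by move=> /integrableP[] /measurable_EFinP. Qed.

Lemma rintegrable_le f g : measurable_fun setT f -> (forall t, `|f t| <= g t) ->
  rintegrable g -> rintegrable f.
Proof.
move=> mf fg gi; apply: (le_integrable measurableT _ _ gi) => /=.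
  exact/measurable_EFinP.
by move=> t _ /=; rewrite lee_fin (le_trans (fg t))// ler_norm.
Qed.

Lemma rintegrableD f g : rintegrable f -> rintegrable g -> rintegrable (fun t => f t + g t).
Proof. by move=> fi gi; exact: (integrableD measurableT fi gi). Qed.

Lemma rintegrableZ k f : rintegrable f -> rintegrable (fun t => k * f t).
Proof. by move=> fi; exact: (integrableZl measurableT k fi). Qed.

Lemma rintegrable_norm f : rintegrable f -> rintegrable (fun t => `|f t|).
Proof. exact: integrable_norm. Qed.

Lemma rintegrable0 : rintegrable (fun=> 0).
Proof. exact: integrable0. Qed.

Lemma EFin_Rintegral f : rintegrable f ->
  (\int[mu]_t f t)%:E = (\int[mu]_t (f t)%:E)%E.
Proof. by move=> fi; rewrite fineK//; exact: integrable_fin_num fi. Qed.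

Lemma ge0_rintegrable f : measurable_fun setT f -> (forall t, 0 <= f t) ->
  (\int[mu]_t (f t)%:E < +oo)%E -> rintegrable f.
Proof.
move=> mf f0 foo; apply/integrableP; split; first exact/measurable_EFinP.
by under eq_integral do rewrite /= ger0_norm//.
Qed.

Lemma ge0_rintegrableP f : (forall t, 0 <= f t) -> rintegrable f ->
  (\int[mu]_t (f t)%:E < +oo)%E.
Proof. by move=> f0 fi; rewrite -EFin_Rintegral// ltry. Qed.

Lemma rintegrable_preserving (g : T -> T) f : measure_preserving mu g -> rintegrable f ->
  rintegrable (fun t => f (g t)).
Proof. by move=> pg fi; exact: (integrable_preserving pg fi). Qed.

Lemma Rintegral_preserving (g : T -> T) f : measure_preserving mu g -> rintegrable f ->
  \int[mu]_t f (g t) = \int[mu]_t f t.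
Proof. by move=> pg fi; rewrite /Rintegral (@integral_preserving _ _ _ mu g (EFin \o f)). Qed.

End real_integral.

Section real_fubini.
Context d1 d2 (T1 : measurableType d1) (T2 : measurableType d2) (R : realType).
Variables (m1 : {sigma_finite_measure set T1 -> \bar R}).
Variables (m2 : {sigma_finite_measure set T2 -> \bar R}).

(** The bound [B] on the inner integrals makes [F] integrable for the product
    measure, by Tonelli. *)
Lemma Rintegral_swap (F : T1 -> T2 -> R) (B : T1 -> R) :
  measurable_fun setT (fun p : T1 * T2 => F p.1 p.2) ->
  (forall x, rintegrable m2 (F x)) -> (forall y, rintegrable m1 (F ^~ y)) ->
  rintegrable m1 B -> (forall x, \int[m2]_y `|F x y| <= B x) ->
  \int[m1]_x \int[m2]_y F x y = \int[m2]_y \int[m1]_x F x y.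
Proof.
move=> mF i2 i1 iB FB.
have mF' : measurable_fun setT (fun p : T1 * T2 => (F p.1 p.2)%:E) by exact/measurable_EFinP.
have mN : measurable_fun setT (fun p : T1 * T2 => `|(F p.1 p.2)%:E|%E).
  exact: measurableT_comp mF'.
have iF : (m1 \x m2)%E.-integrable setT (fun p : T1 * T2 => (F p.1 p.2)%:E).
  apply/integrable12ltyP => //=.
  apply: le_lt_trans (ge0_rintegrableP _ (rintegrable_norm iB)) => //.
  apply: ge0_le_integral => //.
  - by move=> x _; apply: integral_ge0.
  - by apply: (@measurable_fun_fubini_tonelli_F _ _ _ _ _ m2 _ mN).
  - by apply/measurable_EFinP; exact: rintegrable_measurable (rintegrable_norm iB).
  move=> x _; rewrite -(EFin_Rintegral (rintegrable_norm (i2 x))) lee_fin.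
  exact: le_trans (FB x) (ler_norm _).
have E1 := integral12_prod_meas1 iF; have E2 := integral21_prod_meas1 iF.
rewrite /Rintegral; congr fine.
transitivity ((\int[m1 \x m2]_z (F z.1 z.2)%:E)%E).
  by rewrite -E1; apply: eq_integral => x _; rewrite -[LHS]/((\int[m2]_y F x y)%:E) EFin_Rintegral.
by rewrite -E2; apply: eq_integral => x _; rewrite -[RHS]/((\int[m1]_y F y x)%:E) EFin_Rintegral.
Qed.

End real_fubini.

Section complex_integral.
Context d (T : measurableType d) (R : realType) (mu : {measure set T -> \bar R}).
Implicit Types f g : T -> cplx R.

Definition cintegrable f := rintegrable mu (fun t => complex.Re (f t)) /\
   rintegrable mu (fun t => complex.Im (f t)).

Definition cint f : cplx R :=
  Complex (\int[mu]_t complex.Re (f t)) (\int[mu]_t complex.Im (f t)).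

Lemma cintegrable_cmeasurable f : cintegrable f -> cmeasurable f.
Proof. by move=> [f1 f2]; split; [move: f1|move: f2]; exact: rintegrable_measurable. Qed.

Lemma cintegrable_le f (g : T -> R) : cmeasurable f -> (forall t, cmod (f t) <= g t) ->
  rintegrable mu g -> cintegrable f.
Proof.
move=> [m1 m2] fg gi; split; apply: (rintegrable_le _ _ gi) => // t.
  exact: le_trans (ler_cmod_Re _) (fg t).
exact: le_trans (ler_cmod_Im _) (fg t).
Qed.

Lemma rintegrable_cmod f : cintegrable f -> rintegrable mu (fun t => cmod (f t)).
Proof.
move=> fi; have [f1 f2] := fi.
apply: (rintegrable_le _ _ (rintegrableD (rintegrable_norm f1) (rintegrable_norm f2))) => [|t].
  exact/measurable_cmod/cintegrable_cmeasurable.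
by rewrite ger0_norm ?cmod_ge0// ler_cmod_ReIm.
Qed.

Lemma cintegrableZ c f : cintegrable f -> cintegrable (fun t => c * f t).
Proof.
move=> fi; apply: (@cintegrable_le _ (fun t => cmod c * cmod (f t))).
- by apply: cmeasurableM; [exact: cmeasurable_cst|exact: cintegrable_cmeasurable].
- by move=> t; rewrite cmodM.
- exact/rintegrableZ/rintegrable_cmod.
Qed.

Lemma cintZ c f : cintegrable f -> cint (fun t => c * f t) = c * cint f.
Proof.
move=> [f1 f2]; apply: cplx_ext; rewrite reimE/= /cint/=.
  under eq_Rintegral do rewrite ReM.
  by rewrite (RintegralB measurableT (rintegrableZ _ f1) (rintegrableZ _ f2)) !RintegralZl.
under eq_Rintegral do rewrite ImM.
by rewrite (RintegralD measurableT (rintegrableZ _ f2) (rintegrableZ _ f1)) !RintegralZl.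
Qed.

Lemma cintD f g : cintegrable f -> cintegrable g ->
  cint (fun t => f t + g t) = cint f + cint g.
Proof.
move=> [f1 f2] [g1 g2]; apply: cplx_ext; rewrite reimE/= /cint/=.
  by under eq_Rintegral do rewrite ReD; rewrite RintegralD.
by under eq_Rintegral do rewrite ImD; rewrite RintegralD.
Qed.

Lemma cintJ f : cintegrable f -> cint (fun t => (f t)^*) = (cint f)^*.
Proof.
move=> [f1 f2]; apply: cplx_ext; rewrite reimE/= /cint/=.
  by under eq_Rintegral do rewrite ReJ.
under eq_Rintegral do rewrite ImJ -mulN1r.
by rewrite RintegralZl// mulN1r.
Qed.

Lemma cintegrableJ f : cintegrable f -> cintegrable (fun t => (f t)^*).
Proof.
move=> fi; apply: (@cintegrable_le _ (fun t => cmod (f t))).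
- exact/cmeasurableJ/cintegrable_cmeasurable.
- by move=> t; rewrite cmodJ.
- exact: rintegrable_cmod.
Qed.

Lemma eq_cint f g : f =1 g -> cint f = cint g.
Proof. by move=> /funext ->. Qed.

End complex_integral.

Section complex_fubini.
Context d1 d2 (T1 : measurableType d1) (T2 : measurableType d2) (R : realType).
Variables (m1 : {sigma_finite_measure set T1 -> \bar R}).
Variables (m2 : {sigma_finite_measure set T2 -> \bar R}).

Lemma cint_swap (F : T1 -> T2 -> cplx R) (B : T1 -> R) :
  cmeasurable (fun p : T1 * T2 => F p.1 p.2) ->
  (forall x, cintegrable m2 (F x)) -> (forall y, cintegrable m1 (F ^~ y)) ->
  rintegrable m1 B -> (forall x, \int[m2]_y cmod (F x y) <= B x) ->
  cint m1 (fun x => cint m2 (F x)) = cint m2 (fun y => cint m1 (F ^~ y)).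
Proof.
move=> [mR mI] i2 i1 iB FB; apply: cplx_ext => /=.
  apply: (Rintegral_swap (B := B)) => //; [by move=> x; case: (i2 x)|by move=> x; case: (i1 x)|].
  move=> x; apply: le_trans (FB x); apply: le_Rintegral => //.
  - by apply: rintegrable_norm; case: (i2 x).
  - exact: rintegrable_cmod.
  - by move=> y _; exact: ler_cmod_Re.
apply: (Rintegral_swap (B := B)) => //; [by move=> x; case: (i2 x)|by move=> x; case: (i1 x)|].
move=> x; apply: le_trans (FB x); apply: le_Rintegral => //.
- by apply: rintegrable_norm; case: (i2 x).
- exact: rintegrable_cmod.
- by move=> y _; exact: ler_cmod_Im.
Qed.

End complex_fubini.

(** * Gaussian integrals *)

Section power_integral.
Local Open Scope ereal_scope.
Context d (T : measurableType d) (R : realType) (m : {sigma_finite_measure set T -> \bar R}).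

Lemma ge0_integral_prod_separate d1 d2 (T1 : measurableType d1) (T2 : measurableType d2)
    (m1 : {sigma_finite_measure set T1 -> \bar R}) (m2 : {sigma_finite_measure set T2 -> \bar R})
    (f : T1 -> R) (g : T2 -> R) (a b : R) :
  measurable_fun setT f -> measurable_fun setT g ->
  (forall x, 0 <= f x)%R -> (forall x, 0 <= g x)%R -> (0 <= b)%R ->
  \int[m1]_x (f x)%:E = a%:E -> \int[m2]_x (g x)%:E = b%:E ->
  \int[m1 \x m2]_p (f p.1 * g p.2)%:E = (a * b)%:E.
Proof.
move=> mf mg f0 g0 b0 ia ib.
have mfg : measurable_fun setT (fun p : T1 * T2 => (f p.1 * g p.2)%:E).
  by apply/measurable_EFinP; apply: measurable_funM; apply: measurableT_comp.
rewrite (fubini_tonelli1 _ mfg); last by move=> p; rewrite lee_fin mulr_ge0.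
have -> : fubini_F m2 (fun p : T1 * T2 => (f p.1 * g p.2)%:E) = fun x => (b%:E * (f x)%:E).
  apply/funext => x; rewrite /fubini_F/=.
  under eq_integral do rewrite EFinM.
  rewrite ge0_integralZl_EFin//; first by rewrite ib muleC.
    by move=> y _; rewrite lee_fin.
  exact/measurable_EFinP.
rewrite ge0_integralZl_EFin//; first by rewrite ia -EFinM mulrC.
  by move=> y _; rewrite lee_fin.
exact/measurable_EFinP.
Qed.

Lemma ge0_integral_power (f : T -> R) (a : R) n : measurable_fun setT f ->
  (forall x, 0 <= f x)%R -> (0 <= a)%R -> \int[m]_x (f x)%:E = a%:E ->
  \int[power_measure m n]_t (\prod_(i < n) f (tnth t i))%R%:E = (a ^+ n)%:E.
Proof.
move=> mf f0 a0 ia; elim: n => [|n IH].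
  under eq_integral do rewrite big_ord0.
  by rewrite integral_dirac// diracT mul1e expr0.
have mp k : measurable_fun setT (fun t : k.-tuple T => \prod_(i < k) f (tnth t i))%R.
  apply: measurable_prod => i _; exact: measurableT_comp (measurable_tnth i).
have tcm := @measurable_tuple_cons _ T n.
have := @ge0_integral_pushforward _ _ _ _ R _ tcm (m \x power_measure m n) setT
  (fun t : n.+1.-tuple T => (\prod_(i < n.+1) f (tnth t i))%R%:E) measurableT.
rewrite preimage_setT => /(_ _ _)/= ->; first last.
- by move=> t _; rewrite lee_fin; apply: prodr_ge0.
- by apply/measurable_EFinP; exact: mp.
rewrite exprS -(@ge0_integral_prod_separate _ _ _ _ m (power_measure m n) f
  (fun t => \prod_(i < n) f (tnth t i))%R _ _ mf (mp n) f0 _ _ ia IH) ?exprn_ge0//.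
  apply: eq_integral => -[x t] _ /=; congr (_%:E).
  rewrite big_ord_recl; congr (f _ * _)%R; apply: eq_bigr => i _; congr f.
  by rewrite tnthS; congr tnth; exact: val_inj.
by move=> t; apply: prodr_ge0.
Qed.

End power_integral.

Section gaussian.
Variable R : realType.
Local Notation RR := (measurableTypeR R).

(** The integrand is a normal density up to its peak value. *)
Lemma integral_gaussian (a : R) : 0 < a ->
  (\int[@lebesgue_measure R]_x (expR (- a * x ^+ 2))%:E = (Num.sqrt (pi / a))%:E)%E.
Proof.
move=> a0; pose s : R := Num.sqrt (2 * a)^-1.
have s2 : s ^+ 2 = (2 * a)^-1 by rewrite sqr_sqrtr// invr_ge0 mulr_ge0// ltW.
have s0 : s != 0 by rewrite gt_eqF// sqrtr_gt0 invr_gt0 mulr_gt0.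
have p0 := normal_peak_gt0 s0.
transitivity (\int[@lebesgue_measure R]_x ((normal_peak s)^-1%:E * (normal_pdf 0 s x)%:E))%E.
  apply: eq_integral => x _; rewrite -EFinM normal_pdfE//= (mulKf (lt0r_neq0 p0)).
  congr (expR _)%:E; rewrite subr0 s2; field; exact: lt0r_neq0.
rewrite ge0_integralZl_EFin//; first last.
- by rewrite invr_ge0 ltW.
- by apply/measurable_EFinP; exact: measurable_normal_pdf.
- by move=> x _; rewrite lee_fin normal_pdf_ge0.
rewrite integral_normal_pdf mule1 /normal_peak invrK s2; congr (Num.sqrt _)%:E.
by field; exact: lt0r_neq0.
Qed.

Definition plane_gauss (a : R) (p : RR * RR) : R := expR (- a * p.1 ^+ 2) * expR (- a * p.2 ^+ 2).

Lemma measurable_gaussian (a : R) : measurable_fun setT (fun x : RR => expR (- a * x ^+ 2)).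
Proof.
by apply: measurableT_comp => //; apply: measurable_funM => //; exact: measurable_funX.
Qed.

Lemma integral_plane_gauss (a : R) : 0 < a ->
  (\int[@plane_measure R]_p (plane_gauss a p)%:E = (pi / a)%:E)%E.
Proof.
move=> a0.
have := @ge0_integral_prod_separate R _ _ _ _ (@lebesgue_measure R) (@lebesgue_measure R)
 _ _ _ _ (measurable_gaussian a) (measurable_gaussian a) (fun=> expR_ge0 _) (fun=> expR_ge0 _)
 (sqrtr_ge0 _) (integral_gaussian a0) (integral_gaussian a0).
by rewrite -expr2 sqr_sqrtr// divr_ge0 ?pi_ge0 ?(ltW a0).
Qed.

Variable n : nat.
Implicit Types z w : Cn R n.

Definition nsq z : R := \sum_(j < n) cmod (z ord0 j) ^+ 2.

Lemma nsq_ge0 z : 0 <= nsq z.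
Proof. by apply: sumr_ge0 => j _; exact: sqr_ge0. Qed.

Lemma Cn_dot_self z : Cn_dot z z = of_real (nsq z).
Proof.
rewrite /Cn_dot /nsq of_real_sum; apply: eq_bigr => j _.
by rewrite sqr_cmod; apply: cplx_ext; rewrite !reimE/=; ring.
Qed.

Lemma sqr_Cn_norm z : Cn_norm z ^+ 2 = nsq z.
Proof. by rewrite /Cn_norm Cn_dot_self/= sqr_sqrtr// nsq_ge0. Qed.

Lemma gaussE z : gauss z = expR (- (1 / 2) * nsq z).
Proof. by rewrite /gauss sqr_Cn_norm; congr expR; field. Qed.

Lemma gauss_prod (a : R) (t : n.-tuple (RR * RR)) :
  expR (- a * nsq (tuple_to_Cn t)) = \prod_(i < n) plane_gauss a (tnth t i).
Proof.
rewrite /nsq mulr_sumr expR_sum; apply: eq_bigr => i _.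
by rewrite sqr_cmod !mxE/= mulrDr expRD.
Qed.

Lemma integral_Cn_gaussian (a : R) : 0 < a ->
  (\int[Cn_volume R n]_t (expR (- a * nsq (tuple_to_Cn t)))%:E = ((pi / a) ^+ n)%:E)%E.
Proof.
move=> a0; under eq_integral do rewrite gauss_prod.
apply: (@ge0_integral_power _ _ _ (@plane_measure R) (plane_gauss a)).
- by apply: measurable_funM; apply: (measurableT_comp (measurable_gaussian a)).
- by move=> p; rewrite mulr_ge0 ?expR_ge0.
- by rewrite divr_ge0 ?pi_ge0 ?(ltW a0).
- exact: integral_plane_gauss.
Qed.

Lemma measurable_nsq : measurable_fun setT (fun t : n.-tuple (RR * RR) => nsq (tuple_to_Cn t)).
Proof.
apply: measurable_sum => i.
by apply/measurable_funX/measurable_cmod/cmeasurable_tuple_to_Cn.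
Qed.

Lemma rintegrable_gaussian (a : R) : 0 < a ->
  rintegrable (Cn_volume R n) (fun t => expR (- a * nsq (tuple_to_Cn t))).
Proof.
move=> a0; apply: ge0_rintegrable.
- apply: measurableT_comp => //; apply: measurable_funM => //; exact: measurable_nsq.
- by move=> t; exact: expR_ge0.
- by rewrite integral_Cn_gaussian// ltry.
Qed.

Lemma fock_const_gt0 : 0 < fock_const R n.
Proof. by rewrite exprn_gt0// invr_gt0 mulr_gt0// pi_gt0. Qed.

Lemma fock_const_gauss : fock_const R n * \int[Cn_volume R n]_t gauss (tuple_to_Cn t) = 1.
Proof.
under eq_Rintegral do rewrite gaussE.
rewrite /Rintegral integral_Cn_gaussian//= div1r invrK /fock_const -exprMn.
by rewrite [pi * 2]mulrC mulVf ?expr1n// mulf_neq0// gt_eqF// pi_gt0.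
Qed.

End gaussian.

(** * The Gaussian mean value property *)

Section holomorphic_functions.
Variables (R : realType) (n : nat).
Implicit Types (f g : Cn R n -> cplx R) (z w : Cn R n) (c : cplx R).

Lemma holomorphicM f g : holomorphic f -> holomorphic g -> holomorphic (fun z => f z * g z).
Proof. by move=> hf hg z; exact: (@differentiableM _ _ f g). Qed.

Lemma holomorphicD f g : holomorphic f -> holomorphic g -> holomorphic (fun z => f z + g z).
Proof. by move=> hf hg z; exact: (@differentiableD _ _ _ f g). Qed.

Lemma holomorphic_cst c : holomorphic (fun _ : Cn R n => c).
Proof. by move=> z; exact: differentiable_cst. Qed.

Lemma holomorphic_cexp f : holomorphic f -> holomorphic (fun z => cexp (f z)).
Proof.
move=> hf z; apply: (@differentiable_comp _ _ _ _ f (@cexp R)) => //.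
exact: differentiable_cexp.
Qed.

Lemma holomorphic_sum I (r : seq I) (F : I -> Cn R n -> cplx R) :
  (forall i, holomorphic (F i)) -> holomorphic (fun z => \sum_(i <- r) F i z).
Proof.
move=> hF; elim: r => [|i r IH].
  by under eq_fun do rewrite big_nil; exact: holomorphic_cst.
by under eq_fun do rewrite big_cons; exact: holomorphicD.
Qed.

Lemma holomorphic_coord (j : 'I_n) : holomorphic (fun z : Cn R n => z ord0 j).
Proof. by move=> z; exact: differentiable_coord. Qed.

Lemma holomorphic_dot w : holomorphic (fun z => Cn_dot z w).
Proof.
apply: holomorphic_sum => j.
by apply: holomorphicM; [exact: holomorphic_coord|exact: holomorphic_cst].
Qed.

Lemma holomorphic_affine (A : 'M[cplx R]_n) (b : Cn R n) :
  holomorphic (fun z : Cn R n => z *m A + b : Cn R n).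
Proof.
move=> z; apply: (@differentiableD _ _ _ (fun z : Cn R n => z *m A : Cn R n) (cst b)) => //.
have -> : (fun z : Cn R n => z *m A : Cn R n) = \sum_(i < n) (fun z : Cn R n => z ord0 i *: row i A : Cn R n).
  apply/funext => u; rewrite mulmx_sum_row.
  by elim/big_ind2: _ => // [x x' y y' -> ->].
apply: differentiable_sum => i; apply: differentiableZl; exact: differentiable_coord.
Qed.

Lemma holomorphic_comp f (h : Cn R n -> Cn R n) : holomorphic f -> holomorphic h ->
  holomorphic (fun z => f (h z)).
Proof. by move=> hf hh z; exact: (@differentiable_comp _ _ _ _ h f). Qed.

Lemma holomorphic_translate f w : holomorphic f -> holomorphic (fun z => f (z + w)).
Proof.
move=> hf; have := holomorphic_comp hf (holomorphic_affine 1%:M w).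
by under eq_fun do rewrite mulmx1.
Qed.

Lemma holomorphic_slice (W : normedModType (cplx R)) (f : Cn R n -> W) z :
  holomorphic f -> forall l : cplx R, differentiable (fun l : cplx R => f (l *: z)) l.
Proof.
move=> hf l; apply: (@differentiable_comp _ _ _ _ (fun l : cplx R => l *: z) f).
  by apply: (@differentiableZl _ _ _ (fun l : cplx R => l)).
exact: hf.
Qed.

Lemma holomorphic_continuous f : holomorphic f -> continuous f.
Proof. by move=> hf z; exact/differentiable_continuous. Qed.

Lemma holomorphic_cmeasurable f : holomorphic f ->
  cmeasurable (fun t : n.-tuple (measurableTypeR R * measurableTypeR R) => f (tuple_to_Cn t)).
Proof.
move=> hf; apply: cmeasurable_continuous_Cn; first exact: holomorphic_continuous.
by move=> i; exact: cmeasurable_tuple_to_Cn.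
Qed.

End holomorphic_functions.

Section gaussian_mean.
Variables (R : realType) (n : nat).
Local Notation RR := (measurableTypeR R).
Local Notation vol := (Cn_volume R n).
Local Notation ev := (@tuple_to_Cn R n).
Implicit Types (f g G : Cn R n -> cplx R) (z w : Cn R n) (c : cplx R).

Lemma nsqZ c z : nsq (c *: z) = cmod c ^+ 2 * nsq z.
Proof.
by rewrite /nsq mulr_sumr; apply: eq_bigr => j _; rewrite mxE cmodM exprMn.
Qed.

Lemma gaussZ c z : cmod c = 1 -> gauss (c *: z) = gauss z.
Proof. by move=> c1; rewrite !gaussE nsqZ c1 expr1n [1 * nsq z]mul1r. Qed.

Lemma gauss_ge0 z : 0 <= gauss z. Proof. exact: expR_ge0. Qed.

Lemma rintegrable_gauss : rintegrable vol (fun t => gauss (ev t)).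
Proof.
have -> : (fun t => gauss (ev t)) = (fun t => expR (- (1/2) * nsq (ev t))).
  by apply/funext => t; rewrite gaussE.
by apply: rintegrable_gaussian; rewrite divr_gt0.
Qed.

Lemma measurable_gauss : measurable_fun setT (fun t => gauss (ev t)).
Proof. exact: rintegrable_measurable rintegrable_gauss. Qed.

Let D : set R := `[0, 2 * pi]%classic.

Let itg_indic (h : R -> R) : itg 0 (2 * pi) h = \int[@lebesgue_measure R]_x (\1_D x * h x).
Proof.
rewrite /itg Rintegral_mkcond; apply: eq_Rintegral => x _.
by rewrite patchE indicE; case: ifP; rewrite ?mul1r ?mul0r.
Qed.

Let integrable_indic (h : R -> R) : continuous h ->
  rintegrable (@lebesgue_measure R) (fun x => \1_D x * h x).
Proof.
move=> ch; have := @continuous_itg_integrable R h 0 (2 * pi) ch.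
rewrite integrable_mkcond// => hi; rewrite /rintegrable.
rewrite (_ : EFin \o _ = (EFin \o h) \_ `[0, 2 * pi]%classic)//.
by apply/funext => x; rewrite patchE /= indicE; case: ifP; rewrite ?mul1r ?mul0r.
Qed.

(** The function [t |-> G (u x *: ev t)] has the same Gaussian integral for all
    [x]; exchanging the integrals, the mean over [x] is computed for each [t]. *)
Let Re_gaussian_mean G : holomorphic G ->
  rintegrable vol (fun t => complex.Re (G (ev t)) * gauss (ev t)) ->
  fock_const R n * \int[vol]_t (complex.Re (G (ev t)) * gauss (ev t)) = complex.Re (G 0).
Proof.
move=> hG iG.
pose RG t := complex.Re (G (ev t)) * gauss (ev t).
pose u (x : R) : cplx R := cexp (Complex 0 x).
have u1 x : cmod (u x) = 1 by rewrite cmod_cexp expR0.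
pose H (x : R) (t : n.-tuple (RR * RR)) := \1_D x * (complex.Re (G (u x *: ev t)) * gauss (ev t)).
have rot x : exists2 g, measure_preserving vol g &
    forall t, complex.Re (G (u x *: ev t)) * gauss (ev t) = RG (g t).
  have [g pg gE] := @Cn_rotation_preserving R n _ (u1 x); exists g; first exact: pg.
  by move=> t; rewrite /RG gE gaussZ.
have ix x : rintegrable vol (fun t => complex.Re (G (u x *: ev t)) * gauss (ev t)).
  have [g pg gE] := rot x; under eq_fun do rewrite gE.
  exact: (rintegrable_preserving pg iG).
have Ex x : \int[vol]_t (complex.Re (G (u x *: ev t)) * gauss (ev t)) = \int[vol]_t RG t.
  have [g pg gE] := rot x; under eq_Rintegral do rewrite gE.
  exact: (Rintegral_preserving pg iG).
have Nx x : \int[vol]_t `|complex.Re (G (u x *: ev t)) * gauss (ev t)| = \int[vol]_t `|RG t|.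
  have [g pg gE] := rot x; under eq_Rintegral do rewrite gE.
  exact: (Rintegral_preserving pg (rintegrable_norm iG)).
have cu : continuous u.
  move=> x; apply: (@continuous_comp _ _ _ (fun x : R => Complex 0 x : cplx R) (@cexp R)).
    exact: continuous_vline.
  exact/differentiable_continuous/differentiable_cexp.
have cslice t : continuous (fun x : R => complex.Re (G (u x *: ev t))).
  apply: (@continuous_Re_along R (fun l => G (l *: ev t))) => // l.
  exact/differentiable_continuous/holomorphic_slice.
have mvG t : \int[@lebesgue_measure R]_x (\1_D x * complex.Re (G (u x *: ev t))) = 2 * pi * complex.Re (G 0).
  rewrite -itg_indic (@mean_value R (fun l => G (l *: ev t))) ?scale0r//.
  exact: holomorphic_slice.
have mH : measurable_fun setT (fun p : RR * n.-tuple (RR * RR) => H p.1 p.2).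
  apply: measurable_funM.
    have mD : measurable_fun setT (\1_D : RR -> R).
      by apply: measurable_indic; exact: measurable_itv.
    exact: (measurableT_comp mD measurable_fst).
  apply: measurable_funM; last exact: (measurableT_comp measurable_gauss measurable_snd).
  apply: (measurable_continuous_Cn (F := fun z => complex.Re (G z)) (p := fun p : RR * n.-tuple (RR * RR) => u p.1 *: ev p.2)).
    move=> z; apply: (@continuous_comp _ _ _ G (@complex.Re R)); last exact: continuous_Re.
    exact: holomorphic_continuous.
  move=> i; under eq_fun do rewrite mxE.
  apply: cmeasurableM.
    by apply: cmeasurable_cexp; split => /=; [exact: measurable_cst|exact: measurable_fst].
  have [m1 m2] := @cmeasurable_tuple_to_Cn R n i.
  by split; [exact: (measurableT_comp m1 measurable_snd)|exact: (measurableT_comp m2 measurable_snd)].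
have p0 : 0 < 2 * pi :> R by rewrite mulr_gt0// pi_gt0.
have i1 : rintegrable (@lebesgue_measure R) (\1_D : R -> R).
  have -> : (\1_D : R -> R) = (fun x => \1_D x * 1) by apply/funext => x; rewrite mulr1.
  by apply: (@integrable_indic (fun=> 1)) => x; exact: cvg_cst.
have E1 : \int[@lebesgue_measure R]_x \1_D x = 2 * pi.
  have := itg_indic (fun=> 1); rewrite itg_cst ?ltW// mul1r subr0 => ->.
  by apply: eq_Rintegral => x _; rewrite mulr1.
have := @Rintegral_swap _ _ _ _ _ (@lebesgue_measure R) vol H
  (fun x => (\int[vol]_t `|RG t|) * \1_D x) mH.
move=> /(_ _ _ _ _) => S.
have {S} : \int[@lebesgue_measure R]_x \int[vol]_t H x t = \int[vol]_t \int[@lebesgue_measure R]_x H x t.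
  apply: S.
  - by move=> x; apply: rintegrableZ.
  - move=> t; have -> : H ^~ t = fun x => gauss (ev t) * (\1_D x * complex.Re (G (u x *: ev t))).
      by apply/funext => x; rewrite /H; ring.
    by apply: rintegrableZ; exact: integrable_indic.
  - exact: rintegrableZ.
  - move=> x.
    have -> : \int[vol]_t `|H x t| =
       \int[vol]_t (\1_D x * `|complex.Re (G (u x *: ev t)) * gauss (ev t)|).
      by apply: eq_Rintegral => t _; rewrite /H [LHS]normrM ger0_norm// indicE.
    rewrite RintegralZl//; last exact: (rintegrable_norm (ix x)).
    by rewrite Nx mulrC.
have -> : (fun x => \int[vol]_t H x t) = (fun x => (\int[vol]_t RG t) * \1_D x).
  by apply/funext => x; rewrite -(Ex x) [RHS]mulrC -RintegralZl//; exact: ix.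
rewrite RintegralZl// E1.
have -> : (fun t => \int[@lebesgue_measure R]_x H x t) =
   (fun t => (2 * pi * complex.Re (G 0)) * gauss (ev t)).
  apply/funext => t; rewrite -(mvG t) [RHS]mulrC -RintegralZl//; last exact: integrable_indic.
  by apply: eq_Rintegral => x _; rewrite /H; ring.
rewrite RintegralZl//; last exact: rintegrable_gauss.
move=> E; have {}E : \int[vol]_t RG t = complex.Re (G 0) * \int[vol]_t gauss (ev t).
  by apply: (mulIf (lt0r_neq0 p0)); rewrite E; ring.
by rewrite -/RG E mulrCA fock_const_gauss mulr1.
Qed.

(** Averaging over the circle action [u |-> exp (i theta) u], which preserves
    the Gaussian measure, reduces the statement to the mean value property of
    the one-variable entire functions [l |-> G (l u)]. *)
Theorem gaussian_mean_value G : holomorphic G ->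
  cintegrable vol (fun t => G (ev t) * of_real (gauss (ev t))) ->
  of_real (fock_const R n) * cint vol (fun t => G (ev t) * of_real (gauss (ev t))) = G 0.
Proof.
move=> hG iG.
have reE t : complex.Re (G (ev t) * of_real (gauss (ev t))) = complex.Re (G (ev t)) * gauss (ev t).
  by rewrite !reimE/=; ring.
have imE t : complex.Im (G (ev t) * of_real (gauss (ev t))) =
    complex.Re (Complex 0 (-1) * G (ev t)) * gauss (ev t).
  by rewrite !reimE/=; ring.
have [i1 i2] := iG.
apply: cplx_ext; rewrite reimE/= ?mul0r ?subr0 ?addr0.
  under eq_Rintegral do rewrite reE.
  by apply: Re_gaussian_mean => //; under eq_fun do rewrite -reE.
under eq_Rintegral do rewrite imE.
rewrite (@Re_gaussian_mean (fun z => Complex 0 (-1) * G z)).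
- by rewrite reimE/=; ring.
- by apply: holomorphicM => //; exact: holomorphic_cst.
- by under eq_fun do rewrite -imE.
Qed.

End gaussian_mean.

(** * The inner products of C^n and of the Fock space *)

Section conjugation.
Variable R : realType.
Implicit Types a b : cplx R.
Lemma conjM a b : (a * b)^* = a^* * b^*.
Proof. by apply: cplx_ext; rewrite !reimE; ring. Qed.
Lemma conjD a b : (a + b)^* = a^* + b^*.
Proof. by apply: cplx_ext; rewrite !reimE; ring. Qed.
Lemma conjN a : (- a)^* = - a^*.
Proof. by apply: cplx_ext; rewrite !reimE; ring. Qed.
Lemma conjK a : (a^*)^* = a.
Proof. by apply: cplx_ext; rewrite !reimE; ring. Qed.
Lemma conj_of_real (x : R) : (of_real x)^* = of_real x :> cplx R.
Proof. by apply: cplx_ext; rewrite !reimE/= ?oppr0. Qed.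
Lemma conj0 : (0 : cplx R)^* = 0.
Proof. exact: conj_of_real. Qed.
Lemma conj1 : (1 : cplx R)^* = 1.
Proof. exact: conj_of_real. Qed.

Lemma of_real_neq0 (x : R) : 0 < x -> (of_real x : cplx R) != 0.
Proof. by move=> x0; apply/eqP => -[] /eqP; rewrite gt_eqF. Qed.

Lemma half_of_real : 2^-1 = of_real 2^-1 :> cplx R.
Proof.
have -> : 2 = of_real 2 :> cplx R by apply: cplx_ext; rewrite //= ?reimE/= ?addr0.
apply: (@mulfI _ (of_real 2)); first exact: of_real_neq0.
by rewrite divff ?of_real_neq0// -of_realM divff.
Qed.

End conjugation.

Section Cn_dot_theory.
Variables (R : realType) (n : nat).
Implicit Types (z w v : Cn R n) (c : cplx R).

Lemma Cn_dotDl z w v : Cn_dot (z + w) v = Cn_dot z v + Cn_dot w v.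
Proof. by rewrite /Cn_dot -big_split; apply: eq_bigr => j _; rewrite mxE mulrDl. Qed.
Lemma Cn_dotZl c z v : Cn_dot (c *: z) v = c * Cn_dot z v.
Proof. by rewrite /Cn_dot mulr_sumr; apply: eq_bigr => j _; rewrite mxE mulrA. Qed.
Lemma Cn_dotC z w : Cn_dot w z = (Cn_dot z w)^*.
Proof.
rewrite /Cn_dot rmorph_sum; apply: eq_bigr => j _.
by apply: cplx_ext; rewrite !reimE; ring.
Qed.
Lemma Cn_dotDr z w v : Cn_dot z (w + v) = Cn_dot z w + Cn_dot z v.
Proof. by rewrite Cn_dotC Cn_dotDl conjD -!Cn_dotC. Qed.
Lemma Cn_dotZr c z v : Cn_dot z (c *: v) = c^* * Cn_dot z v.
Proof. by rewrite Cn_dotC Cn_dotZl conjM -Cn_dotC. Qed.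
Lemma Cn_dot0l z : Cn_dot 0 z = 0.
Proof. by rewrite -(scale0r 0) Cn_dotZl mul0r. Qed.
Lemma Cn_dot0r z : Cn_dot z 0 = 0.
Proof. by rewrite Cn_dotC Cn_dot0l conj0. Qed.

Lemma nsqD z w : nsq (z + w) = nsq z + nsq w + 2 * complex.Re (Cn_dot z w).
Proof.
have E x : nsq x = complex.Re (Cn_dot x x) by rewrite Cn_dot_self.
by rewrite !E Cn_dotDl !Cn_dotDr (Cn_dotC z w) !reimE; ring.
Qed.

Lemma nsqN z : nsq (- z) = nsq z.
Proof. by rewrite -scaleN1r nsqZ cmodN cmod1 expr1n mul1r. Qed.

Lemma nsq0 : nsq (0 : Cn R n) = 0.
Proof. by rewrite -(scale0r 0) nsqZ cmod0 expr0n mul0r. Qed.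

Lemma cmod_coord_le z j : cmod (z ord0 j) ^+ 2 <= nsq z.
Proof. by rewrite /nsq (bigD1 j)//= lerDl; apply: sumr_ge0 => i _; exact: sqr_ge0. Qed.

Lemma nsq_eq0 z : nsq z = 0 -> z = 0.
Proof.
move=> z0; apply/rowP => j; rewrite mxE; apply: cmod_eq0; apply/eqP.
by rewrite -sqrf_eq0 eq_le sqr_ge0 andbT -z0 cmod_coord_le.
Qed.

(** The squared norm of [t z - w] is nonnegative; divide it by [t]. *)
Lemma Re_dot_le (t : R) z w : 0 < t ->
  2 * complex.Re (Cn_dot z w) <= t * nsq z + t^-1 * nsq w.
Proof.
move=> t0; have := nsq_ge0 (of_real t *: z - w).
rewrite nsqD nsqN nsqZ cmod_of_real (gtr0_norm t0) Cn_dotZl -scaleN1r Cn_dotZr.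
have -> : (-1 : cplx R)^* = -1 by apply: cplx_ext; rewrite !reimE/= ?oppr0.
rewrite !reimE/= => h; rewrite -(ler_pM2l t0) mulrDr !mulrA divff ?gt_eqF// mul1r; lra.
Qed.

End Cn_dot_theory.

Section fock_theory.
Variables (R : realType) (n : nat).
Local Notation RR := (measurableTypeR R).
Local Notation vol := (Cn_volume R n).
Local Notation ev := (@tuple_to_Cn R n).
Local Notation ip := (@fock_ip R n).
Local Notation F2 := (@fock_space R n).
Implicit Types (f g h : Cn R n -> cplx R) (z w : Cn R n) (c : cplx R).

Lemma fock_spaceP f : F2 f <->
  holomorphic f /\ rintegrable vol (fun t => cmod (f (ev t)) ^+ 2 * gauss (ev t)).
Proof.
have ge0 t : 0 <= cmod (f (ev t)) ^+ 2 * gauss (ev t) by rewrite mulr_ge0 ?sqr_ge0 ?gauss_ge0.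
have c0 := fock_const_gt0 R n.
split=> -[hf fi]; split=> //.
  apply: ge0_rintegrable => //.
    apply: measurable_funM; last exact: measurable_gauss.
    by apply/measurable_funX/measurable_cmod/holomorphic_cmeasurable.
  move: fi; rewrite /fock_sqnorm -[X in (_ * X < _)%E]/(\int[vol]_t (cmod (f (ev t)) ^+ 2 * gauss (ev t))%:E)%E.
  case: (\int[vol]_t _)%E => [r _| |//]; first by rewrite ltry.
  by rewrite gt0_muley// ?lte_fin.
rewrite /fock_sqnorm -[X in (_ * X < _)%E]/(\int[vol]_t (cmod (f (ev t)) ^+ 2 * gauss (ev t))%:E)%E.
by rewrite -EFin_Rintegral// -EFinM ltry.
Qed.

Definition fnorm2 f : R := fock_const R n * \int[vol]_t (cmod (f (ev t)) ^+ 2 * gauss (ev t)).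

Definition ipd f g (t : n.-tuple (RR * RR)) : cplx R :=
  f (ev t) * (g (ev t))^* * of_real (gauss (ev t)).

Lemma fock_ipE f g : ip f g = of_real (fock_const R n) * cint vol (ipd f g).
Proof. by []. Qed.

Lemma fock_ip_self f : ip f f = of_real (fnorm2 f).
Proof.
rewrite fock_ipE of_realM; congr (_ * _).
have E t : ipd f f t = of_real (cmod (f (ev t)) ^+ 2 * gauss (ev t)).
  by rewrite /ipd sqr_cmod; apply: cplx_ext; rewrite !reimE/=; ring.
rewrite (eq_cint _ E); apply: cplx_ext => //=.
by rewrite /Rintegral integral0.
Qed.

Lemma fock_holomorphic f : F2 f -> holomorphic f.
Proof. by move=> /fock_spaceP[]. Qed.

Lemma fock_rintegrable f : F2 f -> rintegrable vol (fun t => cmod (f (ev t)) ^+ 2 * gauss (ev t)).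
Proof. by move=> /fock_spaceP[]. Qed.

Lemma fnorm2_ge0 f : 0 <= fnorm2 f.
Proof.
apply: mulr_ge0; first exact/ltW/fock_const_gt0.
apply: Rintegral_ge0 => t _.
by rewrite mulr_ge0 ?sqr_ge0 ?gauss_ge0.
Qed.

Lemma hnormE f : hnorm ip f = Num.sqrt (fnorm2 f).
Proof. by rewrite /hnorm fock_ip_self. Qed.

Let mean_square (a b : R) : a * b <= a ^+ 2 + b ^+ 2.
Proof. by have := sqr_ge0 (a - b); have := sqr_ge0 (a + b); rewrite sqrrB sqrrD; lra. Qed.

Lemma cmod_ipd f g t : cmod (ipd f g t) = cmod (f (ev t)) * cmod (g (ev t)) * gauss (ev t).
Proof. by rewrite /ipd !cmodM cmodJ cmod_of_real ger0_norm ?gauss_ge0. Qed.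

Lemma cmeasurable_ipd f g : holomorphic f -> holomorphic g -> cmeasurable (ipd f g).
Proof.
move=> hf hg; apply: cmeasurableM; last by apply: cmeasurable_of_real; exact: measurable_gauss.
apply: cmeasurableM; first exact: holomorphic_cmeasurable.
by apply: cmeasurableJ; exact: holomorphic_cmeasurable.
Qed.

Lemma cintegrable_ipd f g : F2 f -> F2 g -> cintegrable vol (ipd f g).
Proof.
move=> Ff Fg; apply: (cintegrable_le (g := fun t => cmod (f (ev t)) ^+ 2 * gauss (ev t)
    + cmod (g (ev t)) ^+ 2 * gauss (ev t))).
- by apply: cmeasurable_ipd; exact: fock_holomorphic.
- move=> t; rewrite cmod_ipd -mulrDl ler_wpM2r ?gauss_ge0//; exact: mean_square.
- by apply: rintegrableD; exact: fock_rintegrable.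
Qed.

Lemma fock_spaceZ c f : F2 f -> F2 (fun z => c * f z).
Proof.
move=> Ff; apply/fock_spaceP; split.
  by apply: holomorphicM; [exact: holomorphic_cst|exact: fock_holomorphic].
under eq_fun do rewrite cmodM exprMn -mulrA.
by apply: rintegrableZ; exact: fock_rintegrable.
Qed.

Lemma fock_spaceD f g : F2 f -> F2 g -> F2 (fun z => f z + g z).
Proof.
move=> Ff Fg; have hf := fock_holomorphic Ff; have hg := fock_holomorphic Fg.
have hfg := holomorphicD hf hg.
apply/fock_spaceP; split => //.
apply: (rintegrable_le (g := fun t => 2 * (cmod (f (ev t)) ^+ 2 * gauss (ev t)
    + cmod (g (ev t)) ^+ 2 * gauss (ev t)))).
- apply: measurable_funM; last exact: measurable_gauss.
  by apply: measurable_funX; apply: measurable_cmod; apply: (holomorphic_cmeasurable hfg).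
- move=> t; rewrite ger0_norm; last by apply: mulr_ge0; [exact: sqr_ge0|exact: gauss_ge0].
  rewrite -mulrDl mulrA ler_wpM2r ?gauss_ge0//.
  set a := f _; set b := g _.
  apply: (@le_trans _ _ ((cmod a + cmod b) ^+ 2)).
    by apply: lerXn2r; rewrite ?nnegrE ?cmodD// ?addr_ge0 ?cmod_ge0.
  by have := sqr_ge0 (cmod a - cmod b); rewrite sqrrB sqrrD; lra.
- exact: (rintegrableZ 2 (rintegrableD (fock_rintegrable Ff) (fock_rintegrable Fg))).
Qed.

Lemma fnorm2Z c f : F2 f -> fnorm2 (fun z => c * f z) = cmod c ^+ 2 * fnorm2 f.
Proof.
move=> Ff; rewrite /fnorm2 [RHS]mulrCA -[X in _ = _ * X]RintegralZl//; last exact: fock_rintegrable.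
by congr (_ * _); apply: eq_Rintegral => t _; rewrite cmodM; ring.
Qed.

Lemma fock_spaceB f g : F2 f -> F2 g -> F2 (f - g).
Proof.
move=> Ff Fg; have := fock_spaceD Ff (fock_spaceZ (-1) Fg).
have -> : (fun z => f z + -1 * g z) = f - g; last by [].
by apply/funext => z; rewrite mulN1r.
Qed.

Lemma fock_space0 : F2 (fun=> 0).
Proof.
apply/fock_spaceP; split; first exact: holomorphic_cst.
under eq_fun do rewrite cmod0 expr0n mul0r.
exact: rintegrable0.
Qed.

Lemma fock_ipZl c f g : F2 f -> F2 g -> ip (fun z => c * f z) g = c * ip f g.
Proof.
move=> Ff Fg; rewrite !fock_ipE [RHS]mulrCA; congr (_ * _).
rewrite -(cintZ c (cintegrable_ipd Ff Fg)).
by apply: eq_cint => t; rewrite /ipd !mulrA.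
Qed.

Lemma fock_ipDl f g h : F2 f -> F2 g -> F2 h -> ip (fun z => f z + g z) h = ip f h + ip g h.
Proof.
move=> Ff Fg Fh; rewrite !fock_ipE -mulrDr; congr (_ * _).
rewrite -(cintD (cintegrable_ipd Ff Fh) (cintegrable_ipd Fg Fh)).
by apply: eq_cint => t; rewrite /ipd !mulrDl.
Qed.

Lemma fock_ipC f g : F2 f -> F2 g -> ip g f = (ip f g)^*.
Proof.
move=> Ff Fg; rewrite !fock_ipE conjM -(cintJ (cintegrable_ipd Ff Fg)).
congr (_ * _); first by rewrite conj_of_real.
apply: eq_cint => t; rewrite /ipd; apply: cplx_ext; rewrite !reimE/=; ring.
Qed.

Lemma fock_ipZr c f g : F2 f -> F2 g -> ip f (fun z => c * g z) = c^* * ip f g.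
Proof.
move=> Ff Fg; rewrite (fock_ipC (fock_spaceZ c Fg) Ff) (fock_ipZl _ Fg Ff).
by rewrite conjM -(fock_ipC Fg Ff).
Qed.

Lemma fock_ipDr f g h : F2 f -> F2 g -> F2 h -> ip f (fun z => g z + h z) = ip f g + ip f h.
Proof.
move=> Ff Fg Fh; rewrite (fock_ipC (fock_spaceD Fg Fh) Ff) (fock_ipDl Fg Fh Ff).
by rewrite conjD -(fock_ipC Fg Ff) -(fock_ipC Fh Ff).
Qed.

(** The vector [|g| ^ 2 f - <f, g> g] has a nonnegative squared norm. *)
Lemma fock_cauchy_schwarz f g : F2 f -> F2 g -> 0 < fnorm2 g ->
  cmod (ip f g) ^+ 2 <= fnorm2 f * fnorm2 g.
Proof.
move=> Ff Fg g0; set s := ip f g.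
set b := fnorm2 g in g0 *; set a := fnorm2 f.
have F1 := fock_spaceZ (of_real b) Ff; have F2' := fock_spaceZ (- s) Fg.
have := fnorm2_ge0 (fun z => of_real b * f z + - s * g z).
have : fnorm2 (fun z => of_real b * f z + - s * g z) = b * (a * b - cmod s ^+ 2).
  have := fock_ip_self (fun z => of_real b * f z + - s * g z).
  rewrite (fock_ipDl F1 F2' (fock_spaceD F1 F2')) (fock_ipDr F1 F1 F2') (fock_ipDr F2' F1 F2').
  rewrite (fock_ipZl _ Ff F1) (fock_ipZl _ Ff F2') (fock_ipZl _ Fg F1) (fock_ipZl _ Fg F2').
  rewrite (fock_ipZr _ Ff Ff) (fock_ipZr _ Ff Fg) (fock_ipZr _ Fg Ff) (fock_ipZr _ Fg Fg).
  rewrite (fock_ipC Ff Fg) !fock_ip_self -/s -/a -/b => /(congr1 (@complex.Re R)).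
  clearbody s a b; rewrite !reimE/= => <-; rewrite sqr_cmod; ring.
by move=> ->; rewrite pmulr_rge0// subr_ge0.
Qed.

(** ** The reproducing kernel *)

Definition kernel w z : cplx R := cexp (2^-1 * Cn_dot z w).

Lemma holomorphic_kernel w : holomorphic (kernel w).
Proof.
apply: holomorphic_cexp; apply: holomorphicM; [exact: holomorphic_cst|exact: holomorphic_dot].
Qed.

Lemma cmod_kernel w z : cmod (kernel w z) = expR (complex.Re (Cn_dot z w) / 2).
Proof. by rewrite cmod_cexp half_of_real !reimE/= mul0r subr0 mulrC. Qed.

(** Completing the square turns the weighted kernel into a translated Gaussian. *)
Let kernel_gauss w z : cmod (kernel w z) ^+ 2 * gauss z = expR (nsq w / 2) * gauss (z + - w).
Proof.
rewrite cmod_kernel !gaussE nsqD nsqN -expRM_natl -!expRD; congr expR.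
have -> : Cn_dot z (- w) = - Cn_dot z w.
  by rewrite -scaleN1r Cn_dotZr conjN conj1 mulN1r.
by rewrite reimE; field.
Qed.

Lemma kernel_fock w : F2 (kernel w).
Proof.
apply/fock_spaceP; split; first exact: holomorphic_kernel.
have [g pg gE] := @Cn_translation_preserving R n (- w).
under eq_fun do rewrite kernel_gauss -gE.
exact: rintegrableZ (rintegrable_preserving pg (rintegrable_gauss R n)).
Qed.

Lemma fnorm2_kernel w : fnorm2 (kernel w) = expR (nsq w / 2).
Proof.
have [g pg gE] := @Cn_translation_preserving R n (- w).
rewrite /fnorm2; under eq_Rintegral do rewrite kernel_gauss -gE.
rewrite RintegralZl//; last exact: (rintegrable_preserving pg (rintegrable_gauss R n)).
rewrite (Rintegral_preserving pg (rintegrable_gauss R n)).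
by rewrite mulrCA fock_const_gauss mulr1.
Qed.

End fock_theory.

(** * The reproducing property *)

Section reproducing.
Variables (R : realType) (n : nat).
Local Notation RR := (measurableTypeR R).
Local Notation vol := (Cn_volume R n).
Local Notation ev := (@tuple_to_Cn R n).
Local Notation ip := (@fock_ip R n).
Local Notation F2 := (@fock_space R n).
Implicit Types (f g h : Cn R n -> cplx R) (z w u : Cn R n) (c : cplx R).

Lemma of_real_gauss z : of_real (gauss z) = cexp (of_real (- (1 / 2) * nsq z)).
Proof. by rewrite cexp_of_real gaussE. Qed.

Lemma kernel_gauss_translate w u :
  (kernel w (u + w))^* * of_real (gauss (u + w)) =
  cexp (- 2^-1 * Cn_dot u w) * of_real (gauss u).
Proof.
rewrite !of_real_gauss cexpJ -!cexpD; congr cexp.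
rewrite nsqD Cn_dotDl Cn_dot_self half_of_real; apply: cplx_ext; rewrite !reimE/=; by field.
Qed.

Lemma cint_preserving (g : n.-tuple (RR * RR) -> n.-tuple (RR * RR)) (F : n.-tuple (RR * RR) -> cplx R) : measure_preserving vol g ->
  cintegrable vol F -> cint vol (fun t => F (g t)) = cint vol F.
Proof.
move=> pg [F1 F2']; apply: cplx_ext => /=.
  exact: (Rintegral_preserving pg F1).
exact: (Rintegral_preserving pg F2').
Qed.

(** After translation by [w] the integrand is [f (u + w) exp (- <u, w> / 2)]
    times the Gaussian weight: an entire function whose Gaussian mean is its
    value [f w] at the origin. *)
Theorem fock_reproducing f w : F2 f -> ip f (kernel w) = f w.
Proof.
move=> Ff; have iK := cintegrable_ipd Ff (kernel_fock w).
have [g pg gE] := @Cn_translation_preserving R n w.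
pose G u := f (u + w) * cexp (- 2^-1 * Cn_dot u w).
have hG : holomorphic G.
  apply: holomorphicM; first exact/holomorphic_translate/fock_holomorphic.
  apply: holomorphic_cexp; apply: holomorphicM; [exact: holomorphic_cst|exact: holomorphic_dot].
have E t : ipd f (kernel w) (g t) = G (ev t) * of_real (gauss (ev t)).
  by rewrite /ipd gE -mulrA kernel_gauss_translate /G -!mulrA.
have iG : cintegrable vol (fun t => G (ev t) * of_real (gauss (ev t))).
  under eq_fun do rewrite -E.
  by split; [exact: (rintegrable_preserving pg iK.1)|exact: (rintegrable_preserving pg iK.2)].
rewrite fock_ipE -(cint_preserving pg iK) (eq_cint _ E).
by rewrite (gaussian_mean_value hG iG) /G add0r Cn_dot0l mulr0 cexp0 mulr1.
Qed.

(** Cauchy-Schwarz against the kernel, whose squared norm is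
    [exp (|w| ^ 2 / 2)]. *)
Lemma fock_pointwise f w : F2 f -> cmod (f w) ^+ 2 <= fnorm2 f * expR (nsq w / 2).
Proof.
move=> Ff; rewrite -{1}(fock_reproducing w Ff) -fnorm2_kernel.
apply: fock_cauchy_schwarz => //; first exact: kernel_fock.
by rewrite fnorm2_kernel expR_gt0.
Qed.

Lemma fnorm2_eq0 f : F2 f -> fnorm2 f = 0 -> f = fun=> 0.
Proof.
move=> Ff f0; apply/funext => w; apply: cmod_eq0; apply/eqP; rewrite -sqrf_eq0.
by rewrite eq_le sqr_ge0 andbT; have := fock_pointwise w Ff; rewrite f0 mul0r.
Qed.

Lemma fock_pointwise1 f w : F2 f -> cmod (f w) <= Num.sqrt (fnorm2 f) * expR (nsq w / 4).
Proof.
move=> Ff; rewrite -ler_sqr ?nnegrE ?cmod_ge0 ?mulr_ge0 ?sqrtr_ge0 ?expR_ge0//.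
rewrite exprMn sqr_sqrtr ?fnorm2_ge0// -expRM_natl.
have -> : 2%:R * (nsq w / 4) = nsq w / 2 by field.
exact: fock_pointwise.
Qed.

End reproducing.

(** * Weighted composition operators *)

Section weighted_composition.
Variables (R : realType) (n : nat).
Local Notation RR := (measurableTypeR R).
Local Notation vol := (Cn_volume R n).
Local Notation ev := (@tuple_to_Cn R n).
Local Notation ip := (@fock_ip R n).
Local Notation F2 := (@fock_space R n).
Implicit Types (f g h : Cn R n -> cplx R) (z w u v b : Cn R n) (c k : cplx R) (A : 'M[cplx R]_n).

Definition adjmx A : 'M[cplx R]_n := \matrix_(i, j) (A j i)^*.

Lemma Cn_dot_adjmx A z u : Cn_dot (z *m A) u = Cn_dot z (u *m adjmx A).
Proof.
rewrite /Cn_dot; under eq_bigr do rewrite mxE mulr_suml.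
rewrite exchange_big /=; apply: eq_bigr => i _.
have -> : ((u *m adjmx A) ord0 i)^* = \sum_j A i j * (u ord0 j)^*.
  rewrite mxE; have -> : (\sum_j u ord0 j * adjmx A j i)^* = \sum_j (u ord0 j * adjmx A j i)^*.
    by apply: (big_morph Num.conj); [exact: conjD|exact: conj0].
  by apply: eq_bigr => j _; rewrite mxE conjM conjK mulrC.
by rewrite mulr_sumr; apply: eq_bigr => j _; rewrite mulrA.
Qed.

Lemma adjmxK A : adjmx (adjmx A) = A.
Proof. by apply/matrixP => i j; rewrite !mxE conjK. Qed.

Definition contraction A := exists2 q : R, 0 <= q < 1 & forall z, nsq (z *m A) <= q * nsq z.

(** With [x = z A^*], the identity [|x| ^ 2 = Re <x A, z>] and a weighted
    arithmetic-geometric mean with weight [1 / q] bound [|x| ^ 2] by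
    [(|x| ^ 2 + q |z| ^ 2) / 2]. *)
Lemma contraction_adjmx A : contraction A -> contraction (adjmx A).
Proof.
move=> [q /andP[q0 q1] H]; exists q; first by rewrite q0.
move=> z; set x := z *m adjmx A.
have E : nsq x = complex.Re (Cn_dot (x *m A) z).
  by rewrite Cn_dot_adjmx Cn_dot_self.
have [q00|qn0] := eqVneq q 0.
  have xA0 : x *m A = 0.
    by apply: nsq_eq0; apply/eqP; rewrite eq_le nsq_ge0 andbT; have := H x; rewrite q00 mul0r.
  by rewrite E xA0 Cn_dot0l/= mulr_ge0// nsq_ge0.
have qp : 0 < q by rewrite lt_neqAle eq_sym qn0.
have := Re_dot_le (x *m A) z (t := q^-1); rewrite invr_gt0 invrK => /(_ qp).
rewrite -E => h; have h2 : q^-1 * nsq (x *m A) <= nsq x by rewrite ler_pdivrMl.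
lra.
Qed.

(** The Gaussian weight wins over the growth of the weight [kernel v] and of
    the symbol: this is where the strict contraction is used. *)
Lemma contraction_exponent A b v : contraction A -> exists e C : R, 0 < e /\
  forall z, 2 * complex.Re (Cn_dot z v) + nsq (z *m A + b) - nsq z <= C - e * nsq z.
Proof.
move=> [q /andP[q0 q1] H].
pose t := (1 - q) / 4; have t0 : 0 < t by rewrite divr_gt0// subr_gt0.
exists (2 * t), (nsq b + t^-1 * nsq b + t^-1 * nsq v); split; first by rewrite mulr_gt0.
move=> z; rewrite nsqD.
have h1 := Re_dot_le z v t0; have h2 := Re_dot_le (z *m A) b t0.
have h3 := H z; have n0 := nsq_ge0 z.
have h4 : t * nsq (z *m A) <= t * nsq z.
  by rewrite ler_pM2l// (le_trans h3)// ler_piMl// ltW.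
have h5 : q * nsq z = nsq z - 4 * (t * nsq z) by rewrite /t; field.
have h6 : 2 * t * nsq z = 2 * (t * nsq z) by ring.
lra.
Qed.

Definition wco A b v k f : Cn R n -> cplx R := fun z => k * kernel v z * f (z *m A + b).

Lemma holomorphic_wco A b v k f : holomorphic f -> holomorphic (wco A b v k f).
Proof.
move=> hf; apply: holomorphicM; last exact: (holomorphic_comp hf (holomorphic_affine A b)).
by apply: holomorphicM; [exact: holomorphic_cst|exact: holomorphic_kernel].
Qed.

(** The number [X] stands for the squared modulus at [z A + b] of an element of
    the Fock space, or for a sum of such squares over an orthonormal family. *)
Lemma wco_symbol_le A b v k : contraction A -> exists e C : R, 0 < e /\
  forall z (X Y : R), X <= Y * expR (nsq (z *m A + b) / 2) -> 0 <= Y ->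
    cmod (k * kernel v z) ^+ 2 * X * gauss z <=
    Y * (cmod k ^+ 2 * expR (C / 2) * expR (- (e / 2) * nsq z)).
Proof.
move=> cA; have [e [C [e0 H]]] := contraction_exponent b v cA.
exists e, C; split => // z X Y P Y0.
rewrite cmodM cmod_kernel exprMn gaussE.
have -> : cmod k ^+ 2 * expR (complex.Re (Cn_dot z v) / 2) ^+ 2 *
    X * expR (- (1 / 2) * nsq z) =
  cmod k ^+ 2 * expR (complex.Re (Cn_dot z v) - nsq z / 2) * X.
  rewrite -expRM_natl.
  have -> : complex.Re (Cn_dot z v) - nsq z / 2 =
    2%:R * (complex.Re (Cn_dot z v) / 2) + - (1 / 2) * nsq z by field.
  by rewrite expRD; ring.
apply: (le_trans (ler_wpM2l _ P)); first by rewrite mulr_ge0 ?expR_ge0 ?sqr_ge0.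
have -> : cmod k ^+ 2 * expR (C / 2) * expR (- (e / 2) * nsq z) =
   cmod k ^+ 2 * expR (C / 2 + - (e / 2) * nsq z) by rewrite expRD mulrA.
rewrite mulrCA; apply: ler_wpM2l => //.
rewrite -[leLHS]mulrA -expRD; apply: ler_wpM2l; first exact: sqr_ge0.
by rewrite ler_expR; have := H z; lra.
Qed.

Lemma wco_bounded A b v k : contraction A -> exists2 M : R, 0 <= M &
  forall f, F2 f -> F2 (wco A b v k f) /\ fnorm2 (wco A b v k f) <= M * fnorm2 f.
Proof.
move=> cA; have [e [C [e0 HS]]] := wco_symbol_le b v k cA.
have e2 : 0 < e / 2 by rewrite divr_gt0.
have iG := rintegrable_gaussian n e2.
pose W := cmod k ^+ 2 * expR (C / 2).
have W0 : 0 <= W by rewrite mulr_ge0 ?sqr_ge0 ?expR_ge0.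
exists (fock_const R n * \int[vol]_t (W * expR (- (e / 2) * nsq (ev t)))).
  apply: mulr_ge0; first exact/ltW/fock_const_gt0.
  by apply: Rintegral_ge0 => t _; rewrite mulr_ge0 ?expR_ge0.
move=> f Ff.
have iB := rintegrableZ (fnorm2 f) (rintegrableZ W iG).
have H z : cmod (wco A b v k f z) ^+ 2 * gauss z <=
    fnorm2 f * (W * expR (- (e / 2) * nsq z)).
  rewrite /wco cmodM exprMn; apply: HS; last exact: fnorm2_ge0.
  exact: fock_pointwise.
have hT := holomorphic_wco A b v k (fock_holomorphic Ff).
have FT : F2 (wco A b v k f).
  apply/fock_spaceP; split => //.
  apply: (rintegrable_le _ _ iB).
    apply: measurable_funM; last exact: measurable_gauss.
    by apply: measurable_funX; apply: measurable_cmod; apply: (holomorphic_cmeasurable hT).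
  move=> t; rewrite ger0_norm; first exact: H.
  by apply: mulr_ge0; [exact: sqr_ge0|exact: gauss_ge0].
split => //; rewrite [leLHS]/fnorm2 -mulrA ler_wpM2l ?(ltW (fock_const_gt0 _ _))//.
rewrite [leRHS]mulrC -RintegralZl//; last exact: (rintegrableZ W iG).
apply: le_Rintegral => //; exact: fock_rintegrable.
Qed.

Lemma kernelC w z : kernel z w = (kernel w z)^*.
Proof.
rewrite /kernel cexpJ; congr cexp.
by rewrite half_of_real conjM conj_of_real -Cn_dotC.
Qed.

Lemma kernelDl w z u : kernel w (z + u) = kernel w z * kernel w u.
Proof. by rewrite /kernel Cn_dotDl mulrDr cexpD. Qed.

Lemma kernelDr w z u : kernel (z + u) w = kernel z w * kernel u w.
Proof. by rewrite /kernel Cn_dotDr mulrDr cexpD. Qed.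

Lemma kernel_adjmx A z u : kernel u (z *m A) = kernel (u *m adjmx A) z.
Proof. by rewrite /kernel Cn_dot_adjmx. Qed.

Lemma wco_comp A b v k A' b' v' k' f :
  wco A b v k (wco A' b' v' k' f) =
  wco (A *m A') (b *m A' + b') (v + v' *m adjmx A) (k * k' * kernel v' b) f.
Proof.
apply/funext => z; rewrite /wco mulmxDl mulmxA addrA kernelDl kernelDr kernel_adjmx.
ring.
Qed.

Lemma cmeasurable_comp d1 d2 (T1 : measurableType d1) (T2 : measurableType d2)
  (F : T2 -> cplx R) (p : T1 -> T2) : cmeasurable F -> measurable_fun setT p ->
  cmeasurable (fun t => F (p t)).
Proof. by move=> [F1 F2'] mp; split; [exact: (measurableT_comp F1 mp)|exact: (measurableT_comp F2' mp)]. Qed.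

(** The integrand is split by a weighted arithmetic-geometric mean whose weight
    [exp (|x| ^ 2 / 4)] is the norm of the kernel, which gives the growth in [x]
    of the Cauchy-Schwarz bound. *)
Lemma kernel_integral_le f x : F2 f ->
  \int[vol]_t cmod (ipd f (kernel x) t) <=
  expR (nsq x / 4) * (fnorm2 f + 1) / fock_const R n.
Proof.
move=> Ff; have FK := kernel_fock x; set a := expR (nsq x / 4).
have a0 : 0 < a by exact: expR_gt0.
have c0 := fock_const_gt0 R n.
apply: (@le_trans _ _ (\int[vol]_t (a * (cmod (f (ev t)) ^+ 2 * gauss (ev t)) +
    a^-1 * (cmod (kernel x (ev t)) ^+ 2 * gauss (ev t))))).
  apply: le_Rintegral => //.
  - exact/rintegrable_cmod/cintegrable_ipd.
  - by apply: rintegrableD; apply: rintegrableZ; exact: fock_rintegrable.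
  move=> t _; rewrite cmod_ipd.
  have key (p q : R) : 0 <= p -> 0 <= q -> p * q <= a * p ^+ 2 + a^-1 * q ^+ 2.
    move=> p0 q0; have ai : 0 <= a^-1 by rewrite invr_ge0 ltW.
    have := mulr_ge0 ai (sqr_ge0 (a * p - q)); have := mulr_ge0 p0 q0.
    have -> : a^-1 * (a * p - q) ^+ 2 = a * p ^+ 2 - 2 * (p * q) + a^-1 * q ^+ 2.
      by field; rewrite gt_eqF.
    lra.
  rewrite [a * _]mulrA [a^-1 * _]mulrA -mulrDl; apply: ler_wpM2r; first exact: gauss_ge0.
  by apply: key; exact: cmod_ge0.
rewrite RintegralD//; try by apply: rintegrableZ; exact: fock_rintegrable.
rewrite !RintegralZl//; try exact: fock_rintegrable.
have -> : \int[vol]_t (cmod (kernel x (ev t)) ^+ 2 * gauss (ev t)) = a ^+ 2 / fock_const R n.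
  have := fnorm2_kernel x; rewrite /fnorm2 => E; apply: (mulfI (lt0r_neq0 c0)).
  rewrite E /a -expRM_natl mulrCA divff ?gt_eqF// mulr1; congr expR; by field.
have -> : \int[vol]_t (cmod (f (ev t)) ^+ 2 * gauss (ev t)) = fnorm2 f / fock_const R n.
  by rewrite /fnorm2 mulrAC divff ?gt_eqF// mul1r.
rewrite le_eqVlt; apply/orP; left; apply/eqP.
by field; rewrite !gt_eqF.
Qed.

End weighted_composition.

(** * Adjoints of weighted composition operators *)

Section wco_adjoint.
Variables (R : realType) (n : nat).
Local Notation RR := (measurableTypeR R).
Local Notation vol := (Cn_volume R n).
Local Notation ev := (@tuple_to_Cn R n).
Local Notation ip := (@fock_ip R n).
Local Notation F2 := (@fock_space R n).
Implicit Types (f g h : Cn R n -> cplx R) (z w u v b : Cn R n) (c k : cplx R) (A : 'M[cplx R]_n).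

Lemma ipdE f g (t : n.-tuple (RR * RR)) :
  ipd f g t = f (ev t) * (g (ev t))^* * of_real (gauss (ev t)).
Proof. by []. Qed.

(** Writing the values of [f] in the left-hand side, or those of [g] in the
    right-hand side, as inner products with reproducing kernels gives the same
    double integral, taken in the two possible orders. *)
Theorem wco_adjoint A b v k f g : contraction A -> F2 f -> F2 g ->
  ip (wco A b v k f) g = ip f (wco (adjmx A) v b k^* g).
Proof.
move=> cA Ff Fg; pose x z := z *m A + b.
have hx : forall j, cmeasurable (fun t : n.-tuple (RR * RR) => x (ev t) ord0 j).
  move=> j; apply: (@holomorphic_cmeasurable R n (fun z => x z ord0 j)).
  exact: (holomorphic_comp (holomorphic_coord j) (holomorphic_affine A b)).
pose w (t : n.-tuple (RR * RR)) : cplx R :=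
  k * kernel v (ev t) * (g (ev t))^* * of_real (gauss (ev t)).
(* [F] has two factorisations: by definition with [f] against a kernel in [s],
   and by [FE] with [g] against a kernel in [t] *)
pose F (t s : n.-tuple (RR * RR)) : cplx R := w t * ipd f (kernel (x (ev t))) s.
pose d (s : n.-tuple (RR * RR)) : cplx R :=
  f (ev s) * (k^* * kernel b (ev s))^* * of_real (gauss (ev s)).
have FE t s : F t s = d s * (ipd g (kernel (ev s *m adjmx A + v)) t)^*.
  rewrite /F /w /d !ipdE /x !kernelDr -kernel_adjmx.
  rewrite [kernel (ev t *m A) (ev s)]kernelC !conjM !conjK !conj_of_real; ring.
have cst0 : of_real (fock_const R n) != 0 :> cplx R by exact/of_real_neq0/fock_const_gt0.
have inner t : of_real (fock_const R n) * cint vol (F t) =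
    ipd (wco A b v k f) g t.
  rewrite cintZ; last by apply: cintegrable_ipd => //; exact: kernel_fock.
  rewrite mulrCA -fock_ipE fock_reproducing// /w ipdE /wco -/(x _); ring.
have outer s : of_real (fock_const R n) * cint vol (F ^~ s) = ipd f (wco (adjmx A) v b k^* g) s.
  rewrite (eq_cint _ (FE ^~ s)) cintZ; last first.
    by apply: cintegrableJ; apply: cintegrable_ipd => //; exact: kernel_fock.
  rewrite cintJ; last by apply: cintegrable_ipd => //; exact: kernel_fock.
  rewrite mulrCA -{1}(conj_of_real (fock_const R n)) -conjM -fock_ipE fock_reproducing//.
  rewrite /d ipdE /wco !conjM; ring.
have FTf : F2 (wco A b v k f).
  by have [M _ H] := wco_bounded b v k cA; exact: (H _ Ff).1.
have FTg : F2 (wco (adjmx A) v b k^* g).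
  by have [M _ H] := wco_bounded v b k^* (contraction_adjmx cA); exact: (H _ Fg).1.
have mw : cmeasurable w.
  apply: cmeasurableM; last by apply: cmeasurable_of_real; exact: measurable_gauss.
  apply: cmeasurableM.
    apply: cmeasurableM; first exact: cmeasurable_cst.
    exact: (holomorphic_cmeasurable (holomorphic_kernel v)).
  by apply: cmeasurableJ; exact: (holomorphic_cmeasurable (fock_holomorphic Fg)).
have mF : cmeasurable (fun p : n.-tuple (RR * RR) * n.-tuple (RR * RR) => F p.1 p.2).
  apply: cmeasurableM; first exact: (cmeasurable_comp mw measurable_fst).
  apply: cmeasurableM.
    apply: cmeasurableM.
      exact: (cmeasurable_comp (holomorphic_cmeasurable (fock_holomorphic Ff)) measurable_snd).
    apply: cmeasurableJ; apply: cmeasurable_cexp.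
    apply: cmeasurableM; first exact: cmeasurable_cst.
    apply: cmeasurable_sum => j; apply: cmeasurableM.
      exact: (cmeasurable_comp (@cmeasurable_tuple_to_Cn R n j) measurable_snd).
    by apply: cmeasurableJ; exact: (cmeasurable_comp (hx j) measurable_fst).
  apply: cmeasurable_of_real.
  exact: (measurableT_comp (@measurable_gauss R n) measurable_snd).
pose S : R := (fnorm2 f + 1) / fock_const R n.
have S0 : 0 <= S by rewrite divr_ge0 ?addr_ge0 ?fnorm2_ge0// ltW ?fock_const_gt0.
pose B (t : n.-tuple (RR * RR)) := cmod (w t) * (expR (nsq (x (ev t)) / 4) * S).
have mB : measurable_fun setT B.
  apply: measurable_funM; first exact: measurable_cmod.
  apply: measurable_funM => //; apply: measurableT_comp => //; apply: measurable_funM => //.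
  apply: measurable_sum => j; apply: measurable_funX; apply: measurable_cmod; exact: hx.
have [e [C [e0 HC]]] := contraction_exponent b v cA.
have e4 : 0 < e / 4 by rewrite divr_gt0.
have iB : rintegrable vol B.
  apply: (rintegrable_le mB _ (rintegrableZ (cmod k * Num.sqrt (fnorm2 g) * expR (C / 4) * S)
     (rintegrable_gaussian n e4))) => t.
  rewrite ger0_norm; last first.
    by apply: mulr_ge0; [exact: cmod_ge0|apply: mulr_ge0 => //; exact: expR_ge0].
  rewrite /B /w !cmodM cmodJ cmod_of_real (ger0_norm (gauss_ge0 _)) cmod_kernel gaussE.
  have := fock_pointwise1 (ev t) Fg; set G := Num.sqrt _; set z := ev t => gz.
  have G0 : 0 <= G by exact: sqrtr_ge0.
  apply: (@le_trans _ _ (cmod k * expR (complex.Re (Cn_dot z v) / 2) * (G * expR (nsq z / 4)) *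
      expR (- (1 / 2) * nsq z) * (expR (nsq (x z) / 4) * S))).
    apply: ler_wpM2r; first by apply: mulr_ge0 => //; exact: expR_ge0.
    apply: ler_wpM2r; first exact: expR_ge0.
    by apply: ler_wpM2l => //; apply: mulr_ge0; [exact: cmod_ge0|exact: expR_ge0].
  have -> : cmod k * expR (complex.Re (Cn_dot z v) / 2) * (G * expR (nsq z / 4)) *
      expR (- (1 / 2) * nsq z) * (expR (nsq (x z) / 4) * S) =
    cmod k * G * S * expR (complex.Re (Cn_dot z v) / 2 + nsq z / 4 + - (1 / 2) * nsq z + nsq (x z) / 4).
    by rewrite !expRD; ring.
  have -> : cmod k * G * expR (C / 4) * S * expR (- (e / 4) * nsq z) =
    cmod k * G * S * expR (C / 4 + - (e / 4) * nsq z) by rewrite expRD; ring.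
  apply: ler_wpM2l; first by do 2 apply: mulr_ge0 => //; exact: cmod_ge0.
  by rewrite ler_expR; have := HC z; rewrite -/(x z); lra.
have SW : cint vol (fun t => cint vol (F t)) = cint vol (fun s => cint vol (F ^~ s)).
  apply: (cint_swap mF _ _ iB).
  - by move=> t; apply: cintegrableZ; apply: cintegrable_ipd => //; exact: kernel_fock.
  - move=> s; under eq_fun do rewrite FE.
    by apply: cintegrableZ; apply: cintegrableJ; apply: cintegrable_ipd => //; exact: kernel_fock.
  move=> t; rewrite /F; under eq_Rintegral do rewrite cmodM.
  rewrite RintegralZl//; last first.
    by apply: rintegrable_cmod; apply: cintegrable_ipd => //; exact: kernel_fock.
  apply: ler_wpM2l; first exact: cmod_ge0.
  by rewrite mulrA; exact: kernel_integral_le.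
have inner' t : cint vol (F t) = (of_real (fock_const R n))^-1 * ipd (wco A b v k f) g t.
  by rewrite -inner mulKf.
have outer' s : cint vol (F ^~ s) = (of_real (fock_const R n))^-1 * ipd f (wco (adjmx A) v b k^* g) s.
  by rewrite -outer mulKf.
have L := etrans (eq_cint vol inner') (cintZ (of_real (fock_const R n))^-1 (cintegrable_ipd FTf Fg)).
have M := etrans (eq_cint vol outer') (cintZ (of_real (fock_const R n))^-1 (cintegrable_ipd Ff FTg)).
have {L M}E := etrans (esym L) (etrans SW M).
rewrite !fock_ipE; congr (_ * _).
by apply: (mulfI _ E); rewrite invr_eq0.
Qed.

End wco_adjoint.

(** * Spectral calculus for Hermitian matrices *)

Section spectral_calculus.
Variables (R : realType) (n : nat).
Implicit Types (z w u v b : Cn R n) (A U : 'M[cplx R]_n) (r s : 'I_n -> R).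

Lemma adjmx_mul A U : adjmx (A *m U) = adjmx U *m adjmx A.
Proof.
apply/matrixP => i j; rewrite !mxE (big_morph Num.conj (@conjD R) (@conj0 R)).
by apply: eq_bigr => k _; rewrite !mxE conjM mulrC.
Qed.

(** [U^* diag(r) U], a function of a fixed Hermitian matrix when [r] varies. *)
Definition spec U r : 'M[cplx R]_n := adjmx U *m diag_mx (\row_i of_real (r i)) *m U.

Definition unitary U := U *m adjmx U = 1%:M.

Lemma unitaryC U : unitary U -> adjmx U *m U = 1%:M.
Proof. exact: mulmx1C. Qed.

Lemma nsq_unitary U z : unitary U -> nsq (z *m U) = nsq z.
Proof.
move=> uU; apply: (congr1 (@complex.Re R) (x := of_real _) (y := of_real _)).
by rewrite -!Cn_dot_self Cn_dot_adjmx -mulmxA uU mulmx1.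
Qed.

Lemma nsq_adj_unitary U z : unitary U -> nsq (z *m adjmx U) = nsq z.
Proof.
by move=> uU; apply: nsq_unitary; rewrite /unitary adjmxK; exact: unitaryC.
Qed.

Section fixed_basis.
Variables (U : 'M[cplx R]_n) (uU : unitary U).

Lemma spec_mul r s : spec U r *m spec U s = spec U (fun i => r i * s i).
Proof.
rewrite /spec !mulmxA -(mulmxA _ U) uU mulmx1 -(mulmxA (adjmx U)) mulmx_diag.
suff -> : \row_j ((\row_i of_real (r i)) 0 j * (\row_i of_real (s i)) 0 j) =
  \row_i of_real (r i * s i) :> Cn R n by [].
by apply/rowP => i; rewrite !mxE of_realM.
Qed.

Lemma spec1 : spec U (fun=> 1) = 1%:M.
Proof.
rewrite /spec (_ : \row_i _ = const_mx 1); last by apply/rowP => i; rewrite !mxE.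
by rewrite diag_const_mx mulmx1; exact: unitaryC.
Qed.

Lemma specD r s : spec U r + spec U s = spec U (fun i => r i + s i).
Proof.
rewrite /spec -mulmxDl -mulmxDr -linearD; congr (_ *m diag_mx _ *m _).
by apply/rowP => i; rewrite !mxE of_realD.
Qed.

Lemma spec_adj r : adjmx (spec U r) = spec U r.
Proof.
rewrite /spec !adjmx_mul adjmxK mulmxA; congr (_ *m _ *m _).
apply/matrixP => i j; rewrite !mxE eq_sym; case: eqP => [->|_] /=; last by rewrite conj0.
by rewrite !mulr1n conj_of_real.
Qed.

Lemma nsq_spec r z : nsq (z *m spec U r) = \sum_i r i ^+ 2 * cmod ((z *m adjmx U) ord0 i) ^+ 2.
Proof.
rewrite /spec !mulmxA nsq_unitary// /nsq; apply: eq_bigr => i _.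
by rewrite mul_mx_diag !mxE cmodM cmod_of_real exprMn mulrC real_normK ?num_real.
Qed.

Lemma contraction_spec r : (forall i, 0 <= r i < 1) -> contraction (spec U r).
Proof.
move=> r01; pose q := \big[Order.max/0]_i r i.
have qi i : r i <= q by apply: le_bigmax.
have q0 : 0 <= q by apply: bigmax_ge_id.
have q1 : q < 1 by apply: bigmax_lt => // i _; case/andP: (r01 i).
exists q; first by rewrite q0.
move=> z; rewrite nsq_spec -(nsq_adj_unitary z uU) /nsq mulr_sumr.
apply: ler_sum => i _; apply: ler_wpM2r; first exact: sqr_ge0.
case/andP: (r01 i) => ri0 ri1; rewrite expr2; apply: le_trans (qi i).
by rewrite ler_piMl// ltW.
Qed.

End fixed_basis.

Lemma adjmxE A : adjmx A = map_mx Num.conj A^T.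
Proof. by apply/matrixP => i j; rewrite !mxE. Qed.

(** A Hermitian matrix is unitarily diagonalisable, and the eigenvalue of
    [A A^*] on the unit eigenvector [row i U] is [|row i U A| ^ 2]. *)
Lemma spectral_decomposition A : exists2 U, unitary U &
  A *m adjmx A = spec U (fun i => nsq (row i U *m A)).
Proof.
have [H HA] : exists H, H = A *m adjmx A by exists (A *m adjmx A).
have HH : adjmx H = H by rewrite HA adjmx_mul adjmxK.
have nH : H \is normalmx by apply/normalmxP; rewrite -adjmxE HH.
have /orthomx_spectral_subproof[[P D] /= uP' HE] := nH.
have uP : P *m adjmx P = 1%:M by rewrite adjmxE; exact/unitarymxP.
have iP : invmx P = adjmx P by rewrite (invmx_unitary uP') adjmxE.
rewrite iP in HE; exists P; first exact: uP.
suff DE : D = \row_i of_real (nsq (row i P *m A)) by rewrite -HA [LHS]HE DE.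
apply/rowP => i; rewrite mxE.
have rP : row i P *m H = D ord0 i *: row i P.
  rewrite HE -!row_mul !mulmxA uP mul1mx row_mul row_diag_mx -scalemxAl.
  by rewrite -rowE.
have r1 : Cn_dot (row i P) (row i P) = 1.
  move/matrixP: uP => /(_ i i); rewrite !mxE eqxx mulr1n => <-.
  by rewrite /Cn_dot; apply: eq_bigr => j _; rewrite !mxE.
have E : Cn_dot (row i P *m A) (row i P *m A) = Cn_dot (row i P *m H) (row i P).
  by rewrite HA mulmxA [RHS]Cn_dot_adjmx adjmxK.
by rewrite -Cn_dot_self E rP Cn_dotZl r1 mulr1.
Qed.

Lemma nsq_row_unitary U i : unitary U -> nsq (row i U) = 1.
Proof.
move/matrixP => /(_ i i); rewrite !mxE eqxx mulr1n => h.
apply: (congr1 (@complex.Re R) (x := of_real _) (y := of_real _)).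
rewrite -Cn_dot_self of_real1 -h.
by rewrite /Cn_dot; apply: eq_bigr => j _; rewrite !mxE.
Qed.

Lemma nsq_gram z A : nsq (z *m A) = complex.Re (Cn_dot (z *m (A *m adjmx A)) z).
Proof. by rewrite mulmxA [Cn_dot _ z]Cn_dot_adjmx adjmxK Cn_dot_self. Qed.

(** The squares of the singular values are attained on the rows of a unitary
    matrix, so that the hypothesis makes these finitely many numbers less than
    1. *)
Lemma contraction_strict A : (forall z, z != 0 -> nsq (z *m A) < nsq z) -> contraction A.
Proof.
move=> H; have [U uU E] := spectral_decomposition A.
pose d i := nsq (row i U *m A).
have d1 i : d i < 1.
  rewrite -(nsq_row_unitary i uU); apply: H; apply/eqP => r0.
  have := nsq_row_unitary i uU; rewrite r0 nsq0 => /eqP.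
  by rewrite eq_sym oner_eq0.
pose q := \big[Order.max/0]_i d i.
have qi i : d i <= q by apply: le_bigmax.
have q0 : 0 <= q by apply: bigmax_ge_id.
have q1 : q < 1 by apply: bigmax_lt.
exists q; first by rewrite q0.
move=> z; have d0 i : 0 <= d i by exact: nsq_ge0.
have -> : nsq (z *m A) = nsq (z *m spec U (fun i => Num.sqrt (d i))).
  rewrite (nsq_gram z A) E (nsq_gram z (spec U (fun i => Num.sqrt (d i)))) (spec_adj U) (spec_mul uU).
  suff -> : (fun i => Num.sqrt (d i) * Num.sqrt (d i)) = d by [].
  by apply/funext => i; rewrite -expr2 sqr_sqrtr.
rewrite nsq_spec// -(nsq_adj_unitary z uU) /nsq mulr_sumr.
by apply: ler_sum => i _; apply: ler_wpM2r; [exact: sqr_ge0|rewrite sqr_sqrtr].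
Qed.

End spectral_calculus.

(** * Orthonormal families and the Hilbert-Schmidt bound *)

Section finite_combinations.
Variables (R : realType) (n : nat).
Local Notation vol := (Cn_volume R n).
Local Notation ev := (@tuple_to_Cn R n).
Local Notation ip := (@fock_ip R n).
Local Notation F2 := (@fock_space R n).
Implicit Types (f g h : Cn R n -> cplx R) (z w u v b : Cn R n).

Lemma ip0l h : F2 h -> ip (fun=> 0) h = 0.
Proof.
move=> Fh; have E : (fun=> 0) = (fun z : Cn R n => 0 * 0 : cplx R).
  by apply/funext => z; rewrite mul0r.
by rewrite {1}E (fock_ipZl 0 (fock_space0 R n) Fh) mul0r.
Qed.

Variables (I : eqType).
Implicit Types (s : seq I) (e : I -> Cn R n -> cplx R) (c : I -> cplx R).

Definition comb s e c : Cn R n -> cplx R := fun z => \sum_(i <- s) c i * e i z.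

Lemma comb_cons i s e c : comb (i :: s) e c = fun z => c i * e i z + comb s e c z.
Proof. by apply/funext => z; rewrite /comb big_cons. Qed.

Lemma comb_nil e c : comb [::] e c = fun=> 0.
Proof. by apply/funext => z; rewrite /comb big_nil. Qed.

Lemma fock_comb s e c : {in s, forall i, F2 (e i)} -> F2 (comb s e c).
Proof.
elim: s => [|i s IH] Fe; first by rewrite comb_nil; exact: fock_space0.
rewrite comb_cons; apply: fock_spaceD.
  by apply: fock_spaceZ; apply: Fe; rewrite mem_head.
by apply: IH => j js; apply: Fe; rewrite inE js orbT.
Qed.

Lemma fock_ip_combl s e c h : {in s, forall i, F2 (e i)} -> F2 h ->
  ip (comb s e c) h = \sum_(i <- s) c i * ip (e i) h.
Proof.
elim: s => [|i s IH] Fe Fh; first by rewrite comb_nil big_nil ip0l.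
have Fi : F2 (e i) by apply: Fe; rewrite mem_head.
have Fs : {in s, forall i, F2 (e i)} by move=> j js; apply: Fe; rewrite inE js orbT.
rewrite comb_cons big_cons (fock_ipDl (fock_spaceZ (c i) Fi) (fock_comb c Fs) Fh).
by rewrite (fock_ipZl (c i) Fi Fh) (IH Fs Fh).
Qed.

Definition orthonormal s e := {in s, forall i, F2 (e i)} /\
  {in s &, forall i j, ip (e i) (e j) = (i == j)%:R}.

Lemma ip_comb_orthonormal s e c j : uniq s -> orthonormal s e -> j \in s ->
  ip (comb s e c) (e j) = c j.
Proof.
move=> us [Fe oe] js; rewrite fock_ip_combl//; last exact: Fe.
rewrite (bigD1_seq j)//= oe// eqxx mulr1 big1_seq ?addr0// => i /andP[ij is_].
by rewrite oe// (negbTE ij) mulr0.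
Qed.

Lemma fnorm2_comb_orthonormal s e c : uniq s -> orthonormal s e ->
  fnorm2 (comb s e c) = \sum_(i <- s) cmod (c i) ^+ 2.
Proof.
move=> us oe; have [Fe _] := oe; have Fc := fock_comb c Fe.
apply: (congr1 (@complex.Re R) (x := of_real _) (y := of_real _)).
rewrite -fock_ip_self (fock_ip_combl c Fe Fc) of_real_sum.
rewrite big_seq [RHS]big_seq; apply: eq_bigr => i is_.
rewrite (fock_ipC Fc (Fe i is_)) (ip_comb_orthonormal c us oe is_) sqr_cmod.
by apply: cplx_ext; rewrite !reimE/=; ring.
Qed.

(** Bessel's inequality against the reproducing kernel, obtained by evaluating
    at [x] the combination of the family with coefficients [(e i x)^*]. *)
Lemma orthonormal_pointwise s e x : uniq s -> orthonormal s e ->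
  \sum_(i <- s) cmod (e i x) ^+ 2 <= expR (nsq x / 2).
Proof.
move=> us oe; have [Fe _] := oe.
pose c i := (e i x)^*; set S := \sum_(i <- s) _.
have S0 : 0 <= S by apply: sumr_ge0 => i _; exact: sqr_ge0.
have gN : fnorm2 (comb s e c) = S.
  by rewrite fnorm2_comb_orthonormal//; apply: eq_bigr => i _; rewrite cmodJ.
have gx : comb s e c x = of_real S.
  rewrite /comb of_real_sum; apply: eq_bigr => i _; rewrite /c sqr_cmod.
  by apply: cplx_ext; rewrite !reimE/=; ring.
have := fock_pointwise x (fock_comb c Fe); rewrite gN gx cmod_of_real ger0_norm//.
have [->|Sn] := eqVneq S 0; first by rewrite expR_ge0.
by rewrite expr2 ler_pM2l// lt_neqAle eq_sym Sn.
Qed.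

End finite_combinations.

Section hilbert_schmidt.
Variables (R : realType) (n : nat).
Local Notation vol := (Cn_volume R n).
Local Notation ev := (@tuple_to_Cn R n).
Local Notation F2 := (@fock_space R n).

(** The pointwise bound on [\sum_i |e_i| ^ 2], composed with the symbol, is
    integrable with an integral that depends neither on the family nor on its
    size. *)
Lemma wco_hilbert_schmidt (A : 'M[cplx R]_n) b v k : contraction A ->
  exists K : R, forall (I : eqType) (s : seq I) (e : I -> Cn R n -> cplx R),
    uniq s -> orthonormal s e -> \sum_(i <- s) fnorm2 (wco A b v k (e i)) <= K.
Proof.
move=> cA; have [eps [C [e0 H]]] := wco_symbol_le b v k cA.
have e2 : 0 < eps / 2 by rewrite divr_gt0.
have iG := rintegrableZ (cmod k ^+ 2 * expR (C / 2)) (rintegrable_gaussian n e2).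
exists (fock_const R n * \int[vol]_t (cmod k ^+ 2 * expR (C / 2) * expR (- (eps / 2) * nsq (ev t)))).
move=> I s e us oe; have [Fe _] := oe.
have FT i : i \in s -> F2 (wco A b v k (e i)).
  by move=> is_; have [M _ HM] := wco_bounded b v k cA; exact: (HM _ (Fe i is_)).1.
pose G (r : seq I) t := \sum_(i <- r) cmod (wco A b v k (e i) (ev t)) ^+ 2 * gauss (ev t).
have E : \sum_(i <- s) fnorm2 (wco A b v k (e i)) = fock_const R n * \int[vol]_t G s t
    /\ rintegrable vol (G s).
  elim: s {us oe Fe} FT => [|i s IH] FT.
    have -> : G [::] = fun=> 0 by apply/funext => t; rewrite /G big_nil.
    by rewrite big_nil; split; [rewrite /Rintegral integral0 mulr0|exact: rintegrable0].
  have [j js|E iE] := IH; first by apply: FT; rewrite inE js orbT.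
  have Fi := fock_rintegrable (FT i (mem_head _ _)).
  have -> : G (i :: s) = fun t => cmod (wco A b v k (e i) (ev t)) ^+ 2 * gauss (ev t) + G s t.
    by apply/funext => t; rewrite /G big_cons.
  rewrite big_cons E.
  by split; [rewrite RintegralD// mulrDr|exact: rintegrableD].
rewrite E.1; apply: ler_wpM2l; first exact/ltW/fock_const_gt0.
apply: le_Rintegral => //; first exact: E.2.
move=> t _; rewrite /G -mulr_suml.
have := H (ev t) (\sum_(i <- s) cmod (e i (ev t *m A + b)) ^+ 2) 1.
rewrite !mul1r => /(_ (orthonormal_pointwise _ us oe) ler01); apply: le_trans.
rewrite mulr_sumr; apply: ler_wpM2r; first exact: gauss_ge0.
by apply: ler_sum => i _; rewrite /wco cmodM exprMn.
Qed.

End hilbert_schmidt.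

(** * Positive weighted composition operators *)

Section positive_wco.
Variables (R : realType) (n : nat).
Local Notation ip := (@fock_ip R n).
Local Notation F2 := (@fock_space R n).
Local Notation V := (Cn R n -> cplx R).
Implicit Types (f g h : V) (T Q : V -> V).

(** Here [spec U r] is an arbitrary positive Hermitian strict contraction; the
    repetition of [b] makes the operator self-adjoint, and the sign of [k] makes
    it positive. *)
Definition poswco T := exists (U : 'M[cplx R]_n) (r : 'I_n -> R) (b : Cn R n) (k : R),
  [/\ unitary U, forall i, 0 <= r i < 1, 0 < k & T = wco (spec U r) b b (of_real k)].

(** By [wco_comp] the square of [wco B c c k'] is [wco (B B) (c B + c) (c + c B)
    (k' ^ 2 exp (|c| ^ 2 / 2))], so [B] is the square root of the given matrix,
    [c = b (1 + B)^-1], and [k'] absorbs the exponential. *)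
Lemma poswco_root T : poswco T -> exists Q, poswco Q /\ forall f, Q (Q f) = T f.
Proof.
move=> [U [r [b [k [uU r01 k0 ->]]]]].
pose r' i := Num.sqrt (r i).
have r'0 i : 0 <= r' i by exact: sqrtr_ge0.
have r'01 i : 0 <= r' i < 1.
  rewrite r'0 -(ltr_pXn2r (n := 2))// ?nnegrE// expr1n sqr_sqrtr; case/andP: (r01 i) => //.
pose b' := b *m spec U (fun i => (1 + r' i)^-1).
pose k' := Num.sqrt (k * expR (- (nsq b' / 2))).
have k'0 : 0 < k' by rewrite sqrtr_gt0 mulr_gt0// expR_gt0.
exists (wco (spec U r') b' b' (of_real k')); split; first by exists U, r', b', k'.
have sE : spec U (fun i => r' i * r' i) = spec U r.
  suff -> : (fun i => r' i * r' i) = r by [].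
  by apply/funext => i; rewrite -expr2 sqr_sqrtr//; case/andP: (r01 i).
have bE : b' *m spec U r' + b' = b.
  rewrite -{2}(mulmx1 b') -mulmxDr -(spec1 uU) specD /b' -mulmxA spec_mul//.
  suff -> : (fun i => (1 + r' i)^-1 * (r' i + 1)) = (fun=> 1) by rewrite spec1// mulmx1.
  apply/funext => i; have p0 : 0 < 1 + r' i by rewrite ltr_pwDl.
  by rewrite [r' i + 1]addrC mulVf// gt_eqF.
have kE : of_real k' * of_real k' * kernel b' b' = of_real k.
  rewrite /kernel Cn_dot_self half_of_real -!of_realM cexp_of_real -of_realM; congr of_real.
  rewrite -expr2 sqr_sqrtr; last by rewrite mulr_ge0 ?expR_ge0// ltW.
  by rewrite -mulrA -expRD [2^-1 * _]mulrC addNr expR0 mulr1.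
have bE' : b' + b' *m spec U r' = b by rewrite addrC.
by move=> f; rewrite wco_comp (spec_mul uU) (spec_adj U) sE bE bE' kE.
Qed.

Lemma poswco_bounded T : poswco T -> exists2 M : R, 0 <= M &
  forall f, F2 f -> F2 (T f) /\ fnorm2 (T f) <= M * fnorm2 f.
Proof.
move=> [U [r [b [k [uU r01 _ ->]]]]].
by apply: wco_bounded; exact: contraction_spec.
Qed.

Lemma poswco_fock T f : poswco T -> F2 f -> F2 (T f).
Proof. by move=> /poswco_bounded[M _ H] /H[]. Qed.

Lemma poswco_linear T (a : cplx R) f g : poswco T -> T (a *: f + g) = a *: T f + T g.
Proof.
move=> [U [r [b [k [_ _ _ ->]]]]]; apply/funext => z.
rewrite -[RHS]/(a * wco (spec U r) b b (of_real k) f z + wco (spec U r) b b (of_real k) g z).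
rewrite /wco -[(a *: f + g) _]/(a * f _ + g _); ring.
Qed.

Lemma poswco_selfadjoint T f g : poswco T -> F2 f -> F2 g -> ip (T f) g = ip f (T g).
Proof.
move=> [U [r [b [k [uU r01 _ ->]]]]] Ff Fg.
have := wco_adjoint b b (of_real k) (contraction_spec uU r01) Ff Fg.
by rewrite (spec_adj U) conj_of_real.
Qed.

(** For a self-adjoint root [Q] of [T], [<T f, f> = |Q f| ^ 2]. *)
Lemma poswco_ge0 T f : poswco T -> F2 f -> exists2 x : R, 0 <= x & ip (T f) f = of_real x.
Proof.
move=> pT Ff; have [Q [pQ QQ]] := poswco_root pT.
have FQ := poswco_fock pQ Ff.
exists (fnorm2 (Q f)); first exact: fnorm2_ge0.
by rewrite -QQ (poswco_selfadjoint pQ FQ Ff) fock_ip_self.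
Qed.

Lemma poswco_hilbert_schmidt T : poswco T -> exists K : R,
  forall (I : eqType) (s : seq I) (e : I -> V), uniq s -> orthonormal s e ->
    \sum_(i <- s) fnorm2 (T (e i)) <= K.
Proof.
move=> [U [r [b [k [uU r01 _ ->]]]]].
by apply: wco_hilbert_schmidt; exact: contraction_spec.
Qed.

(** On a positive operator [Q] the equation [Q (Q f) = mu ^ 2 f] forces
    [Q f = mu f], because [Q + mu] is injective. *)
Lemma poswco_root_eigen Q f (mu : R) : poswco Q -> F2 f -> 0 < mu ->
  Q (Q f) = of_real (mu ^+ 2) *: f -> Q f = of_real mu *: f.
Proof.
move=> pQ Ff mu0 QQ; have FQ := poswco_fock pQ Ff.
pose h : V := (- of_real mu) *: f + Q f.
have Fh : F2 h := fock_spaceD (fock_spaceZ (- of_real mu) Ff) FQ.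
have Qh : Q h = (- of_real mu) *: h.
  rewrite poswco_linear// QQ /h scalerDr addrC scalerA; congr (_ *: _ + _).
  by rewrite expr2 of_realM mulrNN.
have [x x0 hx] := poswco_ge0 pQ Fh.
have : ip (Q h) h = - of_real mu * ip h h by rewrite Qh; exact: (fock_ipZl _ Fh Fh).
rewrite hx fock_ip_self -of_realN -of_realM => -[xE].
have h0 : fnorm2 h = 0.
  apply/eqP; rewrite eq_le fnorm2_ge0 andbT -(ler_pM2l mu0) mulr0 -oppr_ge0.
  by rewrite -mulNr -xE.
have := fnorm2_eq0 Fh h0; rewrite /h => /eqP E; apply/eqP.
rewrite -subr_eq0 -scaleNr addrC; exact: E.
Qed.

Lemma poswco_roots T j : poswco T -> exists Q, poswco Q /\
  forall f (l : R), F2 f -> 0 < l -> T f = of_real l *: f ->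
    Q f = of_real (l `^ (2 ^- j)) *: f.
Proof.
move=> pT; elim: j => [|j [Q [pQ HQ]]].
  by exists T; split => // f l Ff l0; rewrite expr0 invr1 powRr1// ltW.
have [Q' [pQ' QQ']] := poswco_root pQ; exists Q'; split => // f l Ff l0 Tf.
have -> : l `^ (2 ^- j.+1) = Num.sqrt (l `^ (2 ^- j)).
  by rewrite -powR12_sqrt ?powR_ge0// -powRrM exprSr invfM.
apply: poswco_root_eigen => //; first by rewrite sqrtr_gt0 powR_gt0.
by rewrite QQ' sqr_sqrtr ?powR_ge0//; exact: HQ.
Qed.

End positive_wco.

(** * Orthonormal bases of eigenspaces *)

Section orthonormalization.
Variables (R : realType) (n : nat).
Local Notation ip := (@fock_ip R n).
Local Notation F2 := (@fock_space R n).
Local Notation V := (Cn R n -> cplx R).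

Lemma comb_scale_sum m (f : 'I_m -> V) (c : 'I_m -> cplx R) :
  comb (index_enum 'I_m) f c = \sum_(i < m) c i *: f i.
Proof.
by apply/funext => z; rewrite /comb; elim/big_ind2: _ => // [x x' y y' -> ->].
Qed.

(** There are more coefficients than orthogonality conditions. *)
Lemma nonzero_orthogonal_comb k j (f : 'I_k -> V) (e : 'I_j -> V) : (j < k)%N ->
  (forall i, F2 (f i)) -> (forall i, F2 (e i)) -> linearly_independent f ->
  exists c, let g := comb (index_enum 'I_k) f c in g <> (fun=> 0) /\ forall i, ip g (e i) = 0.
Proof.
move=> jk Ff Fe li.
pose M : 'M[cplx R]_(k, j) := \matrix_(a, b) ip (f a) (e b).
have : kermx M != 0.
  by rewrite -mxrank_eq0 mxrank_ker -lt0n subn_gt0 (leq_ltn_trans (rank_leq_col M)).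
move=> /rowV0Pn[v /sub_kermxP vM v0].
exists (fun i => v ord0 i); split => [g0|b].
  have := li (fun i => v ord0 i); rewrite -comb_scale_sum => /(_ g0) c0.
  by move: v0; apply/negP/negPn/eqP/rowP => i; rewrite c0 mxE.
rewrite fock_ip_combl//.
have := congr1 (fun X : 'rV[cplx R]_j => X ord0 b) vM; rewrite !mxE => E0.
rewrite -[RHS]E0; apply: eq_bigr => i _; by rewrite mxE.
Qed.

(** The family is built one vector at a time: the next one is a normalised
    combination of the [f i] orthogonal to the [j < k] vectors found so far. *)
Lemma orthonormal_family (E : V -> Prop) k (f : 'I_k -> V) :
  (forall x, E x -> F2 x) -> E (fun=> 0) ->
  (forall (a : cplx R) x y, E x -> E y -> E (a *: x + y)) ->
  (forall i, E (f i)) -> linearly_independent f ->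
  exists e : nat -> V, (forall i, (i < k)%N -> E (e i)) /\ orthonormal (iota 0 k) e.
Proof.
move=> EF E0 ED Ef li.
suff: forall j, (j <= k)%N -> exists e : nat -> V,
    (forall i, (i < j)%N -> E (e i)) /\ orthonormal (iota 0 j) e by apply.
elim=> [_|j IH jk].
  by exists (fun=> fun=> 0); split => //; split => [x|x y]; rewrite in_nil.
have [e [Ee [Fe oe]]] := IH (ltnW jk).
have [|||c [g0 gorth]] := @nonzero_orthogonal_comb k j f (fun i => e i) jk => //.
- by move=> i; exact: EF.
- by move=> i; apply: EF; exact: Ee.
set g := comb _ _ _ in g0 gorth.
have Eg : E g.
  rewrite /g comb_scale_sum.
  elim/big_ind: _ => [|x y Ex Ey|i _]; first exact: E0.
    by have := ED 1 x y Ex Ey; rewrite scale1r.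
  by have := ED (c i) (f i) (fun=> 0) (Ef i) E0; rewrite (_ : (fun=> 0) = 0)// addr0.
have Fg := EF _ Eg.
have gN : 0 < fnorm2 g.
  rewrite lt_neqAle fnorm2_ge0 andbT eq_sym; apply/eqP => h.
  by apply: g0; exact: fnorm2_eq0.
pose a : R := (Num.sqrt (fnorm2 g))^-1.
pose u : V := fun z => of_real a * g z.
have Eu : E u.
  by have := ED (of_real a) g (fun=> 0) Eg E0; rewrite (_ : (fun=> 0) = 0)// addr0.
have Fu : F2 u := EF _ Eu.
exists (fun i => if i == j then u else e i).
have lt i : i \in iota 0 j -> (i < j)%N by rewrite mem_iota add0n.
have ug i : (i < j)%N -> ip u (e i) = 0.
  move=> ij; have Fi : F2 (e i) by apply: EF; exact: Ee.
  by rewrite (fock_ipZl _ Fg Fi) (gorth (Ordinal ij)) mulr0.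
have uu : ip u u = 1.
  rewrite (fock_ipZl _ Fg Fu) (fock_ipZr _ Fg Fg) fock_ip_self conj_of_real -!of_realM -of_real1.
  congr of_real; rewrite mulrA -expr2 exprVn sqr_sqrtr ?fnorm2_ge0// mulVf// gt_eqF//.
split.
  by move=> i; rewrite ltnS leq_eqVlt; case: eqP => [//|_ /=]; exact: Ee.
have mem i : i \in iota 0 j.+1 -> i = j \/ i \in iota 0 j.
  rewrite !mem_iota !add0n /= ltnS leq_eqVlt => /orP[/eqP ->|ij]; [by left|by right].
split => [i|i i'].
  by move=> /mem[->|/[dup] /lt ij is_]; rewrite ?eqxx// ltn_eqF//; exact: Fe.
move=> /mem[->|/[dup] /lt ij is_] /mem[->|/[dup] /lt ij' is'].
- by rewrite eqxx uu.
- by rewrite eqxx [i' == j]ltn_eqF// [j == i']gtn_eqF// ug.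
- have Fi : F2 (e i) by exact: Fe.
  by rewrite eqxx ltn_eqF// (fock_ipC Fu Fi) ug// conj0.
- by rewrite [i == j]ltn_eqF// [i' == j]ltn_eqF// oe.
Qed.

End orthonormalization.

Section eigenvalues.
Variables (R : realType) (n : nat).
Local Notation ip := (@fock_ip R n).
Local Notation F2 := (@fock_space R n).
Local Notation V := (Cn R n -> cplx R).
Variable T : V -> V.
Hypothesis pT : poswco T.

Lemma fnorm2_self1 (x : V) : ip x x = 1 -> fnorm2 x = 1.
Proof. by rewrite fock_ip_self => /(congr1 (@complex.Re R)). Qed.

Lemma fnorm2_scale (a : R) (x : V) : F2 x -> fnorm2 (of_real a *: x) = a ^+ 2 * fnorm2 x.
Proof.
move=> Fx; apply: etrans (fnorm2Z (of_real a) Fx) _.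
by rewrite cmod_of_real real_normK ?num_real.
Qed.

(** The square of the norm of [Q (e i)], for the root [Q] of [T] of order
    [2 ^ j], is [l i] to the power [2 * 2 ^ - j], so the Hilbert-Schmidt bound
    for [Q] controls the sum of these powers. *)
Lemma eigenvalue_power_sum (p : R) : 0 < p -> exists2 K : R, 0 <= K &
  forall (I : eqType) (s : seq I) (e : I -> V) (l : I -> R),
    uniq s -> orthonormal s e ->
    {in s, forall i, 0 < l i /\ T (e i) = of_real (l i) *: e i} ->
    \sum_(i <- s) l i `^ p <= K.
Proof.
move=> p0.
have [j jp] : exists j : nat, 2 ^- j * 2 <= p.
  have [j /= jP] : exists j : nat, 2 / p < j%:R.
    by exists (Num.truncn `|2 / p|).+1; rewrite (le_lt_trans (ler_norm _))// truncnS_gt.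
  exists j; rewrite mulrC ler_pdivrMr ?exprn_gt0// mulrC -ler_pdivrMr//.
  by rewrite ltW// (lt_trans jP)// -natrX ltr_nat ltn_expl.
have [M M0 HM] := poswco_bounded pT.
have [Q [pQ HQ]] := poswco_roots j pT.
have [K HK] := poswco_hilbert_schmidt pQ.
(* the eigenvalues are at most [M + 1], which takes care of the remaining
   power [q] *)
pose q := p - 2 ^- j * 2; have q0 : 0 <= q by rewrite subr_ge0.
exists ((M + 1) `^ q * Num.max K 0).
  by rewrite mulr_ge0 ?powR_ge0// le_max lexx orbT.
move=> I s e l us oe le; have [Fe oij] := oe.
apply: (@le_trans _ _ ((M + 1) `^ q * \sum_(i <- s) fnorm2 (Q (e i)))); last first.
  by apply: ler_wpM2l; [exact: powR_ge0|rewrite le_max HK].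
rewrite mulr_sumr big_seq [leRHS]big_seq; apply: ler_sum => i is_.
have [l0 Te] := le _ is_; have Fi := Fe _ is_.
have e1 : fnorm2 (e i) = 1 by apply: fnorm2_self1; rewrite oij// eqxx.
rewrite (HQ _ _ Fi l0 Te) fnorm2_scale// e1 mulr1.
have lM : l i <= M + 1.
  have [_] := HM _ Fi; rewrite Te fnorm2_scale// e1 !mulr1 => h.
  have [l1|l1] := leP (l i) 1; first by rewrite (le_trans l1)// lerDr.
  by apply: le_trans (_ : M <= _); [apply: le_trans h; rewrite expr2 ler_pMr// ltW|rewrite lerDl].
have -> : l i `^ p = l i `^ q * (l i `^ (2 ^- j)) ^+ 2.
  rewrite -powR_mulrn ?powR_ge0// -powRrM -powRD; last by apply/implyP => _; rewrite gt_eqF.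
  by rewrite /q subrK.
apply: ler_wpM2r; first exact: sqr_ge0.
by apply: ge0_ler_powR => //; rewrite nnegrE ?addr_ge0// ltW.
Qed.

Lemma eigenspace_orthogonal (x y : V) (l l' : R) : F2 x -> F2 y -> l != l' ->
  T x = of_real l *: x -> T y = of_real l' *: y -> ip x y = 0.
Proof.
move=> Fx Fy ll' Tx Ty; have := poswco_selfadjoint pT Fx Fy; rewrite Tx Ty.
rewrite (fock_ipZl (of_real l) Fx Fy) (fock_ipZr (of_real l') Fx Fy) conj_of_real => E.
have : (of_real l - of_real l') * ip x y = 0 by rewrite mulrBl E subrr.
move=> /eqP; rewrite mulf_eq0 => /orP[|/eqP//].
by rewrite subr_eq0 => /eqP[] /eqP; rewrite (negbTE ll').
Qed.

Lemma eigen_lincomb (l : R) (a : cplx R) (x y : V) :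
  eigenvector F2 T l x -> eigenvector F2 T l y -> eigenvector F2 T l (a *: x + y).
Proof.
move=> [Fx Tx] [Fy Ty]; split; first exact: (fock_spaceD (fock_spaceZ a Fx) Fy).
by rewrite poswco_linear// Tx Ty scalerDr !scalerA mulrC.
Qed.

Lemma eigen0 (l : R) : eigenvector F2 T l (fun=> 0).
Proof.
split; first exact: fock_space0.
have T0 : T 0 = 0.
  have := poswco_linear (-1) (0 : V) 0 pT.
  by rewrite scaler0 addr0 scaleN1r addNr.
by rewrite -[fun=> 0]/(0 : V) T0 scaler0.
Qed.

Lemma eigen_orthonormal (l : R) m (f : 'I_m -> V) :
  (forall i, eigenvector F2 T l (f i)) -> linearly_independent f ->
  exists e : nat -> V, (forall i, (i < m)%N -> eigenvector F2 T l (e i)) /\ orthonormal (iota 0 m) e.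
Proof.
apply: orthonormal_family; [by move=> x []|exact: eigen0|exact: eigen_lincomb].
Qed.

(** The bound on the sum of the eigenvalues limits the size of an independent
    family of eigenvectors for [l], so that the supremum is a maximum. *)
Lemma multiplicity_attained (l : R) : 0 < l -> exists m (e : nat -> V),
  [/\ multiplicity F2 T l = m%:R%:E, forall i, (i < m)%N -> eigenvector F2 T l (e i) &
      orthonormal (iota 0 m) e].
Proof.
move=> l0.
pose P m := exists f : 'I_m -> V, (forall i, eigenvector F2 T l (f i)) /\ linearly_independent f.
have [K K0 HK] := eigenvalue_power_sum ltr01.
have bP m : P m -> (m <= Num.truncn (K / l))%N.
  move=> [f [Ef lf]]; have [e [Ee oe]] := eigen_orthonormal Ef lf.
  have : \sum_(i <- iota 0 m) l `^ 1 <= K.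
    apply: (HK _ _ e (fun=> l) (iota_uniq 0 m) oe).
    by move=> i; rewrite mem_iota add0n => /Ee[].
  rewrite big_const_seq count_predT size_iota iter_addr_0 powRr1 ?(ltW l0)// => H.
  by rewrite truncn_ge_nat ?divr_ge0 ?(ltW l0)// ler_pdivlMr// mulr_natl.
have P0 : P 0%N by exists (fun=> 0); split => [[]//|c _ []//].
have [m [Pm mmax]] : exists m, P m /\ forall k, P k -> (k <= m)%N.
  have := @ex_maxnP (fun m => `[< P m >]) (Num.truncn (K / l)).
  have exP : exists m, `[< P m >] by exists 0%N; apply/asboolP.
  have ubP m : `[< P m >] -> (m <= Num.truncn (K / l))%N by move=> /asboolP; exact: bP.
  move=> /(_ exP ubP) [m /asboolP Pm mx]; exists m; split => // k Pk.
  by apply: mx; apply/asboolP.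
have [f [Ef lf]] := Pm; have [e [Ee oe]] := eigen_orthonormal Ef lf.
exists m, e; split => //; apply/eqP; rewrite eq_le; apply/andP; split.
  apply: ge_ereal_sup => _ [k [g [Eg lg ->]]].
  by rewrite lee_fin ler_nat; apply: mmax; exists g.
by apply: ereal_sup_ubound; exists m, f.
Qed.

End eigenvalues.

(** * Summability of the eigenvalues *)

Section schatten_sum.
Variables (R : realType) (n : nat).
Local Notation ip := (@fock_ip R n).
Local Notation F2 := (@fock_space R n).
Local Notation V := (Cn R n -> cplx R).

(** Eigenspaces for distinct eigenvalues are orthogonal, so that bases of
    finitely many of them make up one orthonormal family, to which the uniform
    bound [K] applies. *)
Theorem poswco_schatten_sum (T : V -> V) (p : R) : poswco T -> 0 < p ->
  (\esum_(l in [set l : R | (0 <= l)%R]) (multiplicity F2 T l * (l `^ p)%:E) < +oo)%E.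
Proof.
move=> pT p0; have [K K0 HK] := eigenvalue_power_sum pT p0.
have /choice[D HD] : forall l : R, exists me : nat * (nat -> V), 0 < l ->
    [/\ multiplicity F2 T l = me.1%:R%:E, forall i, (i < me.1)%N -> eigenvector F2 T l (me.2 i) &
      orthonormal (iota 0 me.1) me.2].
  move=> l; have [l0|_] := ltP 0 l; last by exists (0%N, fun=> 0).
  by have [m [e H]] := multiplicity_attained pT l0; exists (m, e).
apply: (@le_lt_trans _ _ K%:E); last by rewrite ltry.
apply: ge_ereal_sup => _ [X [fX XS] <-].
rewrite fsbig_finite//=; set Y : seq R := finmap.enum_fset _.
have uY : uniq Y by exact: finmap.fset_uniq.
have Y0 l : l \in Y -> 0 <= l by rewrite /Y in_fset_set// inE => /XS.
pose Y' := [seq l <- Y | 0 < l].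
pose s := [seq (l, i) | l <- Y', i <- iota 0 (D l).1].
have sP x : x \in s -> 0 < x.1 /\ x.2 \in iota 0 (D x.1).1.
  by move=> /allpairsPdep[l [i [lY il ->]]] /=; move: lY; rewrite mem_filter => /andP[].
have us : uniq s.
  apply: allpairs_uniq_dep; first exact: filter_uniq.
    by move=> l _; exact: iota_uniq.
  by move=> [l i] [l' i'] _ _ /= [-> ->].
have eP x : x \in s -> eigenvector F2 T x.1 ((D x.1).2 x.2).
  by move=> /sP[l0]; rewrite mem_iota add0n => il; have [_ H _] := HD _ l0; exact: H.
have os : orthonormal s (fun x => (D x.1).2 x.2).
  split=> [x /eP[]//|x y xs ys].
  have [Fx Tx] := eP _ xs; have [Fy Ty] := eP _ ys.
  have [lx ix] := sP _ xs; have [ly iy] := sP _ ys.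
  case: x y => [l i] [l' i'] /= in xs ys Fx Tx Fy Ty lx ix ly iy *.
  rewrite xpair_eqE; case: (eqVneq l l') => [ll'|ll'] /=; last first.
    exact: (eigenspace_orthogonal pT Fx Fy ll').
  by subst l'; have [_ _ [_ H]] := HD _ lx; rewrite H.
have H : \sum_(x <- s) x.1 `^ p <= K.
  by apply: (HK _ _ _ (fun x => x.1) us os) => x xs; have [_ ?] := eP _ xs; have [? _] := sP _ xs.
have -> : (\sum_(l <- Y) multiplicity F2 T l * (l `^ p)%:E)%E =
    (\sum_(l <- Y) (if 0 < l then (D l).1%:R * l `^ p else 0)%:E)%E.
  rewrite big_seq [RHS]big_seq; apply: eq_bigr => l lY.
  case: ifP => [l0|/negbT]; first by have [-> _ _] := HD _ l0.
  rewrite -leNgt => l0; have -> : l = 0 by apply/eqP; rewrite eq_le l0 Y0.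
  by rewrite powR0 ?mule0// gt_eqF.
rewrite sumEFin lee_fin -big_mkcond -big_filter; apply: le_trans H.
rewrite /s big_allpairs_dep /=; apply: ler_sum => l _.
by rewrite big_const_seq count_predT size_iota iter_addr_0 mulr_natl.
Qed.

End schatten_sum.

(** * Growth of the symbol of a compact composition operator *)

Section compactness.
Variables (R : realType) (n : nat).
Local Notation ip := (@fock_ip R n).
Local Notation F2 := (@fock_space R n).
Local Notation V := (Cn R n -> cplx R).
Implicit Types (f g y : Cn R n -> cplx R) (z w v : Cn R n) (c : cplx R).

Definition unit_kernel w : V := fun z => of_real (expR (- nsq w / 4)) * kernel w z.

Lemma unit_kernel_fock w : F2 (unit_kernel w).
Proof. exact/fock_spaceZ/kernel_fock. Qed.

Lemma hnorm_unit_kernel w : hnorm ip (unit_kernel w) = 1.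
Proof.
rewrite hnormE fnorm2Z; last exact: kernel_fock.
rewrite fnorm2_kernel cmod_of_real ger0_norm ?expR_ge0// -expRM_natl -expRD.
have -> : 2%:R * (- nsq w / 4) + nsq w / 2 = 0 by field.
by rewrite expR0 sqrtr1.
Qed.

Lemma cmod_unit_kernel w z :
  cmod (unit_kernel w z) = expR (complex.Re (Cn_dot z w) / 2 - nsq w / 4).
Proof.
rewrite cmodM cmod_kernel cmod_of_real ger0_norm ?expR_ge0// -expRD.
congr expR; by field.
Qed.

(** Half of the decay [exp (- |w| ^ 2 / 4)] absorbs the growth of the kernel,
    and the other half is at most [exp (- j)]. *)
Lemma cmod_unit_kernel_le w z (j : nat) : 8 * j%:R <= nsq w ->
  cmod (unit_kernel w z) <= expR (nsq z / 2) * j.+1%:R^-1.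
Proof.
move=> jw; rewrite cmod_unit_kernel.
have t0 : (0 : R) < 2 by [].
have H := Re_dot_le z w t0.
apply: (@le_trans _ _ (expR (nsq z / 2 - j%:R))).
  by rewrite ler_expR; move: H; lra.
rewrite expRD ler_wpM2l ?expR_ge0// expRN lef_pV2 ?posrE ?expR_gt0//.
by rewrite -addn1 natrD addrC expR_ge1Dx.
Qed.

Lemma hnorm_pointwise f w : F2 f -> cmod (f w) <= hnorm ip f * expR (nsq w / 4).
Proof. by rewrite hnormE; exact: fock_pointwise1. Qed.

Variable phi : Cn R n -> Cn R n.
Local Notation T := (composition_operator phi).

(** Otherwise the unit kernels at points [phi (w j)] with [|phi (w j)| >= |w j|]
    and [|phi (w j)| -> oo] contradict compactness: their images tend to 0
    pointwise, hence along a subsequence in norm, while the value of the image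
    at [w j] bounds its norm from below by 1. *)
Lemma compact_composition_growth : compact_operator F2 ip T ->
  exists N, forall w, nsq w <= nsq (phi w) -> nsq (phi w) <= N.
Proof.
move=> [[TF _] cT]; apply: contrapT => /forallNP HN.
have /choice[w Hw] : forall j : nat, exists w, nsq w <= nsq (phi w) /\ 8 * j%:R < nsq (phi w).
  move=> j; apply: contrapT => /forallNP Hj; apply: (HN (8 * j%:R)) => w ww.
  by rewrite leNgt; apply/negP => jw; apply: (Hj w).
pose u j : V := unit_kernel (phi (w j)).
have Fu j : F2 (u j) by exact: unit_kernel_fock.
have [|s [y [ls Fy cv]]] := cT u Fu; first by exists 1 => j; rewrite hnorm_unit_kernel.
have ks k : (k <= s k)%N.
  by elim: k => // k IH; apply: leq_ltn_trans IH (ls _ _ (ltnSn k)).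
have FTu k : F2 (T (u (s k))) by exact: TF.
have y0 : y = 0.
  apply/funext => z; apply: cmod_eq0; apply/eqP; rewrite eq_le cmod_ge0 andbT.
  pose a := expR (nsq (phi z) / 2); pose b := expR (nsq z / 4).
  have L : a * harmonic k + hnorm ip (T (u (s k)) - y) * b @[k --> \oo] --> (0 : R).
    have -> : (0 : R) = a * 0 + 0 * b by rewrite mulr0 mul0r addr0.
    apply: cvgD; apply: cvgM; [exact: cvg_cst|exact: cvg_harmonic|exact: cv|exact: cvg_cst].
  rewrite -(cvg_lim _ L)//; apply: limr_ge; first by apply/cvg_ex; exists 0.
  apply: nearW => k.
  have -> : y z = T (u (s k)) z + - (T (u (s k)) - y) z by rewrite opprB addrC subrK.
  apply: le_trans (cmodD _ _) _; rewrite cmodN; apply: lerD; last first.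
    exact/hnorm_pointwise/fock_spaceB.
  apply: cmod_unit_kernel_le; apply: (@le_trans _ _ (8 * (s k)%:R)).
    by rewrite ler_pM2l// ler_nat.
  by have [_ /ltW] := Hw (s k).
subst y.
suff : 1 <= (0 : R) by rewrite leNgt ltr01.
rewrite -(cvg_lim _ cv)//; apply: limr_ge; first by apply/cvg_ex; exists 0.
apply: nearW => k; rewrite subr0.
have := hnorm_pointwise (w (s k)) (FTu k).
rewrite /T /= cmod_unit_kernel Cn_dot_self /= -ler_pdivrMr ?expR_gt0// -expRN -expRD.
apply: le_trans; rewrite -[leLHS]expR0 ler_expR; have [+ _] := Hw (s k); lra.
Qed.
End compactness.

(** * The symbol is affine and strictly contractive *)

Section affine_symbol.
Variables (R : realType) (n : nat).
Implicit Types (z w u : Cn R n).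

Lemma derive1_slice (f : Cn R n -> cplx R) u : holomorphic f ->
  (fun l : cplx R => f (l *: u))^`()%classic 0 = 'd f 0 u.
Proof.
move=> hf; rewrite -(deriveE _ (hf 0)) /derive1 /derive.
have -> // : (fun h : cplx R => h^-1 *: (f ((h + 0) *: u) - f (0 *: u))) =
  (fun h : cplx R => h^-1 *: ((f \o shift 0) (h *: u) - f 0)).
by apply/funext => h; rewrite /= !addr0 scale0r.
Qed.

Lemma linear_matrix (g : 'I_n -> {linear Cn R n -> cplx R}) :
  exists A : 'M[cplx R]_n, forall u i, (u *m A) ord0 i = g i u.
Proof.
exists (\matrix_(j, i) g i (delta_mx ord0 j)) => u i.
rewrite {2}(row_sum_delta u) linear_sum mxE; apply: eq_bigr => j _.
by rewrite linearZ mxE.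
Qed.

(** On complex lines through the origin the coordinates of [phi] are entire
    functions of one variable of linear growth, hence affine; the slopes are the
    values of the differential of [phi] at 0, which is linear. *)
Lemma nsq_growth_affine (phi : Cn R n -> Cn R n) (N : R) : holomorphic phi ->
  (forall w, nsq (phi w) <= nsq w + N) ->
  exists A, forall z, phi z = z *m A + phi 0.
Proof.
move=> hphi HN.
pose f (i : 'I_n) : Cn R n -> cplx R := fun z => phi z ord0 i.
have hf i : holomorphic (f i) by exact: (holomorphic_comp (holomorphic_coord i) hphi).
have [A HA] := linear_matrix (fun i => 'd (f i) 0).
exists A => u; apply/rowP => i; rewrite [RHS]mxE HA.
have -> : phi u ord0 i = f i (1 *: u) by rewrite scale1r.
rewrite (@linear_growth_affine R (fun l => f i (l *: u)) (Num.sqrt `|N|) (Num.sqrt (nsq u))).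
- by rewrite derive1_slice// mulr1 scale0r addrC.
- by move=> l; exact: holomorphic_slice.
- exact: sqrtr_ge0.
- move=> l; have a0 := sqrtr_ge0 `|N|; have b0 := sqrtr_ge0 (nsq u); have l0 := cmod_ge0 l.
  rewrite -ler_sqr ?nnegrE ?cmod_ge0 ?addr_ge0 ?mulr_ge0//.
  apply: le_trans (cmod_coord_le _ _) _; apply: le_trans (HN _) _.
  rewrite nsqZ sqrrD exprMn !sqr_sqrtr ?normr_ge0 ?nsq_ge0//.
  have := ler_norm N; have := mulr_ge0 a0 (mulr_ge0 b0 l0).
  have -> : cmod l ^+ 2 * nsq u = nsq u * cmod l ^+ 2 by rewrite mulrC.
  lra.
Qed.

(** If [|z A| >= |z|] with [z <> 0], then [w = t z] with a large real [t] of the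
    right sign violates the hypothesis. *)
Lemma bounded_growth_contraction (A : 'M[cplx R]_n) (b : Cn R n) (N : R) :
  (forall w, nsq w <= nsq (w *m A + b) -> nsq (w *m A + b) <= N) -> contraction A.
Proof.
move=> H; apply: contraction_strict => z z0; rewrite ltNge; apply/negP => zA.
have zp : 0 < nsq z.
  by rewrite lt_neqAle nsq_ge0 andbT eq_sym; apply: contra z0 => /eqP/nsq_eq0 ->.
have E (t : R) : nsq ((of_real t *: z) *m A + b) =
    t ^+ 2 * nsq (z *m A) + nsq b + 2 * (t * complex.Re (Cn_dot (z *m A) b)).
  by rewrite nsqD -scalemxAl nsqZ Cn_dotZl cmod_of_real real_normK ?num_real// reimE /= mul0r subr0.
(* the sign of [t] makes the cross term nonnegative *)
have [t tz ct] : exists2 t : R, N < t ^+ 2 * nsq z & 0 <= t * complex.Re (Cn_dot (z *m A) b).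
  pose s := (`|N| + 1) / nsq z + 1.
  have s1 : 1 <= s by rewrite lerDr; apply: divr_ge0; [exact: addr_ge0|exact: ltW].
  have sz : N < s ^+ 2 * nsq z.
    apply: (@lt_le_trans _ _ (s * nsq z)).
      rewrite /s mulrDl divfK ?gt_eqF// mul1r; have := ler_norm N; lra.
    by rewrite ler_pM2r// expr2 ler_peMl// (le_trans ler01).
  have s0 := le_trans ler01 s1.
  have [c0|c0] := leP 0 (complex.Re (Cn_dot (z *m A) b)).
    by exists s => //; apply: mulr_ge0.
  exists (- s); first by rewrite sqrrN.
  by rewrite mulNr oppr_ge0 mulr_ge0_le0// ltW.
have tA : t ^+ 2 * nsq z <= t ^+ 2 * nsq (z *m A) by rewrite ler_wpM2l ?sqr_ge0.
have := H (of_real t *: z); rewrite E nsqZ cmod_of_real real_normK ?num_real//.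
have := nsq_ge0 b => b0.
by move=> /(_ ltac:(lra)); lra.
Qed.

Lemma compact_composition_affine (phi : Cn R n -> Cn R n) : holomorphic phi ->
  compact_operator (@fock_space R n) (@fock_ip R n) (composition_operator phi) ->
  exists2 A, contraction A & forall z, phi z = z *m A + phi 0.
Proof.
move=> hphi cphi; have [N HN] := compact_composition_growth cphi.
have [A HA] : exists A, forall z, phi z = z *m A + phi 0.
  apply: (@nsq_growth_affine _ `|N|) => // w.
  have [wp|/ltW] := leP (nsq w) (nsq (phi w)); last first.
    by move=> /le_trans; apply; rewrite lerDl.
  apply: le_trans (HN w wp) _.
  by apply: le_trans (ler_norm N) _; rewrite lerDr nsq_ge0.
exists A => //; apply: (@bounded_growth_contraction A (phi 0) N) => w.
by rewrite -HA; exact: HN.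
Qed.

End affine_symbol.

(** * The absolute value of the composition operator *)

Section absolute_value.
Variables (R : realType) (n : nat).
Local Notation ip := (@fock_ip R n).
Local Notation F2 := (@fock_space R n).
Local Notation V := (Cn R n -> cplx R).

Lemma poswco_positive_operator (P : V -> V) : poswco P -> positive_operator F2 ip P.
Proof.
move=> pP; split; last first.
  by move=> f Ff; have [x x0 ->] := poswco_ge0 pP Ff; rewrite lecE /= eqxx.
split; first split.
- by move=> f; exact: poswco_fock.
- by move=> a f g _ _; exact: poswco_linear.
have [M M0 HM] := poswco_bounded pP; exists (Num.sqrt M) => f Ff.
rewrite !hnormE -sqrtrM// ler_sqrt; first exact: (HM _ Ff).2.
by rewrite mulr_ge0// fnorm2_ge0.
Qed.

Lemma composition_operator_wco (phi : Cn R n -> Cn R n) A b : (forall z, phi z = z *m A + b) ->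
  composition_operator phi = wco A b 0 1.
Proof.
move=> H; apply/funext => f; apply/funext => z.
by rewrite /composition_operator /wco /kernel Cn_dot0r mulr0 cexp0 !mul1r /= H.
Qed.

(** The eigenvalues of [A^* A] are the numbers [|row i U A^*| ^ 2], less than 1
    because [A^*] is a strict contraction. *)
Lemma poswco_gram (A : 'M[cplx R]_n) (b : Cn R n) : contraction A ->
  poswco (wco (adjmx A *m A) b b 1).
Proof.
move=> /contraction_adjmx cA; have [U uU] := spectral_decomposition (adjmx A).
rewrite adjmxK => ->; have [q /andP[q0 q1] H] := cA.
exists U, (fun i => nsq (row i U *m adjmx A)), b, 1; split=> // i.
by rewrite nsq_ge0 /= (le_lt_trans (H _))// nsq_row_unitary// mulr1.
Qed.

Lemma affine_composition_absolute_value (phi : Cn R n -> Cn R n) A b : contraction A ->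
  (forall z, phi z = z *m A + b) ->
  exists2 P, poswco P & is_absolute_value F2 ip (composition_operator phi) P.
Proof.
move=> cA phiE; rewrite (composition_operator_wco phiE).
have [P [pP PP]] := poswco_root (poswco_gram b cA); exists P => //.
split; first exact: poswco_positive_operator.
exists (wco (adjmx A) 0 b 1).
  split; first by have [M _ H] := wco_bounded 0 b 1 (contraction_adjmx cA) => f /H[].
  by move=> f g Ff Fg; rewrite wco_adjoint// conj1.
move=> f Ff; rewrite PP wco_comp; congr (wco _ _ _ _ f).
- by rewrite mul0mx add0r.
- by rewrite mul0mx addr0.
- by rewrite /kernel Cn_dot0r mulr0 cexp0 !mulr1.
Qed.

End absolute_value.

Theorem theorem2p2 (R : realType) (n : nat) (n_gt0 : (0 < n)%N)
    (phi : Cn R n -> Cn R n) (phi_holo : holomorphic phi)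
    (phi_compact : compact_operator (@fock_space R n) (@fock_ip R n)
                     (composition_operator phi))
    (p : R) (p_gt0 : 0 < p) :
  schatten_class (@fock_space R n) (@fock_ip R n) p (composition_operator phi).
Proof.
split=> //; have [A cA phiE] := compact_composition_affine phi_holo phi_compact.
have [P pP absP] := affine_composition_absolute_value cA phiE.
by exists P; [exact: absP|exact: poswco_schatten_sum].
Qed.
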